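(* Let $B$ be a compact connected Riemann surface, let $U$ be a finite union of disjoint closed discs in $B$, and let $B_0=B\setminus U$. Let $\alpha\in\pi_1(B_0)\setminus\{0\}$. Then there exists $L>0$ with the following property. For any finite subset $S\subset B_0$, there exists a piecewise smooth loop $\gamma\subset B_0\setminus S$ which represents the free homotopy class $\alpha$ in $B_0$ and satisfies $$\mathrm{length}_{d_{B_0\setminus S}}(\gamma)\le L(\#S+1).$$
   Context: For a complex manifold $X$, $d_X$ denotes the intrinsic Kobayashi (pseudo-)hyperbolic metric on $X$. Its infinitesimal form (Kobayashi–Royden) is $\lambda_X(x,v)=\inf \frac{2}{R}$, the infimum being over all $R>0$ for which there is a holomorphic map $h\colon\{z\in\mathbb{C}\colon|z|<R\}\to X$ with $h(0)=x$ and $h'(0)=v$. For a piecewise smooth path $\gamma\colon[0,1]\to X$, $\mathrm{length}_{d_X}(\gamma)=\int_0^1\lambda_X(\gamma(t),\gamma'(t))\,dt$. *)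

(* Defs.v *)
From HB Require Import structures.
From mathcomp Require Import all_boot all_order all_algebra.
From mathcomp Require Import finmap complex.
From mathcomp Require Import all_classical all_reals all_analysis.

Set Implicit Arguments.
Unset Strict Implicit.
Unset Printing Implicit Defensive.

Import Order.TTheory GRing.Theory Num.Theory numFieldNormedType.Exports.

Local Open Scope classical_set_scope.
Local Open Scope ring_scope.
Local Open Scope complex_scope.

(* Going through numClosedFieldType gives R[i] the topology and the normed
   module structure over itself that MathComp-Analysis puts on every
   numFieldType.  Hence, for f : Cplx R -> Cplx R, [derivable f z 1] is complex
   differentiability at z and [derive1 f z] is the complex derivative. *)
Definition Cplx (R : realType) : numClosedFieldType := R[i].

(* Charts are total functions that are only meaningful on [chart_dom c]
   (and their inverses on the image of [chart_dom c]).  Second countability is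
   not required: it is automatic for connected Riemann surfaces. *)
Record riemann_surface (R : realType) (X : topologicalType) := RiemannSurface {
  chart : Type;
  chart_dom : chart -> set X;
  coord : chart -> X -> Cplx R;
  coord_inv : chart -> Cplx R -> X;
  chart_dom_open : forall c, open (chart_dom c);
  chart_img_open : forall c, open (coord c @` chart_dom c);
  coord_continuous : forall c x, chart_dom c x -> {for x, continuous (coord c)};
  coord_inv_continuous : forall c x, chart_dom c x ->
    {for coord c x, continuous (coord_inv c)};
  coordK : forall c x, chart_dom c x -> coord_inv c (coord c x) = x;
  chart_cover : \bigcup_c chart_dom c = [set: X];
  transition_holomorphic : forall c d x, chart_dom c x -> chart_dom d x ->
    derivable (coord d \o coord_inv c) (coord c x) 1;
  surface_hausdorff : hausdorff_space X
}.

Section KobayashiMetric.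
Context {R : realType} {X : topologicalType} (M : riemann_surface R X).
Implicit Types (W : set X) (x : X) (g : R -> X) (h : Cplx R -> X).

(* A tangent vector at x is encoded by its components in all the charts around
   x: [v c] is the component in the chart c, relevant when [chart_dom c x]. *)
Definition tangent := chart M -> Cplx R.

Definition cdisc (r : R) : set (Cplx R) := [set z | `|z| < r%:C].

Definition holomorphic_map (D : set (Cplx R)) h :=
  forall z, D z -> {for z, continuous h} /\
    forall c : chart M, chart_dom c (h z) -> derivable (coord c \o h) z 1.

(* The Kobayashi-Royden metric of the open subset W of X, seen as a Riemann
   surface: a holomorphic map to W is one to X whose values lie in W. *)
Definition kobayashi_royden W x (v : tangent) : \bar R :=
  ereal_inf [set (2 / r)%:E | r in
    [set r : R | 0 < r /\ exists h : Cplx R -> X,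
      [/\ holomorphic_map (cdisc r) h,
          h @` cdisc r `<=` W,
          h 0 = x &
          forall c : chart M, chart_dom c x -> derive1 (coord c \o h) 0 = v c]]].

Definition re_coord (c : chart M) g (t : R) : R := complex.Re (coord c (g t)).
Definition im_coord (c : chart M) g (t : R) : R := complex.Im (coord c (g t)).

Definition velocity g (t : R) : tangent :=
  fun c => derive1 (re_coord c g) t +i* derive1 (im_coord c g) t.

(* For piecewise smooth g, [velocity g t] is meaningless at finitely many t
   (breakpoints, and 0 and 1, outside of which g is arbitrary); these do not
   contribute to the Lebesgue integral. *)
Definition kobayashi_length W g : \bar R :=
  (\int[lebesgue_measure]_(t in `[0%R, 1%R]) kobayashi_royden W (g t) (velocity g t))%E.

Definition smooth_on (D : set R) g :=
  forall t, D t -> {for t, continuous g} /\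
    forall c : chart M, chart_dom c (g t) -> forall n : nat,
      derivable (derive1n n (re_coord c g)) t 1 /\
      derivable (derive1n n (im_coord c g)) t 1.

Definition smooth_on_segment (a b : R) g :=
  exists (e : R) (g' : R -> X),
    [/\ 0 < e, smooth_on `]a - e, b + e[%classic g' &
        forall t, t \in `[a, b] -> g t = g' t].

Definition piecewise_smooth g :=
  exists s : seq R, itv_partition 0 1 s /\
    forall i, (i < size s)%N ->
      smooth_on_segment (nth 1 (0 :: s) i) (nth 1 (0 :: s) i.+1) g.

End KobayashiMetric.

(* Paths are functions on R of which only the restriction to [0, 1] matters. *)
Section Homotopy.
Context {R : realType} {X : topologicalType}.
Implicit Types (W : set X) (b : X) (a g : R -> X) (H : R * R -> X).

Local Notation I := (`[0%R, 1%R]%classic : set R).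

Definition loop_in W g :=
  [/\ {within I, continuous g}, g @` I `<=` W & g 0 = g 1].

Definition homotopy_in W H a g :=
  [/\ {within I `*` I, continuous H},
      H @` (I `*` I) `<=` W,
      forall t, I t -> H (0, t) = a t &
      forall t, I t -> H (1, t) = g t].

Definition path_homotopic W a g := exists H,
  homotopy_in W H a g /\ forall s, I s -> H (s, 0) = a 0 /\ H (s, 1) = a 1.

Definition freely_homotopic W a g := exists H,
  homotopy_in W H a g /\ forall s, I s -> H (s, 0) = H (s, 1).

Definition homotopy_class W a : set (R -> X) := [set g | path_homotopic W a g].

Definition pi1 W b : set (set (R -> X)) :=
  [set homotopy_class W a | a in [set a | loop_in W a /\ a 0 = b]].

Definition pi1_unit W b : set (R -> X) := homotopy_class W (cst b).

(* The free homotopy class of alpha in pi1 W b is that of the loops in alpha. *)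
Definition represents_free_class W (alpha : set (R -> X)) g :=
  exists2 a, alpha a & freely_homotopic W a g.

End Homotopy.

(* A closed disc is a subset homeomorphic to the closed unit disc of C; f and f'
   are mutually inverse homeomorphisms. *)
Definition closed_disc (R : realType) (X : topologicalType) (D : set X) :=
  exists (f : Cplx R -> X) (f' : X -> Cplx R),
    let E := [set z : Cplx R | `|z| <= 1] in
    [/\ f @` E = D,
        {within E, continuous f},
        {within D, continuous f'} &
        forall z, E z -> f' (f z) = z].

(* Main.v *)
(** In a chart, the straight disc through a point at distance [rho] from the punctures
    and from the border of the chart bounds the Kobayashi-Royden metric by
    [2 |w| / rho], and [1 / rho <= 1 / r + sum_p 1 / |z - p|].  Along a horizontal or
    vertical segment the term of [p] integrates to [O (1 + log (1 / d))], with [d] the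
    distance of [p] to the line, which is at most [O (1 + d ^ (- 1 / 2))].  As this is an
    integrable function of the height of the line, averaging over the height gives a
    line on which the terms of all punctures add up to [O (#S + 1)].  Hence the given
    loop can be replaced, between junction points chosen by such an averaging in two
    charts at once, by L-shaped paths in finitely many coordinate boxes that do not
    depend on [S].  The boxes lie in [B0], and in them the loop is homotopic to the new
    path.  For the new path to be smooth in every chart, transition maps must be
    infinitely differentiable, which is Goursat's theorem. *)

(* The cost near a puncture is unbounded, so no point of the new loop can be fixed before [S]; yet
   its homotopy class is prescribed. Therefore the boxes, the cutting times and the constants are
   chosen first, then [S], then the junctions, and the homotopy carries each cutting point of the
   given loop to its junction along a path inside the boxes ([edge]).

   An L-shaped path runs at the height of its first end and then at the abscissa of its last end.
   Its two legs are thus controlled by the two ends alone, and the corner is unconstrained. So it is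
   enough to average over a junction moving on one short segment, where four functions (two
   coordinates in two charts) must be kept away from the punctures at once; no double integral is
   needed.

   The logarithm is replaced by a power because the average is taken over finitely many samples;
   with the exponent -1/2 the resulting sums telescope against square roots.

   The regularity theorem serves twice: for smoothness of chart lines seen in other charts, and for
   continuity of the derivative of a transition map, which keeps the coordinates in the second chart
   moving at positive speed. *)
Require Import Defs.
From HB Require Import structures.
From mathcomp Require Import all_boot all_order all_algebra.
From mathcomp Require Import finmap complex.
From mathcomp Require Import all_classical all_reals all_analysis.
From mathcomp Require Import measurable_realfun.
From mathcomp Require Import ring lra zify.

Import Order.TTheory GRing.Theory Num.Theory numFieldNormedType.Exports.

Set Implicit Arguments.
Unset Strict Implicit.
Unset Printing Implicit Defensive.

Local Open Scope classical_set_scope.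
Local Open Scope ring_scope.

(* [coord] alone would be the coordinate function of vector spaces. *)
Local Notation coord := Defs.coord.

(** * Complex calculus *)

Section ComplexCalculus.
Context {R : realType}.
Local Notation C := (Cplx R).
Local Notation normc := ComplexField.Normc.normc.
Implicit Types (z w h : C) (x y : R) (f g : C -> C).

(* The norm as a real number: [`|z|] itself lives in [Cplx R]. *)
Definition nr z : R := complex.Re `|z|.
Definition rc x : C := (x%:C)%C.
Definition ii : C := ('i)%C.

Lemma nrE z : `|z| = rc (nr z).
Proof. by rewrite /nr /rc; case: z => a b; rewrite normc_def. Qed.

Lemma nr_normc z : nr z = normc z.
Proof. by rewrite /nr; case: z => a b; rewrite normc_def. Qed.

Lemma nr_sqrt z : nr z = Num.sqrt (complex.Re z ^+ 2 + complex.Im z ^+ 2).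
Proof. by rewrite nr_normc; case: z. Qed.

Lemma nrM z w : nr (z * w) = nr z * nr w.
Proof. by rewrite !nr_normc ComplexField.Normc.normcM. Qed.

Lemma nrV z : nr z^-1 = (nr z)^-1.
Proof. by rewrite !nr_normc ComplexField.Normc.normcV. Qed.

Lemma nrN z : nr (- z) = nr z.
Proof. by rewrite !nr_normc normcN. Qed.

Lemma ler_nrD z w : nr (z + w) <= nr z + nr w.
Proof. by rewrite !nr_normc le_normcD. Qed.

Lemma nr_ge0 z : 0 <= nr z.
Proof. by rewrite nr_sqrt sqrtr_ge0. Qed.

Lemma nr0_eq0 z : nr z = 0 -> z = 0.
Proof. by rewrite nr_normc => /ComplexField.Normc.eq0_normc. Qed.

Lemma nr_rc x : nr (rc x) = `|x|.
Proof. by rewrite nr_sqrt /rc /= expr0n addr0 sqrtr_sqr. Qed.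

Lemma nr0 : nr 0 = 0. Proof. by rewrite (nr_rc 0) normr0. Qed.
Lemma nr1 : nr 1 = 1. Proof. by rewrite (nr_rc 1) normr1. Qed.

Lemma nr_gt0 z : z != 0 -> 0 < nr z.
Proof.
move=> z0; rewrite lt_neqAle nr_ge0 andbT eq_sym.
by apply: contra_neq z0; exact: nr0_eq0.
Qed.

Lemma nrB z w : nr (z - w) = nr (w - z).
Proof. by rewrite -nrN opprB. Qed.

Lemma nrX z n : nr (z ^+ n) = nr z ^+ n.
Proof. by elim: n => [|n IH]; rewrite ?expr0 ?nr1// !exprS nrM IH. Qed.

Lemma ler_nrB z w : nr z - nr w <= nr (z - w).
Proof. by rewrite lerBlDr (le_trans _ (ler_nrD _ _)) // subrK. Qed.

Lemma Re_le_nr z : `|complex.Re z| <= nr z.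
Proof. by rewrite nr_sqrt -sqrtr_sqr ler_wsqrtr// lerDl sqr_ge0. Qed.

Lemma Im_le_nr z : `|complex.Im z| <= nr z.
Proof. by rewrite nr_sqrt -sqrtr_sqr ler_wsqrtr// lerDr sqr_ge0. Qed.

Lemma rcB x y : rc (x - y) = rc x - rc y. Proof. exact: raddfB. Qed.
Lemma rc0 : rc 0 = 0. Proof. by []. Qed.
Lemma rc1 : rc 1 = 1. Proof. by []. Qed.

Lemma Re_rc x : complex.Re (rc x) = x. Proof. by []. Qed.
Lemma Im_rc x : complex.Im (rc x) = 0. Proof. by []. Qed.
Lemma Re_ii : complex.Re ii = 0. Proof. by []. Qed.
Lemma Im_ii : complex.Im ii = 1. Proof. by []. Qed.
Lemma ReD z w : complex.Re (z + w) = complex.Re z + complex.Re w.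
Proof. by case: z; case: w. Qed.
Lemma ImD z w : complex.Im (z + w) = complex.Im z + complex.Im w.
Proof. by case: z; case: w. Qed.
Lemma ReN z : complex.Re (- z) = - complex.Re z. Proof. by case: z. Qed.
Lemma ImN z : complex.Im (- z) = - complex.Im z. Proof. by case: z. Qed.
Lemma ReM z w : complex.Re (z * w) =
  complex.Re z * complex.Re w - complex.Im z * complex.Im w.
Proof. by case: z; case: w. Qed.
Lemma ImM z w : complex.Im (z * w) =
  complex.Re z * complex.Im w + complex.Im z * complex.Re w.
Proof. by case: z => a b; case: w => c d /=; rewrite [b * c]mulrC. Qed.
Definition ReImE := (ReD, ImD, ReN, ImN, ReM, ImM, Re_rc, Im_rc, Re_ii, Im_ii).

Lemma ReImP z w : complex.Re z = complex.Re w -> complex.Im z = complex.Im w -> z = w.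
Proof. by case: z; case: w => /= ? ? ? ? -> ->. Qed.

Lemma cE z : z = rc (complex.Re z) + ii * rc (complex.Im z).
Proof. by apply: ReImP; rewrite !ReImE; ring. Qed.

Lemma nr_ii : nr ii = 1.
Proof. by rewrite nr_sqrt Re_ii Im_ii expr0n expr1n add0r sqrtr1. Qed.

Lemma nr_le z : nr z <= `|complex.Re z| + `|complex.Im z|.
Proof. by rewrite {1}(cE z) (le_trans (ler_nrD _ _))// nrM nr_ii mul1r !nr_rc. Qed.

Lemma nr_le_max z e : `|complex.Re z| <= e -> `|complex.Im z| <= e -> nr z <= 2 * e.
Proof. by move=> h1 h2; apply: (le_trans (nr_le _)); lra. Qed.

Definition ccont f z := forall e, 0 < e ->
  exists2 d : R, 0 < d & forall w, nr (w - z) < d -> nr (f w - f z) < e.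

(** First-order expansion without a quotient: [w = z] needs no exception, and errors simply add up
    in the rules of calculus. *)
Definition cderiv f z (l : C) := forall e, 0 < e ->
  exists2 d : R, 0 < d & forall w, nr (w - z) < d ->
    nr (f w - f z - l * (w - z)) <= e * nr (w - z).

Lemma ltC_nr z (e : C) : 0 < e -> (`|z| < e) = (nr z < complex.Re e).
Proof.
move=> e0; rewrite nrE /rc ltcE /= andbC; case: ltP => //= _.
by move: e0; rewrite ltcE /= => /andP[/eqP -> _]; rewrite eqxx.
Qed.

Lemma Re_gt0C (e : C) : 0 < e -> 0 < complex.Re e.
Proof. by rewrite ltcE /= => /andP[]. Qed.

Lemma rc_gt0 x : (0 < rc x) = (0 < x).
Proof. by rewrite /rc ltcE /= eqxx. Qed.

Lemma nbhs_nr z (P : set C) :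
  nbhs z P <-> exists2 d : R, 0 < d & forall w, nr (w - z) < d -> P w.
Proof.
split=> [/nbhs_ballP[e /= e0 eP]|[d d0 dP]].
  exists (complex.Re e); first exact: Re_gt0C.
  by move=> w; rewrite -ltC_nr// => we; apply: eP; rewrite -ball_normE /= distrC.
apply/nbhs_ballP; exists (rc d); first by rewrite /= rc_gt0.
move=> w; rewrite -ball_normE /= distrC ltC_nr ?rc_gt0//; exact: dP.
Qed.

(** Both expansions are tested at one real displacement [r]: two errors of at most a quarter of
    [nr (l - l') * r] cannot add up to [nr (l - l') * r]. *)
Lemma cderiv_unique f z l l' : cderiv f z l -> cderiv f z l' -> l = l'.
Proof.
move=> h h'; apply/eqP; rewrite -subr_eq0; apply: contraT => n0.
have e0 : 0 < nr (l - l') / 4 by rewrite divr_gt0// nr_gt0.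
have [d d0 dP] := h _ e0; have [d' d'0 d'P] := h' _ e0.
set r := Order.min d d' / 2.
have r0 : 0 < r by rewrite divr_gt0// lt_min d0.
have rlt : r < Order.min d d' by rewrite ltr_pdivrMr// ltr_pMr ?lt_min ?d0// ltr1n.
have E : z + rc r - z = rc r by ring.
have nE : nr (z + rc r - z) = r by rewrite E nr_rc gtr0_norm.
have Ml : Order.min d d' <= d by rewrite ge_min lexx.
have Mr : Order.min d d' <= d' by rewrite ge_min lexx orbT.
have := dP (z + rc r); rewrite nE => /(_ (lt_le_trans rlt Ml)).
have := d'P (z + rc r); rewrite nE => /(_ (lt_le_trans rlt Mr)).
move=> A B; have := ler_nrD (f (z + rc r) - f z - l' * (z + rc r - z))
  (- (f (z + rc r) - f z - l * (z + rc r - z))).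
rewrite nrN.
have -> : f (z + rc r) - f z - l' * (z + rc r - z) -
  (f (z + rc r) - f z - l * (z + rc r - z)) = (l - l') * (z + rc r - z) by ring.
rewrite nrM nE; set N := nr (l - l') in e0 A B *.
by move=> D; exfalso; clear -e0 A B D r0; nra.
Qed.

Lemma derivable_cderiv f z : derivable f z 1 -> cderiv f z (derive1 f z).
Proof.
move=> fd e e0.
have /cvg_ex[l fl] := fd.
have fE : derive1 f z = l.
  by rewrite derive1E /derive; apply: cvg_lim.
rewrite {}fE.
have /cvgrPdist_lt/(_ (rc e)) : _ := fl; rewrite rc_gt0 => /(_ e0).
move=> /nbhs_nr[d d0 dP]; exists d => // w wd.
have [->|nz] := eqVneq w z; first by rewrite !subrr mulr0 subr0 nr0 mulr0.
have wz : w - z != 0 by rewrite subr_eq0.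
have := dP (w - z); rewrite subr0 => /(_ wd wz).
rewrite ltC_nr ?rc_gt0// Re_rc => /ltW A.
have -> : f w - f z - l * (w - z) =
  - ((l - (w - z)^-1 *: (f ((w - z) *: 1 + z) - f z)) * (w - z)).
  rewrite /GRing.scale /= mulr1 subrK; field => //.
by rewrite nrN nrM ler_wpM2r// nr_ge0.
Qed.

Lemma cderiv_cvg f z l : cderiv f z l ->
  (fun h => h^-1 *: (f (h *: 1 + z) - f z)) @ (0 : C)^' --> l.
Proof.
move=> h; apply/cvgrPdist_lt => e e0.
have e1 : 0 < complex.Re e / 2 by rewrite divr_gt0// Re_gt0C.
have [d d0 dP] := h _ e1; apply/nbhs_nr; exists d => // w; rewrite subr0 => wd w0.
rewrite /= ltC_nr//.
have E : w + z - z = w by ring.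
have := dP (w + z); rewrite E => /(_ wd) A.
have -> : l - w^-1 *: (f (w *: 1 + z) - f z) = - ((f (w + z) - f z - l * w) / w).
  rewrite /GRing.scale /= mulr1; field => //.
have nw := nr_gt0 w0.
rewrite nrN nrM nrV; apply: (@le_lt_trans _ _ (complex.Re e / 2)).
  by rewrite ler_pdivrMr.
by rewrite ltr_pdivrMr// ltr_pMr ?ltr1n// Re_gt0C.
Qed.

Lemma cderiv_derivable f z l : cderiv f z l -> derivable f z 1 /\ derive1 f z = l.
Proof.
move=> /cderiv_cvg h; split; first by apply/cvg_ex; exists l.
by rewrite derive1E /derive; apply: cvg_lim.
Qed.

Lemma cderiv_ccont f z l : cderiv f z l -> ccont f z.
Proof.
move=> h e e0; have [d d0 dP] := h _ (@ltr01 R).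
have N0 : 0 < 1 + nr l by rewrite ltr_wpDr// nr_ge0.
exists (Order.min d (e / (1 + nr l))); first by rewrite lt_min d0 divr_gt0.
move=> w; rewrite lt_min => /andP[/dP]; rewrite mul1r ltr_pdivlMr// => A B.
apply: le_lt_trans B.
have -> : f w - f z = (f w - f z - l * (w - z)) + l * (w - z) by ring.
by apply: (le_trans (ler_nrD _ _)); rewrite nrM; lra.
Qed.

Lemma cderiv_ext f g z l : (exists2 d : R, 0 < d & forall w, nr (w - z) < d -> f w = g w) ->
  cderiv f z l -> cderiv g z l.
Proof.
move=> [r r0 rE] h e e0; have [d d0 dP] := h _ e0.
exists (Order.min d r); first by rewrite lt_min d0.
move=> w; rewrite lt_min => /andP[A B]; rewrite -!rE//; first exact: dP.
by rewrite subrr nr0.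
Qed.

Lemma cderiv_cst (k : C) z : cderiv (fun=> k) z 0.
Proof. by move=> e e0; exists 1 => // w _; rewrite subrr mul0r subrr nr0 mulr_ge0 ?nr_ge0 ?ltW. Qed.

Lemma cderiv_id z : cderiv id z 1.
Proof. by move=> e e0; exists 1 => // w _; rewrite mul1r subrr nr0 mulr_ge0 ?nr_ge0 ?ltW. Qed.

Lemma cderivD f g z l m : cderiv f z l -> cderiv g z m ->
  cderiv (fun w => f w + g w) z (l + m).
Proof.
move=> hf hg e e0; have e1 : 0 < e / 2 by rewrite divr_gt0.
have [d d0 dP] := hf _ e1; have [d' d'0 d'P] := hg _ e1.
exists (Order.min d d'); first by rewrite lt_min d0.
move=> w; rewrite lt_min => /andP[/dP A /d'P B].
have -> : f w + g w - (f z + g z) - (l + m) * (w - z) =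
  (f w - f z - l * (w - z)) + (g w - g z - m * (w - z)) by ring.
by apply: (le_trans (ler_nrD _ _)); lra.
Qed.

Lemma cderiv_comp f g z l m : cderiv f z l -> cderiv g (f z) m ->
  cderiv (g \o f) z (m * l).
Proof.
move=> hf hg e e0.
have [d1 d10 d1P] := hf _ (@ltr01 R).
have nl := nr_ge0 l; have nm := nr_ge0 m.
have L0 : 0 < 1 + nr l by lra.
have M0 : 0 < 1 + nr m by lra.
have e1 : 0 < e / 2 / (1 + nr l) by rewrite !divr_gt0.
have e2 : 0 < e / 2 / (1 + nr m) by rewrite !divr_gt0.
have [d2 d20 d2P] := hg _ e1; have [d3 d30 d3P] := hf _ e2.
have [d4 d40 d4P] := cderiv_ccont hf d20.
exists (Order.min (Order.min d1 d3) d4); first by rewrite !lt_min d10 d30.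
move=> w; rewrite !lt_min => /andP[/andP[/d1P A /d3P B] /d4P/d2P D] /=.
have -> : g (f w) - g (f z) - m * l * (w - z) =
  (g (f w) - g (f z) - m * (f w - f z)) + m * (f w - f z - l * (w - z)) by ring.
apply: (le_trans (ler_nrD _ _)); rewrite nrM.
have F : nr (f w - f z) <= (1 + nr l) * nr (w - z).
  have -> : f w - f z = (f w - f z - l * (w - z)) + l * (w - z) by ring.
  by apply: (le_trans (ler_nrD _ _)); rewrite nrM; lra.
have G : nr (g (f w) - g (f z) - m * (f w - f z)) <= e / 2 * nr (w - z).
  apply: (le_trans D); rewrite -mulrA ler_pM2l ?divr_gt0//.
  by rewrite mulrC ler_pdivrMr// mulrC.
have H : nr m * nr (f w - f z - l * (w - z)) <= e / 2 * nr (w - z).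
  apply: (@le_trans _ _ ((1 + nr m) * (e / 2 / (1 + nr m) * nr (w - z)))).
    by apply: ler_pM => //; rewrite ?nr_ge0//; lra.
  by rewrite mulrA [_ * (_ / _)]mulrC divfK ?gt_eqF.
by move: G H; clear; lra.
Qed.

Lemma cderivM f g z l m : cderiv f z l -> cderiv g z m ->
  cderiv (fun w => f w * g w) z (l * g z + f z * m).
Proof.
move=> hf hg e e0.
have [d1 d10 d1P] := hf _ (@ltr01 R).
have nl := nr_ge0 l; have nfz := nr_ge0 (f z); have ngz := nr_ge0 (g z).
(* [K] dominates [nr (f z)], [nr (g z)] and the Lipschitz constant of [f] at [z]; each of the three
   error terms then gets a third of [e]. *)
pose K := 1 + nr l + nr (f z) + nr (g z) + 1.
have K0 : 0 < K by rewrite /K; lra.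
have e1 : 0 < e / 3 / K by rewrite !divr_gt0.
have [d2 d20 d2P] := hf _ e1; have [d3 d30 d3P] := hg _ e1.
have [d4 d40 d4P] := cderiv_ccont hg e1.
exists (Order.min (Order.min d1 d2) (Order.min d3 d4)); first by rewrite !lt_min d10 d20 d30.
move=> w; rewrite !lt_min => /andP[/andP[/d1P A /d2P B] /andP[/d3P D /d4P /ltW E]] /=.
have -> : f w * g w - f z * g z - (l * g z + f z * m) * (w - z) =
  ((f w - f z) * (g w - g z) + g z * (f w - f z - l * (w - z)))
   + f z * (g w - g z - m * (w - z)) by ring.
have F : nr (f w - f z) <= K * nr (w - z).
  have -> : f w - f z = (f w - f z - l * (w - z)) + l * (w - z) by ring.
  apply: (le_trans (ler_nrD _ _)); rewrite nrM.
  by have := nr_ge0 (w - z); rewrite /K; nra.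
have eK : e / 3 / K * K = e / 3 by rewrite divfK ?gt_eqF.
set N := nr (w - z) in A B D F *; have N0 : 0 <= N := nr_ge0 _.
have T1 : nr ((f w - f z) * (g w - g z)) <= e / 3 * N.
  rewrite nrM (le_trans (ler_pM (nr_ge0 _) (nr_ge0 _) F E))//.
  by rewrite mulrAC [K * _]mulrC eK.
have T2 : nr (g z * (f w - f z - l * (w - z))) <= e / 3 * N.
  rewrite nrM (@le_trans _ _ (K * (e / 3 / K * N)))//.
    by apply: ler_pM => //; rewrite ?nr_ge0// /K; lra.
  by rewrite mulrA [K * _]mulrC eK.
have T3 : nr (f z * (g w - g z - m * (w - z))) <= e / 3 * N.
  rewrite nrM (@le_trans _ _ (K * (e / 3 / K * N)))//.
    by apply: ler_pM => //; rewrite ?nr_ge0// /K; lra.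
  by rewrite mulrA [K * _]mulrC eK.
apply: (le_trans (ler_nrD _ _)).
by have := ler_nrD ((f w - f z) * (g w - g z)) (g z * (f w - f z - l * (w - z)));
  move: T1 T2 T3; clear; lra.
Qed.

Lemma cderivV z : z != 0 -> cderiv (fun w => w^-1) z (- z ^- 2).
Proof.
move=> z0 e e0; have n0 := nr_gt0 z0.
(* The error is exactly [(w - z) ^+ 2 / (w * z ^+ 2)]. The first bound gives [nr w >= nr z / 2]; the
   second then makes the error at most [e * nr (w - z)]. *)
exists (Order.min (nr z / 2) (e * nr z ^+ 3 / 2)).
  by rewrite lt_min !divr_gt0// mulr_gt0// exprn_gt0.
move=> w; rewrite lt_min => /andP[A B].
have W : nr z / 2 <= nr w.
  by have := ler_nrB z w; rewrite nrB; move: A; clear; lra.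
have w0 : w != 0.
  apply: contraTneq W => ->; rewrite nr0 -ltNge; lra.
have nw := nr_gt0 w0.
have -> : w^-1 - z^-1 - - z ^- 2 * (w - z) = (w - z) ^+ 2 / (w * z ^+ 2).
  by field; rewrite z0 w0.
rewrite nrM nrV nrM !nrX ler_pdivrMr ?mulr_gt0 ?exprn_gt0//.
have : nr z ^+ 3 / 2 <= nr w * nr z ^+ 2.
  by rewrite exprS mulrAC ler_wpM2r// exprn_ge0// ltW.
set X := nr w * _ => Y; rewrite expr2 -mulrA [X in _ <= X]mulrCA.
apply: ler_wpM2l; first exact: nr_ge0.
by apply: (le_trans (ltW B)); rewrite -mulrA ler_pM2l.
Qed.

End ComplexCalculus.

#[global] Opaque rc ii nr.

(** * Cauchy's theorem on rectangles and regularity of holomorphic functions *)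

Section RectangleIntegral.
Context {R : realType}.
Local Notation C := (Cplx R).
Local Notation mu := (@lebesgue_measure R).
Local Notation rc := (@rc R).
Local Notation ii := (@ii R).
Implicit Types (z w : C) (a b t x y e : R) (f g : C -> C) (u v : R -> C).

Definition rcont u t := forall e, 0 < e ->
  exists2 d : R, 0 < d & forall s, `|s - t| < d -> nr (u s - u t) < e.

Definition rcont_on a b u := forall t, a <= t <= b -> rcont u t.

Definition Ic u a b : C :=
  rc (\int[mu]_(t in `[a, b]) complex.Re (u t)) +
  ii * rc (\int[mu]_(t in `[a, b]) complex.Im (u t)).

Lemma Re_Ic u a b : complex.Re (Ic u a b) = \int[mu]_(t in `[a, b]) complex.Re (u t).
Proof. by rewrite /Ic !ReImE; ring. Qed.

Lemma Im_Ic u a b : complex.Im (Ic u a b) = \int[mu]_(t in `[a, b]) complex.Im (u t).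
Proof. by rewrite /Ic !ReImE; ring. Qed.

Opaque Ic.

Lemma nbhs_real x (P : set R) :
  nbhs x P <-> exists2 d : R, 0 < d & forall y, `|y - x| < d -> P y.
Proof.
split=> [/nbhs_ballP[e /= e0 eP]|[d d0 dP]].
  by exists e => // y yx; apply: eP; rewrite -ball_normE /= distrC.
by apply/nbhs_ballP; exists d => // y; rewrite -ball_normE /= distrC; exact: dP.
Qed.

Lemma rcont_Re u t : rcont u t -> {for t, continuous (fun s => complex.Re (u s))}.
Proof.
move=> h A /nbhs_real[e e0 eA]; have [d d0 dP] := h _ e0.
apply/nbhs_real; exists d => // s /dP us; apply: eA.
by apply: le_lt_trans us; rewrite -ReN -ReD Re_le_nr.
Qed.

Lemma rcont_Im u t : rcont u t -> {for t, continuous (fun s => complex.Im (u s))}.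
Proof.
move=> h A /nbhs_real[e e0 eA]; have [d d0 dP] := h _ e0.
apply/nbhs_real; exists d => // s /dP us; apply: eA.
by apply: le_lt_trans us; rewrite -ImN -ImD Im_le_nr.
Qed.

Lemma integrable_itv (h : R -> R) a b :
  (forall t, a <= t <= b -> {for t, continuous h}) ->
  mu.-integrable `[a, b] (EFin \o h).
Proof.
move=> hc; apply: continuous_compact_integrable; first exact: segment_compact.
apply: continuous_in_subspaceT => t; rewrite inE /= in_itv /=; exact: hc.
Qed.

Lemma Re_integrable u a b : rcont_on a b u ->
  mu.-integrable `[a, b] (EFin \o (fun s => complex.Re (u s))).
Proof. by move=> h; apply: integrable_itv => t /h; exact: rcont_Re. Qed.

Lemma Im_integrable u a b : rcont_on a b u ->
  mu.-integrable `[a, b] (EFin \o (fun s => complex.Im (u s))).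
Proof. by move=> h; apply: integrable_itv => t /h; exact: rcont_Im. Qed.

Lemma eq_Ic u v a b : (forall t, a <= t <= b -> u t = v t) -> Ic u a b = Ic v a b.
Proof.
by move=> uv; apply: ReImP; rewrite ?Re_Ic ?Im_Ic; apply: eq_Rintegral => t;
  rewrite inE /= in_itv /= => /uv ->.
Qed.

Lemma IcD u v a b : rcont_on a b u -> rcont_on a b v ->
  Ic (fun t => u t + v t) a b = Ic u a b + Ic v a b.
Proof.
move=> hu hv; apply: ReImP.
  rewrite ReD !Re_Ic -RintegralD//; try exact: Re_integrable.
  by apply: eq_Rintegral => t _; rewrite ReD.
rewrite ImD !Im_Ic -RintegralD//; try exact: Im_integrable.
by apply: eq_Rintegral => t _; rewrite ImD.
Qed.

Lemma rcontZ k u t : rcont u t -> rcont (fun s => k * u s) t.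
Proof.
move=> h e e0; have K : 0 < 1 + nr k by have := nr_ge0 k; lra.
have [d d0 dP] := h (e / (1 + nr k)) (divr_gt0 e0 K); exists d => // s /dP.
rewrite -mulrBr nrM ltr_pdivlMr// mulrC; apply: le_lt_trans.
by rewrite ler_wpM2r ?nr_ge0// lerDr.
Qed.

Lemma integralZ_cont (h : R -> R) k a b : mu.-integrable `[a, b] (EFin \o h) ->
  \int[mu]_(t in `[a, b]) (k * h t) = k * \int[mu]_(t in `[a, b]) h t.
Proof. by move=> hi; rewrite RintegralZl. Qed.

Lemma integrableZ_cont (h : R -> R) k a b : mu.-integrable `[a, b] (EFin \o h) ->
  mu.-integrable `[a, b] (EFin \o (fun t => k * h t)).
Proof.
move=> hi; have := @integrableZl _ _ _ mu `[a, b]%classic (measurable_itv _) k (EFin \o h) hi.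
by apply: eq_integrable.
Qed.

Lemma IcZ k u a b : rcont_on a b u -> Ic (fun t => k * u t) a b = k * Ic u a b.
Proof.
move=> hu; have hr := Re_integrable hu; have hi := Im_integrable hu.
apply: ReImP; rewrite ?ReM ?ImM !(Re_Ic, Im_Ic).
  rewrite -!integralZ_cont// -RintegralB//; try exact: integrableZ_cont.
  by apply: eq_Rintegral => t _; rewrite ReM.
rewrite -!integralZ_cont// -RintegralD//; try exact: integrableZ_cont.
by apply: eq_Rintegral => t _; rewrite ImM.
Qed.

Lemma Rintegral_cat (h : R -> R) a m b : a <= m <= b ->
  mu.-integrable `[a, b] (EFin \o h) ->
  \int[mu]_(t in `[a, b]) h t =
  \int[mu]_(t in `[a, m]) h t + \int[mu]_(t in `[m, b]) h t.
Proof.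
move=> /andP[am mb] hi.
have hi2 : mu.-integrable `[m, b] (EFin \o h).
  apply: integrableS hi => //; apply: subset_itvr; rewrite bnd_simp//.
have hi3 : mu.-integrable `]m, b] (EFin \o h).
  apply: integrableS hi2 => //; apply: subset_itvr; rewrite bnd_simp//.
rewrite -(@Rintegral_itv_obnd_cbnd _ m (BRight b))//.
by rewrite -(@Rintegral_itvB _ h (BLeft a) (BRight b) m)// ?bnd_simp// addrC subrK.
Qed.

Lemma Ic_cat u a m b : a <= m <= b -> rcont_on a b u ->
  Ic u a b = Ic u a m + Ic u m b.
Proof.
move=> amb hu; apply: ReImP.
  by rewrite ReD !Re_Ic; apply: Rintegral_cat => //; exact: Re_integrable.
by rewrite ImD !Im_Ic; apply: Rintegral_cat => //; exact: Im_integrable.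
Qed.

Lemma integral_cst_itv k a b : a <= b -> \int[mu]_(t in `[a, b]) k = k * (b - a).
Proof.
move=> ab; rewrite Rintegral_cst//= lebesgue_measure_itv /= lte_fin.
by case: ltgtP ab => // -> _; rewrite subrr /= mulr0.
Qed.

Lemma integrable_cst_itv k a b : mu.-integrable `[a, b] (EFin \o (fun=> k)).
Proof. by apply: integrable_itv => t _; exact: cst_continuous. Qed.

Lemma Rintegral_itv_ge (h : R -> R) k a b : a <= b ->
  mu.-integrable `[a, b] (EFin \o h) -> (forall t, a <= t <= b -> k <= h t) ->
  k * (b - a) <= \int[mu]_(t in `[a, b]) h t.
Proof.
move=> ab hi hk; rewrite -integral_cst_itv//; apply: le_Rintegral => //.
  exact: integrable_cst_itv.
Qed.

Lemma Rintegral_itv_abs (h : R -> R) k a b : a <= b ->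
  mu.-integrable `[a, b] (EFin \o h) -> (forall t, a <= t <= b -> `|h t| <= k) ->
  `|\int[mu]_(t in `[a, b]) h t| <= k * (b - a).
Proof.
move=> ab hi hk; rewrite ler_norml; apply/andP; split.
  by rewrite -mulNr; apply: Rintegral_itv_ge => // t /hk; rewrite ler_norml => /andP[].
rewrite -integral_cst_itv//; apply: le_Rintegral => //; first exact: integrable_cst_itv.
by move=> t /=; rewrite in_itv /= => /hk; rewrite ler_norml => /andP[].
Qed.

(** The factor 2 comes from bounding the real and imaginary parts separately; the sharp constant is
    irrelevant. *)
Lemma nr_Ic_le u k a b : a <= b -> rcont_on a b u ->
  (forall t, a <= t <= b -> nr (u t) <= k) -> nr (Ic u a b) <= 2 * (k * (b - a)).
Proof.
move=> ab hu uk; apply: nr_le_max; rewrite ?Re_Ic ?Im_Ic; apply: Rintegral_itv_abs => //.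
- exact: Re_integrable.
- by move=> t /uk; apply: le_trans; exact: Re_le_nr.
- exact: Im_integrable.
- by move=> t /uk; apply: le_trans; exact: Im_le_nr.
Qed.

Lemma Re_Ic_ge u k a b : a <= b -> rcont_on a b u ->
  (forall t, a <= t <= b -> k <= complex.Re (u t)) -> k * (b - a) <= complex.Re (Ic u a b).
Proof. by move=> ab hu uk; rewrite Re_Ic; apply: Rintegral_itv_ge => //; exact: Re_integrable. Qed.

Lemma Im_Ic_ge u k a b : a <= b -> rcont_on a b u ->
  (forall t, a <= t <= b -> k <= complex.Im (u t)) -> k * (b - a) <= complex.Im (Ic u a b).
Proof. by move=> ab hu uk; rewrite Im_Ic; apply: Rintegral_itv_ge => //; exact: Im_integrable. Qed.

Lemma integral_id_itv a b : a <= b ->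
  \int[mu]_(t in `[a, b]) t = (b ^+ 2 - a ^+ 2) / 2.
Proof.
rewrite le_eqVlt => /predU1P[->|ab].
  by rewrite set_itv1 Rintegral_set1 subrr mul0r.
have dF x : is_derive x 1 (fun t : R => t ^+ 2 / 2) x.
  apply: is_derive_eq; by rewrite /GRing.scale /=; field.
have cF : continuous (fun t : R => t ^+ 2 / 2).
  by move=> x; apply/differentiable_continuous/derivable1_diffP; apply: (@ex_derive _ _ _ _ _ _ _ (dF x)).
rewrite /Rintegral (@continuous_FTC2 _ id (fun t => t ^+ 2 / 2) a b)//=.
- by rewrite mulrBl.
- by apply: continuous_subspaceT => x; exact: cvg_id.
- split.
  + by move=> x _; apply: (@ex_derive _ _ _ _ _ _ _ (dF x)).
  + exact/cvg_at_right_filter/cF.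
  + exact/cvg_at_left_filter/cF.
- by move=> x _; rewrite derive1E; apply: derive_val.
Qed.

Lemma Ic_cst k a b : a <= b -> Ic (fun=> k) a b = k * rc (b - a).
Proof.
by move=> ab; apply: ReImP; rewrite !(Re_Ic, Im_Ic, ReImE) integral_cst_itv//; ring.
Qed.

Lemma Ic_rc a b : a <= b -> Ic rc a b = rc ((b ^+ 2 - a ^+ 2) / 2).
Proof.
move=> ab; apply: ReImP; rewrite !(Re_Ic, Im_Ic, ReImE).
  by rewrite -integral_id_itv//.
by rewrite (@eq_Rintegral _ _ _ _ _ (fun=> 0)) ?integral_cst_itv ?mul0r.
Qed.

Lemma rcont_cst k t : rcont (fun=> k) t.
Proof. by move=> e e0; exists 1 => // s _; rewrite subrr nr0. Qed.

Lemma rcont_rc t : rcont rc t.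
Proof. by move=> e e0; exists e => // s; rewrite -rcB nr_rc. Qed.

Definition hline y t : C := rc t + ii * rc y.
Definition vline x t : C := rc x + ii * rc t.

(** The counterclockwise contour integral along the border of a rectangle: [dz] is [dt] on
    horizontal sides and [ii * dt] on vertical ones. *)
Definition rct f x0 x1 y0 y1 : C :=
  Ic (fun t => f (hline y0 t)) x0 x1 + ii * Ic (fun t => f (vline x1 t)) y0 y1
  - Ic (fun t => f (hline y1 t)) x0 x1 - ii * Ic (fun t => f (vline x0 t)) y0 y1.

Lemma rctE f x0 x1 y0 y1 : rct f x0 x1 y0 y1 =
  Ic (fun t => f (hline y0 t)) x0 x1 + ii * Ic (fun t => f (vline x1 t)) y0 y1
  - Ic (fun t => f (hline y1 t)) x0 x1 - ii * Ic (fun t => f (vline x0 t)) y0 y1.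
Proof. by []. Qed.

Definition crect x0 x1 y0 y1 w :=
  x0 <= complex.Re w <= x1 /\ y0 <= complex.Im w <= y1.

Definition brect x0 x1 y0 y1 w := crect x0 x1 y0 y1 w /\
  (complex.Re w = x0 \/ complex.Re w = x1 \/ complex.Im w = y0 \/ complex.Im w = y1).

Lemma Re_hline y t : complex.Re (hline y t) = t. Proof. by rewrite /hline !ReImE; ring. Qed.
Lemma Im_hline y t : complex.Im (hline y t) = y. Proof. by rewrite /hline !ReImE; ring. Qed.
Lemma Re_vline x t : complex.Re (vline x t) = x. Proof. by rewrite /vline !ReImE; ring. Qed.
Lemma Im_vline x t : complex.Im (vline x t) = t. Proof. by rewrite /vline !ReImE; ring. Qed.
Definition lineE := (Re_hline, Im_hline, Re_vline, Im_vline).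

Lemma ccont_hline f y t : ccont f (hline y t) -> rcont (fun s => f (hline y s)) t.
Proof.
move=> h e e0; have [d d0 dP] := h _ e0; exists d => // s st; apply: dP.
by rewrite /hline opprD addrACA subrr addr0 -rcB nr_rc.
Qed.

Lemma ccont_vline f x t : ccont f (vline x t) -> rcont (fun s => f (vline x s)) t.
Proof.
move=> h e e0; have [d d0 dP] := h _ e0; exists d => // s st; apply: dP.
by rewrite /vline opprD addrACA subrr add0r -mulrBr -rcB nrM nr_ii mul1r nr_rc.
Qed.

(* [a + ii * b - c - ii * d] is [rct] with the integrals over the sides as variables. *)
Lemma sidesD (a b c d a' b' c' d' : C) :
  a + a' + ii * (b + b') - (c + c') - ii * (d + d') =
  (a + ii * b - c - ii * d) + (a' + ii * b' - c' - ii * d').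
Proof. by ring. Qed.

Lemma sidesZ (k a b c d : C) :
  k * a + ii * (k * b) - k * c - ii * (k * d) = k * (a + ii * b - c - ii * d).
Proof. by ring. Qed.

Lemma sides_hsplit (a a' b c c' d m : C) :
  a + a' + ii * b - (c + c') - ii * d =
  (a + ii * m - c - ii * d) + (a' + ii * b - c' - ii * m).
Proof. by ring. Qed.

Lemma sides_vsplit (a b b' c d d' m : C) :
  a + ii * (b + b') - c - ii * (d + d') =
  (a + ii * b - m - ii * d) + (m + ii * b' - c - ii * d').
Proof. by ring. Qed.

Lemma nr_sides (a b c d : C) (p q : R) : nr a <= p -> nr b <= q -> nr c <= p -> nr d <= q ->
  nr (a + ii * b - c - ii * d) <= 2 * (p + q).
Proof.
move=> ha hb hc hd; have := ler_nrD (a + ii * b - c) (- (ii * d)).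
have := ler_nrD (a + ii * b) (- c); have := ler_nrD a (ii * b).
by rewrite !nrN !nrM nr_ii !mul1r; lra.
Qed.

Section Rect.
Variables x0 x1 y0 y1 : R.
Hypothesis x01 : x0 <= x1.
Hypothesis y01 : y0 <= y1.

Lemma brect_h0 t : x0 <= t <= x1 -> brect x0 x1 y0 y1 (hline y0 t).
Proof. by move=> tx; rewrite /brect /crect !lineE lexx y01 tx; do !split => //; auto. Qed.
Lemma brect_h1 t : x0 <= t <= x1 -> brect x0 x1 y0 y1 (hline y1 t).
Proof. by move=> tx; rewrite /brect /crect !lineE lexx y01 tx; do !split => //; auto. Qed.
Lemma brect_v0 t : y0 <= t <= y1 -> brect x0 x1 y0 y1 (vline x0 t).
Proof. by move=> tx; rewrite /brect /crect !lineE lexx x01 tx; do !split => //; auto. Qed.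
Lemma brect_v1 t : y0 <= t <= y1 -> brect x0 x1 y0 y1 (vline x1 t).
Proof. by move=> tx; rewrite /brect /crect !lineE lexx x01 tx; do !split => //; auto. Qed.

Definition bcont f := forall w, brect x0 x1 y0 y1 w -> ccont f w.

Lemma bcont_lines f : bcont f ->
  [/\ rcont_on x0 x1 (fun t => f (hline y0 t)), rcont_on y0 y1 (fun t => f (vline x1 t)),
      rcont_on x0 x1 (fun t => f (hline y1 t)) & rcont_on y0 y1 (fun t => f (vline x0 t))].
Proof.
move=> h; split=> t ht.
- exact/ccont_hline/h/brect_h0.
- exact/ccont_vline/h/brect_v1.
- exact/ccont_hline/h/brect_h1.
- exact/ccont_vline/h/brect_v0.
Qed.

Lemma eq_rct f g : (forall w, brect x0 x1 y0 y1 w -> f w = g w) ->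
  rct f x0 x1 y0 y1 = rct g x0 x1 y0 y1.
Proof.
move=> fg; rewrite /rct; congr (_ + ii * _ - _ - ii * _); apply: eq_Ic => t ht; apply: fg.
- exact: brect_h0.
- exact: brect_v1.
- exact: brect_h1.
- exact: brect_v0.
Qed.

Lemma rctD f g : bcont f -> bcont g ->
  rct (fun w => f w + g w) x0 x1 y0 y1 = rct f x0 x1 y0 y1 + rct g x0 x1 y0 y1.
Proof.
by move=> /bcont_lines[? ? ? ?] /bcont_lines[? ? ? ?]; rewrite /rct !IcD// sidesD.
Qed.

Lemma rctZ k f : bcont f ->
  rct (fun w => k * f w) x0 x1 y0 y1 = k * rct f x0 x1 y0 y1.
Proof. by move=> /bcont_lines[? ? ? ?]; rewrite /rct !IcZ// sidesZ. Qed.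

Lemma nr_rct_le k f : bcont f -> (forall w, brect x0 x1 y0 y1 w -> nr (f w) <= k) ->
  nr (rct f x0 x1 y0 y1) <= 4 * k * ((x1 - x0) + (y1 - y0)).
Proof.
move=> /bcont_lines[h1 h2 h3 h4] fk; rewrite /rct.
have n1 := nr_Ic_le x01 h1 (fun t ht => fk _ (brect_h0 ht)).
have n2 := nr_Ic_le y01 h2 (fun t ht => fk _ (brect_v1 ht)).
have n3 := nr_Ic_le x01 h3 (fun t ht => fk _ (brect_h1 ht)).
have n4 := nr_Ic_le y01 h4 (fun t ht => fk _ (brect_v0 ht)).
have -> : 4 * k * (x1 - x0 + (y1 - y0)) = 2 * (2 * (k * (x1 - x0)) + 2 * (k * (y1 - y0))) by ring.
exact: nr_sides.
Qed.

(** Computed side by side from the explicit primitives. It allows the first-order part of a function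
    to be subtracted in Goursat's argument. *)
Lemma rct_affine k l : rct (fun w => k + l * w) x0 x1 y0 y1 = 0.
Proof.
have cc : forall w : C, ccont (fun w => w) w by move=> w e e0; exists e.
have ck : forall w : C, ccont (fun=> k) w by move=> w e e0; exists 1 => // ? _; rewrite subrr nr0.
have cl : forall w : C, ccont (fun w => l * w) w.
  by move=> w; apply: cderiv_ccont; apply: cderivM; [exact: cderiv_cst|exact: cderiv_id].
rewrite rctD// ?rctZ//; try by move=> ? ?.
have -> : rct (fun=> k) x0 x1 y0 y1 = 0 by rewrite /rct !Ic_cst//; ring.
have H y a b : a <= b -> Ic (hline y) a b = rc ((b ^+ 2 - a ^+ 2) / 2) + ii * rc y * rc (b - a).
  move=> ab; rewrite /hline IcD ?Ic_rc ?Ic_cst//.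
    by move=> t _; exact: rcont_rc.
  by move=> t _; exact: rcont_cst.
have V x a b : a <= b -> Ic (vline x) a b = rc x * rc (b - a) + ii * rc ((b ^+ 2 - a ^+ 2) / 2).
  move=> ab; rewrite /vline IcD ?IcZ ?Ic_rc ?Ic_cst//.
  - by move=> t _; exact: rcont_rc.
  - by move=> t _; exact: rcont_cst.
  - by move=> t _; apply/rcontZ/rcont_rc.
have -> : rct (fun w => w) x0 x1 y0 y1 = 0.
  have -> : rct (fun w => w) x0 x1 y0 y1 = Ic (hline y0) x0 x1 + ii * Ic (vline x1) y0 y1
    - Ic (hline y1) x0 x1 - ii * Ic (vline x0) y0 y1 by [].
  by rewrite !H// !V//; apply: ReImP; rewrite !ReImE; field.
by rewrite mulr0 addr0.
Qed.

Lemma rct_hsplit f m : x0 <= m <= x1 -> bcont f ->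
  rct f x0 x1 y0 y1 = rct f x0 m y0 y1 + rct f m x1 y0 y1.
Proof.
by move=> hm /bcont_lines[? ? ? ?]; rewrite /rct !(@Ic_cat _ x0 m x1)//; exact: sides_hsplit.
Qed.

Lemma rct_vsplit f m : y0 <= m <= y1 -> bcont f ->
  rct f x0 x1 y0 y1 = rct f x0 x1 y0 m + rct f x0 x1 m y1.
Proof.
by move=> hm /bcont_lines[? ? ? ?]; rewrite /rct !(@Ic_cat _ y0 m y1)//; exact: sides_vsplit.
Qed.
End Rect.
End RectangleIntegral.

#[global] Opaque Ic rct.

(** * Goursat's theorem by bisection *)

Section Goursat.
Context {R : realType}.
Local Notation C := (Cplx R).
Local Notation rc := (@rc R).
Local Notation ii := (@ii R).
Implicit Types (w : C) (x y p q e : R) (f g : C -> C).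

(** Every left end lies below every right end, so the supremum of the left ends is a common
    point. *)
Lemma nested_intervals (a l : nat -> R) : (forall n, 0 <= l n) ->
  (forall n, a n <= a n.+1) -> (forall n, a n.+1 + l n.+1 <= a n + l n) ->
  exists z : R, forall n, a n <= z <= a n + l n.
Proof.
move=> l0 au al.
have am : {homo a : m n / (m <= n)%N >-> m <= n}.
  by apply: homo_leq => //; exact: le_trans.
have bm : {homo (fun n => - (a n + l n)) : m n / (m <= n)%N >-> m <= n}.
  by apply: homo_leq => //; [exact: le_trans|move=> n; rewrite lerN2].
have ab m n : a m <= a n + l n.
  apply: (@le_trans _ _ (a (maxn m n))); first by apply: am; rewrite leq_maxl.
  apply: (@le_trans _ _ (a (maxn m n) + l (maxn m n))); first by rewrite lerDl.
  by rewrite -lerN2; apply: bm; rewrite leq_maxr.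
exists (sup (range a)) => n; apply/andP; split.
  by apply: ub_le_sup; [exists (a 0%N + l 0%N) => _ [m _ <-]; exact: ab|exists n].
by apply: ge_sup; [exists (a 0%N), 0%N|move=> _ [m _ <-]; exact: ab].
Qed.

Lemma dist_itv_le (a l x y : R) : a <= x <= a + l -> a <= y <= a + l -> `|x - y| <= l.
Proof. by move=> /andP[? ?] /andP[? ?]; rewrite ler_norml; apply/andP; split; lra. Qed.

Lemma exists_pow2_lt x e : 0 <= x -> 0 < e -> exists n : nat, x / 2 ^+ n < e.
Proof.
move=> x0 e0; exists (Num.bound (x / e)).
have h := archi_boundP (divr_ge0 x0 (ltW e0)).
rewrite ltr_pdivrMr ?exprn_gt0// mulrC -ltr_pdivrMr//.
by apply: (lt_le_trans h); rewrite -natrX ler_nat ltnW// ltn_expl.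
Qed.

Lemma ler_nrD4 (z1 z2 z3 z4 : C) e : nr z1 <= e -> nr z2 <= e -> nr z3 <= e ->
  nr z4 <= e -> nr (z1 + z2 + (z3 + z4)) <= 4 * e.
Proof.
move=> h1 h2 h3 h4; have := ler_nrD (z1 + z2) (z3 + z4).
by have := ler_nrD z1 z2; have := ler_nrD z3 z4; lra.
Qed.

Local Notation box f x y p q := (rct f x (x + p) y (y + q)).

Lemma crect_sub x p y q x' p' y' q' w : x <= x' -> x' + p' <= x + p ->
  y <= y' -> y' + q' <= y + q ->
  crect x' (x' + p') y' (y' + q') w -> crect x (x + p) y (y + q) w.
Proof. by move=> ? ? ? ? [/andP[? ?] /andP[? ?]]; split; apply/andP; split; lra. Qed.

(** The integral is the sum over the four quarters, so they cannot all be at most [e / 4]. *)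
Lemma quarter f x y p q e : 0 <= p -> 0 <= q ->
  (forall w, crect x (x + p) y (y + q) w -> ccont f w) -> e < nr (box f x y p q) ->
  exists x' y', [/\ x <= x' <= x + p / 2, y <= y' <= y + q / 2 &
    e / 4 < nr (box f x' y' (p / 2) (q / 2))].
Proof.
move=> p0 q0 fc.
have p2 : 0 <= p / 2 by rewrite divr_ge0.
have q2 : 0 <= q / 2 by rewrite divr_ge0.
have Ep : x + p = (x + p / 2) + p / 2 by rewrite -addrA -splitr.
have Eq : y + q = (y + q / 2) + q / 2 by rewrite -addrA -splitr.
have sub x0 x1 y0 y1 : x <= x0 -> x1 <= x + p -> y <= y0 -> y1 <= y + q ->
    bcont x0 x1 y0 y1 f.
  move=> ? ? ? ? w [[/andP[? ?] /andP[? ?]] _]; apply: fc; split; apply/andP; split; lra.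
have -> : box f x y p q = box f x y (p / 2) (q / 2) + box f x (y + q / 2) (p / 2) (q / 2)
   + (box f (x + p / 2) y (p / 2) (q / 2) + box f (x + p / 2) (y + q / 2) (p / 2) (q / 2)).
  have H1 : box f x y p q = rct f x (x + p / 2) y (y + q) + rct f (x + p / 2) (x + p) y (y + q).
    by apply: rct_hsplit; [lra|lra|lra|apply: sub; lra].
  have H2 : rct f x (x + p / 2) y (y + q) =
      rct f x (x + p / 2) y (y + q / 2) + rct f x (x + p / 2) (y + q / 2) (y + q).
    by apply: rct_vsplit; [lra|lra|lra|apply: sub; lra].
  have H3 : rct f (x + p / 2) (x + p) y (y + q) =
      rct f (x + p / 2) (x + p) y (y + q / 2) + rct f (x + p / 2) (x + p) (y + q / 2) (y + q).
    by apply: rct_vsplit; [lra|lra|lra|apply: sub; lra].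
  by rewrite H1 H2 H3 -Ep -Eq.
move=> h; apply: contrapT => no.
have no' x' y' : x <= x' <= x + p / 2 -> y <= y' <= y + q / 2 ->
    nr (box f x' y' (p / 2) (q / 2)) <= e / 4.
  by move=> hx hy; rewrite leNgt; apply/negP => ?; apply: no; exists x', y'.
have i1 : x <= x <= x + p / 2 by rewrite lexx lerDl.
have i2 : x <= x + p / 2 <= x + p / 2 by rewrite lexx lerDl p2.
have j1 : y <= y <= y + q / 2 by rewrite lexx lerDl.
have j2 : y <= y + q / 2 <= y + q / 2 by rewrite lexx lerDl q2.
by have := ler_nrD4 (no' _ _ i1 j1) (no' _ _ i1 j2) (no' _ _ i2 j1) (no' _ _ i2 j2); rewrite [4 * _]mulrC divfK// leNgt h.
Qed.

(** Were the integral nonzero, nested boxes would carry more than [e / 4 ^+ n]. Near their common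
    point [f] is affine up to a small multiple of the distance; the affine part integrates to 0 and
    the rest to a small multiple of diameter times perimeter, itself of order [1 / 4 ^+ n]. *)
Lemma goursat f x y p q : 0 <= p -> 0 <= q ->
  (forall w, crect x (x + p) y (y + q) w -> exists l, cderiv f w l) ->
  box f x y p q = 0.
Proof.
move=> p0 q0 fd; apply: nr0_eq0; apply/eqP; apply: contraT => nz.
have fc w : crect x (x + p) y (y + q) w -> ccont f w by move=> /fd[l]; exact: cderiv_ccont.
set N := nr (box f x y p q) in nz.
have N0 : 0 < N by rewrite lt_neqAle eq_sym nz nr_ge0.
pose e := N / 2.
have e0 : 0 < e by rewrite divr_gt0.
pose P (n : nat) (s : R * R) := [/\ x <= s.1, s.1 + p / 2 ^+ n <= x + p, y <= s.2,
  s.2 + q / 2 ^+ n <= y + q & e / 4 ^+ n < nr (box f s.1 s.2 (p / 2 ^+ n) (q / 2 ^+ n))].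
have pn (r : R) n : r / 2 ^+ n / 2 = r / 2 ^+ n.+1.
  by rewrite exprS invfM mulrA mulrAC.
(* The hypothesis sits under the existential so that [choice] yields a total function, with an
   arbitrary value at pairs violating [P]. *)
have step (ns : nat * (R * R)) : exists s' : R * R, P ns.1 ns.2 ->
    [/\ P ns.1.+1 s', ns.2.1 <= s'.1, s'.1 + p / 2 ^+ ns.1.+1 <= ns.2.1 + p / 2 ^+ ns.1,
    ns.2.2 <= s'.2 & s'.2 + q / 2 ^+ ns.1.+1 <= ns.2.2 + q / 2 ^+ ns.1].
  case: ns => n [u v] /=.
  case: (pselect (P n (u, v))) => [|no]; last by exists (u, v).
  move=> [/= h1 h2 h3 h4 h5].
  have pp : 0 <= p / 2 ^+ n by rewrite divr_ge0// exprn_ge0.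
  have qq : 0 <= q / 2 ^+ n by rewrite divr_ge0// exprn_ge0.
  have [|x' [y' [/andP[a1 a2] /andP[b1 b2] c]]] := quarter pp qq _ h5.
    by move=> w; move/(crect_sub h1 h2 h3 h4); exact: fc.
  rewrite !pn in a2 b2 c.
  have pE := splitr (p / 2 ^+ n); have qE := splitr (q / 2 ^+ n).
  rewrite !pn in pE qE.
  have t1 : x' + p / 2 ^+ n.+1 <= u + p / 2 ^+ n by rewrite pE addrA lerD2r.
  have t2 : y' + q / 2 ^+ n.+1 <= v + q / 2 ^+ n by rewrite qE addrA lerD2r.
  exists (x', y') => _ /=; split => //; split => /=.
  - exact: le_trans a1.
  - exact: le_trans h2.
  - exact: le_trans b1.
  - exact: le_trans h4.
  - suff -> : e / 4 ^+ n.+1 = e / 4 ^+ n / 4 by [].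
    by rewrite exprS invfM mulrA mulrAC.
have {step}[F FP] := choice step.
pose s := fix s n := match n with 0%N => (x, y) | m.+1 => F (m, s m) end.
have sP n : P n (s n).
  elim: n => [|n /(FP (n, _))[]//].
  split => //=; rewrite expr0 ?divr1 ?lexx//.
  by rewrite -/N ltr_pdivrMr// ltr_pMr// ltr1n.
have [zx zxP] : exists z, forall n, (s n).1 <= z <= (s n).1 + p / 2 ^+ n.
  apply: nested_intervals => n; first by rewrite divr_ge0 ?exprn_ge0.
  - by have [] := FP (n, s n) (sP n).
  - by have [] := FP (n, s n) (sP n).
have [zy zyP] : exists z, forall n, (s n).2 <= z <= (s n).2 + q / 2 ^+ n.
  apply: nested_intervals => n; first by rewrite divr_ge0 ?exprn_ge0.
  - by have [] := FP (n, s n) (sP n).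
  - by have [] := FP (n, s n) (sP n).
pose z := hline zy zx.
have [l lP] : exists l, cderiv f z l.
  apply: fd; rewrite /crect !lineE; have := zxP 0%N; have := zyP 0%N.
  by rewrite /= expr0 !divr1.
have pq1 : 0 < p + q + 1 by lra.
(* With this tolerance the estimate becomes [e / 4 ^+ n] times [(p + q) ^+ 2 / (p + q + 1) ^+ 2];
   the added 1 covers the degenerate box [p = q = 0]. *)
have e1 : 0 < e / (4 * (p + q + 1) ^+ 2) by rewrite divr_gt0// mulr_gt0// exprn_gt0.
have [d d0 dP] := lP _ e1.
have [n nP] := exists_pow2_lt (addr_ge0 p0 q0) d0.
have [h1 h2 h3 h4 h5] := sP n.
set u := (s n).1 in h1 h2 h5; set v := (s n).2 in h3 h4 h5.
have pp : 0 <= p / 2 ^+ n by rewrite divr_ge0// exprn_ge0.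
have qq : 0 <= q / 2 ^+ n by rewrite divr_ge0// exprn_ge0.
have zb w : brect u (u + p / 2 ^+ n) v (v + q / 2 ^+ n) w -> nr (w - z) <= (p + q) / 2 ^+ n.
  move=> [[/andP[wa wb] /andP[wc wd]] _]; apply: (le_trans (nr_le _)).
  rewrite ReD ImD ReN ImN /z !lineE mulrDl.
  by apply: lerD; [apply: (dist_itv_le _ (zxP n))|apply: (dist_itv_le _ (zyP n))]; apply/andP.
have bc : bcont u (u + p / 2 ^+ n) v (v + q / 2 ^+ n) f.
  by move=> w [wr _]; apply: fc; exact: crect_sub wr.
have ca k m (w : C) : ccont (fun w => k + m * w) w.
  apply: cderiv_ccont; apply: cderivD; first exact: cderiv_cst.
  by apply: cderivM; [exact: cderiv_cst|exact: cderiv_id].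
have xu : u <= u + p / 2 ^+ n by rewrite lerDl.
have yv : v <= v + q / 2 ^+ n by rewrite lerDl.
pose k := - (f z - l * z).
have E1 : rct f u (u + p / 2 ^+ n) v (v + q / 2 ^+ n) =
   rct (fun w => f w + (k + (- l) * w)) u (u + p / 2 ^+ n) v (v + q / 2 ^+ n).
  by rewrite (rctD xu yv bc (fun w _ => ca _ _ w)) rct_affine ?addr0.
have E2 : nr (rct f u (u + p / 2 ^+ n) v (v + q / 2 ^+ n)) <=
   4 * (e / (4 * (p + q + 1) ^+ 2) * ((p + q) / 2 ^+ n)) * ((u + p / 2 ^+ n - u) + (v + q / 2 ^+ n - v)).
  rewrite E1; apply: (nr_rct_le xu yv).
    move=> w wb; have [l' hl'] := fd _ (crect_sub h1 h2 h3 h4 wb.1).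
    apply: cderiv_ccont; apply: (cderivD hl').
    apply: cderivD; first exact: cderiv_cst.
    by apply: cderivM; [exact: cderiv_cst|exact: cderiv_id].
  move=> w wb; have -> : f w + (k + - l * w) = f w - f z - l * (w - z) by rewrite /k; ring.
  apply: (le_trans (dP _ _)); first by apply: le_lt_trans nP; exact: zb.
  by apply: ler_wpM2l; [exact: ltW|exact: zb].
suff : nr (box f u v (p / 2 ^+ n) (q / 2 ^+ n)) <= e / 4 ^+ n by rewrite leNgt h5.
apply: (le_trans E2); rewrite ![_ + _ - _]addrAC !subrr !add0r.
have -> : p / 2 ^+ n + q / 2 ^+ n = (p + q) / 2 ^+ n by rewrite mulrDl.
have f4 : (4 : R) ^+ n = 2 ^+ n * 2 ^+ n by rewrite -exprMn -natrM.
have t0 : (0 : R) < 2 ^+ n by rewrite exprn_gt0.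
rewrite f4.
have -> : 4 * (e / (4 * (p + q + 1) ^+ 2) * ((p + q) / 2 ^+ n)) * ((p + q) / 2 ^+ n)
  = e / (2 ^+ n * 2 ^+ n) * ((p + q) ^+ 2 / (p + q + 1) ^+ 2).
  by field; rewrite !gt_eqF.
rewrite ler_piMr ?divr_ge0 ?mulr_ge0 ?ltW//.
rewrite ltr_pdivrMr ?exprn_gt0// mul1r.
by clear -p0 q0; nra.
Qed.
End Goursat.

(** * Cauchy's formula on a square and differentiability of the derivative *)

Section CauchyFormula.
Context {R : realType}.
Local Notation C := (Cplx R).
Local Notation rc := (@rc R).
Local Notation ii := (@ii R).
Implicit Types (z w h l : C) (x y s e : R) (f g : C -> C).

Lemma ccontM f g z : (exists l, cderiv f z l) -> (exists l, cderiv g z l) ->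
  ccont (fun w => f w * g w) z.
Proof. by move=> [l hl] [m hm]; apply: cderiv_ccont; exact: cderivM hl hm. Qed.

Lemma ccontD f g z : ccont f z -> ccont g z -> ccont (fun w => f w + g w) z.
Proof.
move=> hf hg e e0; have e2 : 0 < e / 2 by rewrite divr_gt0.
have [d d0 dP] := hf _ e2; have [d' d'0 d'P] := hg _ e2.
exists (Order.min d d'); first by rewrite lt_min d0.
move=> w; rewrite lt_min => /andP[/dP A /d'P B].
have -> : f w + g w - (f z + g z) = (f w - f z) + (g w - g z) by ring.
by apply: (le_lt_trans (ler_nrD _ _)); lra.
Qed.

Lemma ccontZ k f z : ccont f z -> ccont (fun w => k * f w) z.
Proof.
move=> h e e0; have K : 0 < 1 + nr k by have := nr_ge0 k; lra.
have [d d0 dP] := h (e / (1 + nr k)) (divr_gt0 e0 K); exists d => // s /dP.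
rewrite -mulrBr nrM ltr_pdivlMr// mulrC; apply: le_lt_trans.
by rewrite ler_wpM2r ?nr_ge0// lerDr.
Qed.

Lemma cderiv_inv_sub z w : w != z -> cderiv (fun v => (v - z)^-1) w (- (w - z) ^- 2).
Proof.
move=> wz; have h : cderiv (fun v => v + (- z)) w (1 + 0).
  by apply: cderivD; [exact: cderiv_id|exact: cderiv_cst].
have wz0 : w - z != 0 by rewrite subr_eq0.
by have := cderiv_comp h (cderivV wz0); rewrite addr0 mulr1.
Qed.

Lemma goursat_rct f x0 x1 y0 y1 : x0 <= x1 -> y0 <= y1 ->
  (forall w, crect x0 x1 y0 y1 w -> exists l, cderiv f w l) -> rct f x0 x1 y0 y1 = 0.
Proof.
move=> hx hy fd; have Ex : x0 + (x1 - x0) = x1 by rewrite addrC subrK.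
have Ey : y0 + (y1 - y0) = y1 by rewrite addrC subrK.
have := @goursat R f x0 y0 (x1 - x0) (y1 - y0).
by rewrite Ex Ey !subr_ge0; apply.
Qed.

Lemma small_nr0 (v : C) (k d : R) : 0 < d -> (forall e, 0 < e -> e < d -> nr v <= k * e) -> v = 0.
Proof.
move=> d0 h; apply: nr0_eq0; apply/eqP; apply: contraT => v0.
have n0 : 0 < nr v by rewrite lt_neqAle eq_sym v0 nr_ge0.
have k0 : 0 < `|k| + 1 by rewrite ltr_wpDl.
pose e := Order.min (d / 2) (nr v / (`|k| + 1) / 2).
have e0 : 0 < e by rewrite lt_min !divr_gt0.
have ed : e < d by rewrite gt_min ltr_pdivrMr// ltr_pMr// ltr1n.
have := h _ e0 ed; rewrite leNgt => /negP[].
apply: (@le_lt_trans _ _ ((`|k| + 1) * e)).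
  by rewrite ler_pM2r// (le_trans (ler_norm _))// lerDl.
apply: (@le_lt_trans _ _ ((`|k| + 1) * (nr v / (`|k| + 1) / 2))).
  by rewrite ler_pM2l// ge_min lexx orbT.
rewrite mulrA [_ * (_ / _)]mulrC divfK ?gt_eqF//.
by rewrite ltr_pdivrMr// ltr_pMr// ltr1n.
Qed.

Section Square.
Variables (a b s : R).
Hypothesis s0 : 0 < s.
Local Notation z0 := (hline b a).
Local Notation sq f := (rct f (a - s) (a + s) (b - s) (b + s)).
Local Notation bd := (@brect R (a - s) (a + s) (b - s) (b + s)).

Lemma bd_far z w : bd w -> nr (z - z0) < s / 2 -> s / 2 <= nr (w - z).
Proof.
move=> [[/andP[h1 h2] /andP[h3 h4]] hw] zz.
have hr := le_lt_trans (Re_le_nr _) zz; have hi := le_lt_trans (Im_le_nr _) zz.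
move: hr hi; rewrite ReD ImD ReN ImN !lineE !ltr_norml => /andP[r1 r2] /andP[i1 i2].
have hr := Re_le_nr (w - z); have hi := Im_le_nr (w - z).
move: hr hi; rewrite ReD ImD ReN ImN !ler_norml => /andP[r3 r4] /andP[i3 i4].
by case: hw => [|[|[|]]] E; rewrite E in h1 h2 h3 h4 r3 r4 i3 i4; lra.
Qed.

Lemma bd_near z w : bd w -> nr (z - z0) < s / 2 -> nr (w - z) <= 3 * s.
Proof.
move=> [[/andP[h1 h2] /andP[h3 h4]] _] zz.
have -> : w - z = (w - z0) - (z - z0) by ring.
have := ler_nrD (w - z0) (- (z - z0)); rewrite nrN.
have := nr_le (w - z0); rewrite ReD ImD ReN ImN !lineE.
have : `|complex.Re w - a| <= s by rewrite ler_norml; apply/andP; split; lra.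
have : `|complex.Im w - b| <= s by rewrite ler_norml; apply/andP; split; lra.
move: zz; have := s0; clear; lra.
Qed.

Lemma bd_neq z w : bd w -> nr (z - z0) < s / 2 -> w != z.
Proof.
move=> wb zz; have := bd_far wb zz; apply: contraTneq => ->.
by rewrite subrr nr0 -ltNge divr_gt0.
Qed.

Lemma near_box z : nr (z - z0) < s / 2 ->
  (a - s / 2 < complex.Re z < a + s / 2) /\ (b - s / 2 < complex.Im z < b + s / 2).
Proof.
move=> zz.
have hr := le_lt_trans (Re_le_nr _) zz; have hi := le_lt_trans (Im_le_nr _) zz.
move: hr hi; rewrite ReD ImD ReN ImN !lineE !ltr_norml => /andP[r1 r2] /andP[i1 i2].
by split; apply/andP; split; lra.
Qed.

Local Notation holo f := (forall w, crect (a - s) (a + s) (b - s) (b + s) w -> exists l, cderiv f w l).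

(** The difference quotient is holomorphic off [z] and bounded near [z]. By Goursat the integral
    equals that over a square of half-side [e] around [z], which is of the order of its
    perimeter. *)
Lemma quotient_rct0 f z : holo f -> nr (z - z0) < s / 2 ->
  sq (fun w => (f w - f z) * (w - z)^-1) = 0.
Proof.
move=> hf zz; set g := fun w => _.
have [/andP[r1 r2] /andP[i1 i2]] := near_box zz.
have [x xE] : exists x, complex.Re z = x by exists (complex.Re z).
have [y yE] : exists y, complex.Im z = y by exists (complex.Im z).
rewrite xE in r1 r2; rewrite yE in i1 i2.
have zr : crect (a - s) (a + s) (b - s) (b + s) z.
  by split; rewrite ?xE ?yE; apply/andP; split; lra.
have gd w : crect (a - s) (a + s) (b - s) (b + s) w -> w != z -> exists l, cderiv g w l.
  move=> wr wz; have [l hl] := hf _ wr.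
  have h1 : cderiv (fun v => f v + (- f z)) w (l + 0) by apply: cderivD => //; exact: cderiv_cst.
  by eexists; exact: (cderivM h1 (cderiv_inv_sub wz)).
have [l hl] := hf _ zr.
have [d d0 dP] := hl _ (@ltr01 R).
have M0 : 0 <= nr l + 1 by have := nr_ge0 l; lra.
(* The expansion with tolerance 1 bounds the quotient; at [w = z] its value is 0, as both factors
   vanish ([0^-1 = 0]). *)
have gM w : nr (w - z) < d -> nr (g w) <= nr l + 1.
  move=> wz; have [->|nz] := eqVneq w z; first by rewrite /g !subrr mul0r nr0.
  have p0 : 0 < nr (w - z) by rewrite nr_gt0// subr_eq0.
  rewrite /g nrM nrV ler_pdivrMr//.
  have -> : f w - f z = (f w - f z - l * (w - z)) + l * (w - z) by ring.
  apply: (le_trans (ler_nrD _ _)); rewrite nrM.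
  by move: (dP _ wz) => H; rewrite mulrDl addrC lerD2l.
pose m := Order.min (d / 2) (s / 2).
have m0 : 0 < m by rewrite lt_min !divr_gt0.
apply: (@small_nr0 _ (16 * (nr l + 1)) m) => // e e0 em.
have ed : e < d / 2 by apply: (lt_le_trans em); rewrite ge_min lexx.
have es : e < s / 2 by apply: (lt_le_trans em); rewrite ge_min lexx orbT.
have x1 : a - s <= x - e by lra.
have x2 : x - e <= x + e by lra.
have x3 : x + e <= a + s by lra.
have y1 : b - s <= y - e by lra.
have y2 : y - e <= y + e by lra.
have y3 : y + e <= b + s by lra.
have G x0 x1' y0 y1' : a - s <= x0 -> x0 <= x1' -> x1' <= a + s -> b - s <= y0 -> y0 <= y1' ->
    y1' <= b + s -> (x1' < x \/ x < x0 \/ y1' < y \/ y < y0) -> rct g x0 x1' y0 y1' = 0.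
  move=> h1 h2 h3 h4 h5 h6 h7; apply: goursat_rct => // w [/andP[w1 w2] /andP[w3 w4]].
  apply: gd; first by split; apply/andP; split; apply: le_trans; eassumption.
  by apply: contraPneq h7 => E; rewrite E in w1 w2 w3 w4; rewrite xE in w1 w2; rewrite yE in w3 w4; lra.
have BC x0 x1' y0 y1' : a - s <= x0 -> x1' <= a + s -> b - s <= y0 ->
    y1' <= b + s -> (x0 < x < x1' /\ y0 < y < y1') -> bcont x0 x1' y0 y1' g.
  move=> h1 h3 h4 h6 [/andP[u1 u2] /andP[u3 u4]] w [[/andP[w1 w2] /andP[w3 w4]] wb].
  have wr : crect (a - s) (a + s) (b - s) (b + s) w.
    by split; apply/andP; split; apply: le_trans; eassumption.
  have wn : w != z by apply: contraPneq wb => ->; rewrite xE yE; lra.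
  by have [l' hl'] := gd w wr wn; exact: cderiv_ccont hl'.
have s0' := s0; have xs : a - s <= a + s by lra.
have ys : b - s <= b + s by lra.
have xs2 : x - e <= a + s by lra.
(* Four cuts remove the left, right, lower and upper strips. None of them contains [z], so each
   contributes 0. *)
have -> : sq g = rct g (x - e) (x + e) (y - e) (y + e).
  rewrite (@rct_hsplit R _ _ _ _ xs ys g (x - e)); last 2 first.
  - by apply/andP; split; lra.
  - by apply: BC; rewrite ?lexx//; split; apply/andP; split; lra.
  rewrite (G (a - s) (x - e)) ?lexx//; last by lra.
  rewrite add0r (@rct_hsplit R _ _ _ _ xs2 ys g (x + e)); last 2 first.
  - by apply/andP; split; lra.
  - by apply: BC; rewrite ?lexx//; split; apply/andP; split; lra.
  rewrite (G (x + e) (a + s)) ?lexx//; last 2 first.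
  - by lra.
  - by lra.
  rewrite addr0 (@rct_vsplit R _ _ _ _ x2 ys g (y - e)); last 2 first.
  - by apply/andP; split; lra.
  - by apply: BC; rewrite ?lexx//; split; apply/andP; split; lra.
  rewrite (G (x - e) (x + e) (b - s) (y - e)) ?lexx//; last 2 first.
  - by lra.
  - by lra.
  have ys2 : y - e <= b + s by lra.
  rewrite add0r (@rct_vsplit R _ _ _ _ x2 ys2 g (y + e)); last 2 first.
  - by apply/andP; split; lra.
  - by apply: BC; rewrite ?lexx//; split; apply/andP; split; lra.
  rewrite (G (x - e) (x + e) (y + e) (b + s)) ?lexx//; last 2 first.
  - by lra.
  - by lra.
  by rewrite addr0.
have bc : bcont (x - e) (x + e) (y - e) (y + e) g.
  by apply: BC => //; split; apply/andP; split; lra.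
have := @nr_rct_le R _ _ _ _ x2 y2 (nr l + 1) g bc.
have -> : 4 * (nr l + 1) * (x + e - (x - e) + (y + e - (y - e))) = 16 * (nr l + 1) * e by ring.
apply => w [[/andP[w1 w2] /andP[w3 w4]] _]; apply: gM.
apply: (@le_lt_trans _ _ (2 * e)); last by lra.
apply: nr_le_max; rewrite ?(ReD, ImD) ?(ReN, ImN) ?xE ?yE; rewrite ler_norml; apply/andP; split; lra.
Qed.

(** Split [f w] as [(f w - f z) + f z]. The integral of [(w - z)^-1] is left unevaluated: knowing
    that it is nonzero suffices, and its value [2 * pi * ii] is never computed. *)
Lemma cauchy_square f z : holo f -> nr (z - z0) < s / 2 ->
  sq (fun w => f w * (w - z)^-1) = f z * sq (fun w => (w - z)^-1).
Proof.
move=> hf zz; have s0' := s0; have xs : a - s <= a + s by lra.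
have ys : b - s <= b + s by lra.
have vc : bcont (a - s) (a + s) (b - s) (b + s) (fun w => (w - z)^-1).
  by move=> w wb; apply: cderiv_ccont; exact: cderiv_inv_sub (bd_neq wb zz).
rewrite -rctZ// -[RHS]add0r -(quotient_rct0 hf zz) -rctD//.
- by apply: eq_rct => // w wb; ring.
- move=> w wb; apply: ccontM.
    have [l hl] := hf _ wb.1; exists (l + 0); apply: cderivD => //; exact: cderiv_cst.
  by eexists; exact: cderiv_inv_sub (bd_neq wb zz).
- move=> w wb; apply: ccontM; first by eexists; exact: cderiv_cst.
  by eexists; exact: cderiv_inv_sub (bd_neq wb zz).
Qed.

Lemma Re_inv w : complex.Re w^-1 = complex.Re w / (complex.Re w ^+ 2 + complex.Im w ^+ 2).
Proof. by case: w. Qed.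

Lemma Im_inv w : complex.Im w^-1 = - complex.Im w / (complex.Re w ^+ 2 + complex.Im w ^+ 2).
Proof. by case: w => u v /=; rewrite mulNr. Qed.

Lemma sqr_sum_bound z w : bd w -> nr (z - z0) < s / 2 ->
  0 < complex.Re (w - z) ^+ 2 + complex.Im (w - z) ^+ 2 <= 9 * s ^+ 2.
Proof.
move=> wb zz; have -> : complex.Re (w - z) ^+ 2 + complex.Im (w - z) ^+ 2 = nr (w - z) ^+ 2.
  by rewrite nr_sqrt sqr_sqrtr// addr_ge0// sqr_ge0.
have h1 := bd_far wb zz; have h2 := bd_near wb zz; have s0' := s0.
have n0 : 0 < nr (w - z) by lra.
rewrite exprn_gt0//=; nra.
Qed.

Lemma Im_rct f x0 x1 y0 y1 : complex.Im (rct f x0 x1 y0 y1) =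
  complex.Im (Ic (fun t => f (hline y0 t)) x0 x1)
  + complex.Re (Ic (fun t => f (vline x1 t)) y0 y1)
  - complex.Im (Ic (fun t => f (hline y1 t)) x0 x1)
  - complex.Re (Ic (fun t => f (vline x0 t)) y0 y1).
Proof.
have H (v : C) : complex.Im (ii * v) = complex.Re v.
  by rewrite ImM Re_ii Im_ii mul0r mul1r add0r.
by rewrite rctE ImD ImN H ImD ImN ImD H.
Qed.

(** The imaginary part of the contour integral is a sum of four contributions, one per side, and all
    of them are positive. *)
Lemma winding_neq0 z : nr (z - z0) < s / 2 -> sq (fun w => (w - z)^-1) != 0.
Proof.
move=> zz; have s0' := s0; have xs : a - s <= a + s by lra.
have ys : b - s <= b + s by lra.
have vc : bcont (a - s) (a + s) (b - s) (b + s) (fun w => (w - z)^-1).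
  by move=> w wb; apply: cderiv_ccont; exact: cderiv_inv_sub (bd_neq wb zz).
have [h1 h2 h3 h4] := bcont_lines xs ys vc.
have [/andP[r1 r2] /andP[i1 i2]] := near_box zz.
(* On a side, the component of [w - z] normal to it is at least [s / 2] in absolute value, while
   [nr (w - z) <= 3 * s]; hence [k] bounds the integrand below. *)
set k := s / 2 / (9 * s ^+ 2).
have k0 : 0 < k by rewrite /k !divr_gt0// mulr_gt0// exprn_gt0.
have K (u v : R) : s / 2 <= u -> 0 < v <= 9 * s ^+ 2 -> k <= u / v.
  move=> su /andP[v0 v1]; rewrite /k ler_pdivrMr; last by rewrite mulr_gt0// exprn_gt0.
  rewrite mulrAC ler_pdivlMr//; apply: ler_pM => //; last by lra.
  by rewrite divr_ge0// ltW.
have s2 : 0 < (a + s) - (a - s) by lra.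
have k3 : k * (a + s - (a - s)) <= complex.Im (Ic (fun t => -1 * (hline (b + s) t - z)^-1) (a - s) (a + s)).
  apply: Im_Ic_ge => // [t ht|t ht]; first exact/rcontZ/h3.
  rewrite mulN1r ImN Im_inv mulNr opprK; apply: K; last first.
    by apply: sqr_sum_bound => //; exact: brect_h1.
  by rewrite ImD ImN !lineE; lra.
have k4 : k * (b + s - (b - s)) <= complex.Re (Ic (fun t => -1 * (vline (a - s) t - z)^-1) (b - s) (b + s)).
  apply: Re_Ic_ge => // [t ht|t ht]; first exact/rcontZ/h4.
  rewrite mulN1r ReN Re_inv -mulNr; apply: K; last first.
    by apply: sqr_sum_bound => //; exact: brect_v0.
  by rewrite ReD ReN !lineE; lra.
have k1 : k * (a + s - (a - s)) <= complex.Im (Ic (fun t => (hline (b - s) t - z)^-1) (a - s) (a + s)).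
  apply: Im_Ic_ge => // t ht; rewrite Im_inv; apply: K; last first.
    by apply: sqr_sum_bound => //; exact: brect_h0.
  by rewrite ImD ImN !lineE; lra.
have k2 : k * (b + s - (b - s)) <= complex.Re (Ic (fun t => (vline (a + s) t - z)^-1) (b - s) (b + s)).
  apply: Re_Ic_ge => // t ht; rewrite Re_inv; apply: K; last first.
    by apply: sqr_sum_bound => //; exact: brect_v1.
  by rewrite ReD ReN !lineE; lra.
rewrite (IcZ _ h3) mulN1r ImN in k3; rewrite (IcZ _ h4) mulN1r ReN in k4.
apply: contraTneq (ltr01 : (0 : R) < 1) => E.
have {E} : complex.Im (sq (fun w => (w - z)^-1)) = 0 by rewrite E.
have t2 : 0 < (b + s) - (b - s) by rewrite opprB addrC addrA subrK addr_gt0.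
rewrite Im_rct => E; have := lt_le_trans (mulr_gt0 k0 s2) k1.
have := lt_le_trans (mulr_gt0 k0 t2) k2; have := lt_le_trans (mulr_gt0 k0 s2) k3.
have := lt_le_trans (mulr_gt0 k0 t2) k4 => h4' h3' h2' h1'.
have := addr_gt0 (addr_gt0 (addr_gt0 h1' h2') h3') h4'.
by rewrite E ltxx.
Qed.

(** Differentiation under the integral sign: a quadratic remainder that is uniform on the border
    passes through the integral. *)
Lemma rct_cderiv (K : C -> C -> C) (K' : C -> C) z (d M : R) : 0 < d -> 0 <= M ->
  (forall w, bd w -> ccont K' w) ->
  (forall z', nr (z' - z) < d -> forall w, bd w -> ccont (K z') w) ->
  (forall z', nr (z' - z) < d -> forall w, bd w ->
    nr (K z' w - K z w - (z' - z) * K' w) <= M * nr (z' - z) ^+ 2) ->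
  cderiv (fun z' => sq (K z')) z (sq K').
Proof.
move=> d0 M0 cK' cK hK e e0; have s0' := s0; have xs : a - s <= a + s by lra.
have ys : b - s <= b + s by lra.
pose N := 16 * (M + 1) * s.
have N0 : 0 < N by rewrite /N !mulr_gt0//; lra.
exists (Order.min d (e / N)); first by rewrite lt_min d0 divr_gt0.
move=> z'; rewrite lt_min => /andP[z'd]; rewrite ltr_pdivlMr// => /ltW z'e.
have zd : nr (z - z) < d by rewrite subrr nr0.
have Ez : sq (K z') - sq (K z) - sq K' * (z' - z) =
    sq (fun w => K z' w + -1 * K z w + - (z' - z) * K' w).
  have c1 : forall k f, (forall w, bd w -> ccont f w) -> forall w, bd w -> ccont (fun w => k * f w) w.
    by move=> k f hf w /hf h; exact: ccontZ.
  have c2 : forall f g, (forall w, bd w -> ccont f w) -> (forall w, bd w -> ccont g w) ->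
      forall w, bd w -> ccont (fun w => f w + g w) w.
    by move=> f g hf hg w wb; apply: ccontD; [exact: hf|exact: hg].
  rewrite rctD ?rctD ?rctZ//.
  - by ring.
  - exact: cK.
  - exact: cK.
  - exact/c1/cK.
  - by apply: c2; [exact: cK|exact/c1/cK].
  - exact: c1.
rewrite {}Ez.
have bound : forall w, bd w -> nr (K z' w + -1 * K z w + - (z' - z) * K' w) <= M * nr (z' - z) ^+ 2.
  by move=> w wb; rewrite mulN1r mulNr; exact: hK.
apply: (le_trans (nr_rct_le xs ys _ bound)).
  move=> w wb; apply: ccontD; last exact/ccontZ/cK'.
  by apply: ccontD; [exact: cK|exact/ccontZ/cK].
set n := nr (z' - z) in z'e *; have n0 : 0 <= n := nr_ge0 _.
have -> : 4 * (M * n ^+ 2) * (a + s - (a - s) + (b + s - (b - s))) = n * (16 * M * s) * n by ring.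
apply: ler_wpM2r => //; apply: le_trans z'e; apply: ler_wpM2l => //.
by rewrite /N ler_pM2r// ler_pM2l// lerDl.
Qed.

Lemma ex_cderivM f g z : (exists l, cderiv f z l) -> (exists l, cderiv g z l) ->
  exists l, cderiv (fun w => f w * g w) z l.
Proof. by move=> [l hl] [m hm]; eexists; exact: cderivM hl hm. Qed.

Lemma ex_cderivV z w : bd w -> nr (z - z0) < s / 2 ->
  exists l, cderiv (fun w => (w - z)^-1) w l.
Proof. by move=> wb zz; eexists; exact: cderiv_inv_sub (bd_neq wb zz). Qed.

Lemma nr_inv_le z w : bd w -> nr (z - z0) < s / 2 -> nr (w - z)^-1 <= 2 / s.
Proof.
move=> wb zz; have := bd_far wb zz; have s2 : 0 < s / 2 by rewrite divr_gt0.
move=> h; rewrite nrV -[2 / s]invrK lef_pV2 ?posrE ?invf_div//.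
exact: lt_le_trans h.
Qed.

Lemma near4 z z' : nr (z - z0) < s / 4 -> nr (z' - z) < s / 4 -> nr (z' - z0) < s / 2.
Proof.
move=> h1 h2; have -> : z' - z0 = (z' - z) + (z - z0) by ring.
by apply: (le_lt_trans (ler_nrD _ _)); lra.
Qed.

Lemma quarter_half : s / 4 < s / 2.
Proof. by rewrite ltr_pM2l// ltf_pV2 ?posrE// ltr_nat. Qed.

(** The remainder of the kernel is exactly [(z' - z) ^+ 2] times three inverses, each at most
    [2 / s]. The radius [s / 4] leaves room for [z'] to stay within [s / 2] of the centre. *)
Lemma cauchy_deriv1 g (B : R) z : holo g -> (forall w, bd w -> nr (g w) <= B) -> 0 <= B ->
  nr (z - z0) < s / 4 ->
  cderiv (fun z' => sq (fun w => g w * (w - z')^-1)) z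
    (sq (fun w => g w * ((w - z)^-1 * (w - z)^-1))).
Proof.
move=> hg gB B0 zz; have s4 : 0 < s / 4 by rewrite divr_gt0.
have c0 : 0 <= 2 / s by rewrite divr_ge0// ltW.
have zz2 := lt_trans zz quarter_half.
apply: (@rct_cderiv (fun z' w => g w * (w - z')^-1)
  (fun w => g w * ((w - z)^-1 * (w - z)^-1)) z (s / 4) (B * (2 / s) ^+ 3)) => //.
- by rewrite mulr_ge0// exprn_ge0.
- move=> w wb; apply: ccontM; first exact: hg wb.1.
  by apply: ex_cderivM; exact: ex_cderivV.
- move=> z' zz' w wb; apply: ccontM; first exact: hg wb.1.
  by apply: ex_cderivV => //; exact: near4 zz'.
- move=> z' zz' w wb; have zz2' := near4 zz zz'.
  have n1 : w - z != 0 by rewrite subr_eq0 (bd_neq wb zz2).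
  have n2 : w - z' != 0 by rewrite subr_eq0 (bd_neq wb zz2').
  have -> : g w * (w - z')^-1 - g w * (w - z)^-1 - (z' - z) * (g w * ((w - z)^-1 * (w - z)^-1)) =
    g w * ((w - z)^-1 * (w - z)^-1 * (w - z')^-1) * (z' - z) ^+ 2.
    by field; rewrite n1 n2.
  rewrite [leLHS]nrM nrX ler_wpM2r ?exprn_ge0 ?nr_ge0// nrM.
  apply: ler_pM; rewrite ?nr_ge0//; first exact: gB.
  rewrite !nrM exprSr expr2.
  have := nr_inv_le wb zz2; have := nr_inv_le wb zz2' => h' h.
  by do !(apply: ler_pM; rewrite ?mulr_ge0 ?nr_ge0//).
Qed.

(** The same for the squared kernel, whose derivative is [2 * (w - z) ^- 3]; the remainder has three
    terms, each with four inverses, whence [3 * (2 / s) ^+ 4]. *)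
Lemma cauchy_deriv2 g (B : R) z : holo g -> (forall w, bd w -> nr (g w) <= B) -> 0 <= B ->
  nr (z - z0) < s / 4 ->
  exists l, cderiv (fun z' => sq (fun w => g w * ((w - z')^-1 * (w - z')^-1))) z l.
Proof.
move=> hg gB B0 zz; have s4 : 0 < s / 4 by rewrite divr_gt0.
have c0 : 0 <= 2 / s by rewrite divr_ge0// ltW.
have zz2 := lt_trans zz quarter_half.
eexists; apply: (@rct_cderiv (fun z' w => g w * ((w - z')^-1 * (w - z')^-1))
  (fun w => g w * (((w - z)^-1 * (w - z)^-1 * (w - z)^-1) * (1 + 1))) z (s / 4)
  (B * (3 * (2 / s) ^+ 4))) => //.
- by rewrite mulr_ge0// mulr_ge0// exprn_ge0.
- move=> w wb; apply: ccontM; first exact: hg wb.1.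
  apply: ex_cderivM; last by eexists; exact: cderiv_cst.
  by do !apply: ex_cderivM; exact: ex_cderivV.
- move=> z' zz' w wb; apply: ccontM; first exact: hg wb.1.
  by apply: ex_cderivM; apply: ex_cderivV => //; exact: near4 zz'.
- move=> z' zz' w wb; have zz2' := near4 zz zz'.
  have n1 : w - z != 0 by rewrite subr_eq0 (bd_neq wb zz2).
  have n2 : w - z' != 0 by rewrite subr_eq0 (bd_neq wb zz2').
  set v := (w - z)^-1; set v' := (w - z')^-1.
  have -> : g w * (v' * v') - g w * (v * v) - (z' - z) * (g w * (v * v * v * (1 + 1))) =
    g w * (v * v * (v' * v') + v * v * (v * v') + v * v * (v * v')) * (z' - z) ^+ 2.
    by rewrite /v /v'; field; rewrite n1 n2.
  have h : nr v <= 2 / s := nr_inv_le wb zz2.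
  have h' : nr v' <= 2 / s := nr_inv_le wb zz2'.
  rewrite nrM nrX ler_wpM2r ?exprn_ge0 ?nr_ge0// nrM.
  apply: ler_pM; rewrite ?nr_ge0//; first exact: gB.
  have P (p q r t : C) : nr p <= 2 / s -> nr q <= 2 / s -> nr r <= 2 / s -> nr t <= 2 / s ->
      nr (p * q * (r * t)) <= (2 / s) ^+ 4.
    move=> ? ? ? ?; have -> : (2 / s) ^+ 4 = (2 / s) * (2 / s) * ((2 / s) * (2 / s)) by ring.
    rewrite !nrM.
    by do !(apply: ler_pM; rewrite ?mulr_ge0 ?nr_ge0//).
  have -> : 3 * (2 / s) ^+ 4 = (2 / s) ^+ 4 + (2 / s) ^+ 4 + (2 / s) ^+ 4 by ring.
  apply: (le_trans (ler_nrD _ _)); apply: lerD; last exact: P.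
  by apply: (le_trans (ler_nrD _ _)); apply: lerD; exact: P.
Qed.
End Square.

(* Cauchy's formula reads [A z = f z * c z] with [A], [c] rectangle integrals that
   are twice differentiable in [z] and [c z != 0], so [f' = (A' - f c') / c]. *)
Theorem holomorphic_derive1 f (d : R) z : 0 < d ->
  (forall w, nr (w - z) < d -> exists l, cderiv f w l) ->
  exists l, cderiv (derive1 f) z l.
Proof.
move=> d0 hd; set a := complex.Re z; set b := complex.Im z.
have zE : hline b a = z by apply: ReImP; rewrite !lineE.
have zz0 : nr (z - z) < d by rewrite subrr nr0.
have [l0 fz] := hd _ zz0.
have [d' d'0 d'P] := cderiv_ccont fz (@ltr01 R).
(* Points of the closed square of half-side [s] are within [2 * s] of [z], so there [f] is both
   differentiable and bounded. *)
pose s := Order.min d d' / 4.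
have m0 : 0 < Order.min d d' by rewrite lt_min d0.
have s0 : 0 < s by rewrite divr_gt0.
have sm : 2 * s < Order.min d d' by rewrite /s; lra.
have near w : crect (a - s) (a + s) (b - s) (b + s) w -> nr (w - z) < d /\ nr (w - z) < d'.
  move=> [/andP[h1 h2] /andP[h3 h4]]; apply/andP; rewrite -lt_min.
  apply: le_lt_trans sm; apply: nr_le_max; rewrite ?(ReD, ImD) ?(ReN, ImN) -/a -/b ler_norml;
  apply/andP; split; lra.
have hf w : crect (a - s) (a + s) (b - s) (b + s) w -> exists l, cderiv f w l.
  by move=> /near[/hd].
have h1 w : crect (a - s) (a + s) (b - s) (b + s) w -> exists l, cderiv (fun=> 1 : C) w l.
  by move=> _; eexists; exact: cderiv_cst.
have fB w : brect (a - s) (a + s) (b - s) (b + s) w -> nr (f w) <= 1 + nr (f z).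
  move=> [/near[_ /d'P h] _]; have -> : f w = (f w - f z) + f z by ring.
  by apply: (le_trans (ler_nrD _ _)); rewrite lerD2r ltW.
have oB w : brect (a - s) (a + s) (b - s) (b + s) w -> nr (1 : C) <= 1.
  by rewrite nr1.
have B0 : 0 <= 1 + nr (f z) by rewrite addr_ge0// nr_ge0.
have s4 : 0 < s / 4 by rewrite divr_gt0.
have zs : nr (z - hline b a) < s / 4 by rewrite zE subrr nr0.
set sq := fun F => rct F (a - s) (a + s) (b - s) (b + s).
pose A1 v := sq (fun w => f w * (w - v)^-1).
pose A2 v := sq (fun w => f w * ((w - v)^-1 * (w - v)^-1)).
(* Written as the Cauchy integral of the constant function 1, so that the differentiation lemmas
   used for [A1] apply verbatim. *)
pose c1 v := sq (fun w => 1 * (w - v)^-1).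
pose c2 v := sq (fun w => 1 * ((w - v)^-1 * (w - v)^-1)).
have dA1 v : nr (v - z) < s / 4 -> cderiv A1 v (A2 v).
  by rewrite -zE => hv; exact: (cauchy_deriv1 s0 hf fB B0 hv).
have dc1 v : nr (v - z) < s / 4 -> cderiv c1 v (c2 v).
  by rewrite -zE => hv; exact: (cauchy_deriv1 s0 h1 oB ler01 hv).
have [A3 dA2] := cauchy_deriv2 s0 hf fB B0 zs.
have [c3 dc2] := cauchy_deriv2 s0 h1 oB ler01 zs.
have h42 := quarter_half s0.
have c1n v : nr (v - z) < s / 4 -> c1 v != 0.
  rewrite -zE => hv; have := winding_neq0 s0 (lt_trans hv h42).
  rewrite /c1 /sq; congr (_ != 0); apply: eq_rct; rewrite ?lerD2l ?gerBl;
    by move=> *; rewrite ?mul1r//; lra.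
have cf v : nr (v - z) < s / 4 -> A1 v = f v * c1 v.
  rewrite -zE => hv; have := cauchy_square s0 hf (lt_trans hv h42).
  rewrite /A1 /c1 /sq => ->; congr (_ * _); apply: eq_rct; rewrite ?lerD2l;
    by move=> *; rewrite ?mul1r//; lra.
have fd v : nr (v - z) < s / 4 -> cderiv f v (derive1 f v).
  move=> hv; have [|l hl] := hd v; last by have [_ ->] := cderiv_derivable hl.
  apply: (lt_trans hv); apply: (@lt_trans _ _ (2 * s)); first by lra.
  by apply: (lt_le_trans sm); rewrite ge_min lexx.
(* The product rule on [A1 = f * c1], compared with the derivative [A2] of [A1]; every factor on the
   right is differentiable at [z]. *)
have E v : nr (v - z) < s / 4 -> derive1 f v = (A2 v + -1 * (f v * c2 v)) * (c1 v)^-1.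
  move=> hv; have H : cderiv A1 v (derive1 f v * c1 v + f v * c2 v).
    apply: cderiv_ext (cderivM (fd v hv) (dc1 v hv)).
    exists (s / 4 - nr (v - z)); first by rewrite subr_gt0.
    move=> w hw; rewrite cf//.
    have -> : w - z = (w - v) + (v - z) by ring.
    by apply: (le_lt_trans (ler_nrD _ _)); lra.
  by rewrite (cderiv_unique (dA1 v hv) H); field; exact: c1n.
have zs' : nr (z - z) < s / 4 by rewrite subrr nr0.
eexists; apply: (@cderiv_ext _ (fun v => (A2 v + -1 * (f v * c2 v)) * (c1 v)^-1)).
  by exists (s / 4) => // w hw; rewrite E.
apply: cderivM; last exact: (cderiv_comp (dc1 z zs') (cderivV (c1n z zs'))).
apply: (cderivD dA2); apply: cderivM; first exact: cderiv_cst.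
exact: (cderivM fz dc2).
Qed.
End CauchyFormula.

(** * Straight segments in a chart *)

Section RealDerivative.
Context {R : realType}.
Local Notation C := (Cplx R).
Implicit Types (f g : R -> R) (t l : R).

Definition rderiv f t l := forall e, 0 < e ->
  exists2 d : R, 0 < d & forall s, `|s - t| < d ->
    `|f s - f t - l * (s - t)| <= e * `|s - t|.

Lemma rderiv_derivable f t l : rderiv f t l -> derivable f t 1 /\ derive1 f t = l.
Proof.
move=> h.
have H : (fun h => h^-1 *: (f (h *: 1 + t) - f t)) @ (0 : R)^' --> l.
  apply/cvgrPdist_lt => e e0; have e1 : 0 < e / 2 by rewrite divr_gt0.
  have [d d0 dP] := h _ e1; apply/nbhs_real; exists d => // w; rewrite subr0 => wd w0.
  have E : w + t - t = w by ring.
  have := dP (w + t); rewrite E => /(_ wd) A.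
  have -> : l - w^-1 *: (f (w *: 1 + t) - f t) = - ((f (w + t) - f t - l * w) / w).
    rewrite /GRing.scale /= mulr1; field => //.
  have nw : 0 < `|w| by rewrite normr_gt0.
  rewrite normrN normrM normfV; apply: (@le_lt_trans _ _ (e / 2)).
    by rewrite ler_pdivrMr.
  by rewrite ltr_pdivrMr// ltr_pMr ?ltr1n.
split; first by apply/cvg_ex; exists l.
by rewrite derive1E /derive; apply: cvg_lim.
Qed.

Lemma rderiv_ext f g t l : (exists2 d : R, 0 < d & forall s, `|s - t| < d -> f s = g s) ->
  rderiv f t l -> rderiv g t l.
Proof.
move=> [r r0 rE] h e e0; have [d d0 dP] := h _ e0.
exists (Order.min d r); first by rewrite lt_min d0.
move=> w; rewrite lt_min => /andP[A B]; rewrite -!rE//; first exact: dP.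
by rewrite subrr normr0.
Qed.

Definition aline (z w : C) (t : R) : C := z + rc t * w.

Lemma alineB z w t s : aline z w s - aline z w t = rc (s - t) * w.
Proof. by rewrite /aline rcB; ring. Qed.

Lemma aline_near z w t (d : R) : 0 < d -> exists2 d' : R, 0 < d' &
  forall s, `|s - t| < d' -> nr (aline z w s - aline z w t) < d.
Proof.
move=> d0; have w0 : 0 < 1 + nr w by have := nr_ge0 w; lra.
exists (d / (1 + nr w)); first by rewrite divr_gt0.
move=> s; rewrite ltr_pdivlMr// alineB nrM nr_rc; apply: le_lt_trans.
by rewrite ler_wpM2l// lerDr.
Qed.

Lemma cderiv_aline (F : C -> C) z w t (l : C) : cderiv F (aline z w t) l ->
  rderiv (fun s => complex.Re (F (aline z w s))) t (complex.Re (l * w)) /\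
  rderiv (fun s => complex.Im (F (aline z w s))) t (complex.Im (l * w)).
Proof.
move=> h.
have H e : 0 < e -> exists2 d : R, 0 < d & forall s, `|s - t| < d ->
    nr (F (aline z w s) - F (aline z w t) - rc (s - t) * (l * w)) <= e * `|s - t|.
  move=> e0; have w0 : 0 < 1 + nr w by have := nr_ge0 w; lra.
  have [d d0 dP] := h _ (divr_gt0 e0 w0).
  have [d' d'0 d'P] := aline_near z w t d0.
  exists d' => // s /d'P/dP; rewrite alineB nrM nr_rc.
  have -> : l * (rc (s - t) * w) = rc (s - t) * (l * w) by ring.
  move=> A; apply: (le_trans A).
  have -> : e / (1 + nr w) * (`|s - t| * nr w) = e * `|s - t| * (nr w / (1 + nr w)).
    by field; rewrite gt_eqF.
  rewrite ler_piMr//; first by rewrite mulr_ge0// ltW.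
  by rewrite ler_pdivrMr// mul1r lerDr.
split=> e /H[d d0 dP]; exists d => // s /dP; apply: le_trans.
  apply: le_trans (Re_le_nr _); rewrite !(ReD, ReN).
  by rewrite [complex.Re (rc _ * _)]ReM Re_rc Im_rc mul0r subr0 mulrC.
apply: le_trans (Im_le_nr _); rewrite !(ImD, ImN).
by rewrite [complex.Im (rc _ * _)]ImM Re_rc Im_rc mul0r addr0 mulrC.
Qed.

(** Along a line of direction [w], the real derivative of order [n] is the real (or imaginary) part
    of [w ^+ n] times the complex derivative of order [n], which is again holomorphic. *)
Lemma aline_smooth (F : C -> C) (O : set C) z w :
  (forall u, O u -> exists2 d : R, 0 < d & forall v, nr (v - u) < d -> O v) ->
  (forall u, O u -> exists l : C, cderiv F u l) ->
  forall t, O (aline z w t) -> forall n,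
    derivable (derive1n n (fun s => complex.Re (F (aline z w s)))) t 1 /\
    derivable (derive1n n (fun s => complex.Im (F (aline z w s)))) t 1.
Proof.
move=> Oo OF.
have Fn n u : O u -> exists l : C, cderiv (derive1n n F) u l.
  elim: n u => [|n IH] u Ou; first by rewrite derive1n0; exact: OF.
  have [d d0 dP] := Oo _ Ou; rewrite derive1nS.
  by apply: (holomorphic_derive1 d0) => v /dP; exact: IH.
have Fn' n u : O u -> cderiv (derive1n n F) u (derive1n n.+1 F u).
  by move=> /(Fn n)[l hl]; rewrite derive1nS; have [_ ->] := cderiv_derivable hl.
have ext n t : O (aline z w t) ->
    rderiv (fun s => complex.Re (w ^+ n * derive1n n F (aline z w s))) t
      (complex.Re (w ^+ n.+1 * derive1n n.+1 F (aline z w t))) /\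
    rderiv (fun s => complex.Im (w ^+ n * derive1n n F (aline z w s))) t
      (complex.Im (w ^+ n.+1 * derive1n n.+1 F (aline z w t))).
  move=> /(Fn' n) h.
  have := cderivM (@cderiv_cst R (w ^+ n) (aline z w t)) h.
  rewrite mul0r add0r => /cderiv_aline.
  by have -> : w ^+ n * derive1n n.+1 F (aline z w t) * w = w ^+ n.+1 * derive1n n.+1 F (aline z w t)
    by rewrite exprSr mulrAC.
have near t : O (aline z w t) -> exists2 d : R, 0 < d & forall s, `|s - t| < d -> O (aline z w s).
  move=> /Oo[d d0 dP]; have [d' d'0 d'P] := aline_near z w t d0.
  by exists d' => // s /d'P/dP.
have main n t : O (aline z w t) ->
    derive1n n (fun s => complex.Re (F (aline z w s))) t = complex.Re (w ^+ n * derive1n n F (aline z w t)) /\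
    derive1n n (fun s => complex.Im (F (aline z w s))) t = complex.Im (w ^+ n * derive1n n F (aline z w t)).
  elim: n t => [|n IH] t Ot; first by rewrite !derive1n0 expr0 mul1r.
  have [h1 h2] := ext n t Ot; have [d d0 dP] := near _ Ot.
  split.
    rewrite (derive1nS (fun s => complex.Re (F (aline z w s)))).
    apply: (rderiv_derivable (rderiv_ext _ h1)).2.
    by exists d => // s /dP/IH[->].
  rewrite (derive1nS (fun s => complex.Im (F (aline z w s)))).
  apply: (rderiv_derivable (rderiv_ext _ h2)).2.
  by exists d => // s /dP/IH[_ ->].
move=> t Ot n; have [h1 h2] := ext n t Ot; have [d d0 dP] := near _ Ot.
split.
  apply: (rderiv_derivable (rderiv_ext _ h1)).1.
  by exists d => // s /dP/(main n)[->].
apply: (rderiv_derivable (rderiv_ext _ h2)).1.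
by exists d => // s /dP/(main n)[_ ->].
Qed.
End RealDerivative.

(** * Chart lines and the Kobayashi-Royden metric *)

Section ChartLines.
Context {R : realType} {X : topologicalType} (M : riemann_surface R X).
Local Notation C := (Cplx R).
Implicit Types (c d : chart M) (z w u v : C) (W : set X).

Definition chart_img c : set C := coord c @` chart_dom c.

Lemma coord_invP c z : chart_img c z ->
  chart_dom c (coord_inv c z) /\ coord c (coord_inv c z) = z.
Proof. by move=> [x cx <-]; rewrite coordK. Qed.

Lemma coord_inv_cvg c z : chart_img c z -> {for z, continuous (coord_inv c)}.
Proof. by move=> [x cx <-]; exact: coord_inv_continuous. Qed.

Lemma open_nr (O : set C) z : open O -> O z -> exists2 d : R, 0 < d & forall w, nr (w - z) < d -> O w.
Proof. by move=> Oo Oz; apply/nbhs_nr; exact: open_nbhs_nbhs. Qed.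

Lemma coord_inv_near c z (V : set X) : open V -> chart_img c z -> V (coord_inv c z) ->
  exists2 e : R, 0 < e & forall w, nr (w - z) < e -> chart_img c w /\ V (coord_inv c w).
Proof.
move=> Vo cz Vz.
have [e1 e10 e1P] := open_nr (@chart_img_open R X M c) cz.
have /nbhs_nr[e2 e20 e2P] : nbhs z (coord_inv c @^-1` V).
  by apply: coord_inv_cvg => //; exact: open_nbhs_nbhs.
exists (Order.min e1 e2); first by rewrite lt_min e10.
by move=> w; rewrite lt_min => /andP[/e1P ? /e2P ?].
Qed.

Definition overlap c d : set C := [set z | chart_img c z /\ chart_dom d (coord_inv c z)].

Lemma overlap_open c d z : overlap c d z -> exists2 e : R, 0 < e & forall w, nr (w - z) < e -> overlap c d w.
Proof. by move=> [cz dz]; exact: (coord_inv_near (@chart_dom_open R X M d)). Qed.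

Lemma transition_cderiv c d z : overlap c d z ->
  cderiv (coord d \o coord_inv c) z (derive1 (coord d \o coord_inv c) z).
Proof.
move=> [cz dz]; have [cx xz] := coord_invP cz; apply: derivable_cderiv.
by have := transition_holomorphic cx dz; rewrite xz.
Qed.

Definition chart_line c z w (t : R) : X := coord_inv c (aline z w t).

Lemma chart_line_smooth c z w (D : set R) : (forall t, D t -> chart_img c (aline z w t)) ->
  smooth_on M D (chart_line c z w).
Proof.
move=> hD t /hD ct; split.
  move=> A /(coord_inv_cvg ct)/nbhs_nr[e e0 eA]; apply/nbhs_real.
  by have [d d0 dP] := aline_near z w t e0; exists d => // s /dP/eA.
move=> d dt n; apply: (@aline_smooth R (coord d \o coord_inv c) (overlap c d)) => //.
  by move=> u; exact: overlap_open.
by move=> u /transition_cderiv; exists (derive1 (coord d \o coord_inv c) u).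
Qed.

Lemma chart_line_velocity c z w t d : chart_img c (aline z w t) ->
  chart_dom d (chart_line c z w t) ->
  velocity (M := M) (chart_line c z w) t d = derive1 (coord d \o coord_inv c) (aline z w t) * w.
Proof.
move=> ct dt; have := @transition_cderiv c d (aline z w t) (conj ct dt).
move=> /cderiv_aline[/rderiv_derivable[_ h1] /rderiv_derivable[_ h2]].
by apply: ReImP; rewrite /velocity /=; [exact: h1|exact: h2].
Qed.

(* The extra [e] below keeps the radius [2 / D] finite when [w = 0]. *)
Lemma kobayashi_le c z w W (v : tangent M) (rho : R) : 0 < rho ->
  (forall u, nr u < rho -> chart_img c (z + u) /\ W (coord_inv c (z + u))) ->
  (forall d, chart_dom d (coord_inv c z) -> v d = derive1 (coord d \o coord_inv c) z * w) ->
  (kobayashi_royden W (coord_inv c z) v <= (2 * nr w / rho)%:E)%E.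
Proof.
move=> r0 hW hv; apply/lee_addgt0Pr => e e0.
have nw := nr_ge0 w.
pose D := 2 * nr w / rho + e.
have D0 : 0 < D by rewrite /D ltr_wpDl// divr_ge0 ?mulr_ge0// ltW.
rewrite -EFinD -/D; apply: ereal_inf_lbound; exists (2 / D); last by congr EFin; field; rewrite gt_eqF.
split; first by rewrite divr_gt0.
have small u : nr u < 2 / D -> nr (u * w) < rho.
  rewrite ltr_pdivlMr// nrM => uD; have nu := nr_ge0 u.
  rewrite -(ltr_pM2l (ltr0n _ 2%N : 0 < 2%:R :> R)).
  apply: (@le_lt_trans _ _ (nr u * D * rho)); last by rewrite ltr_pM2r.
  have -> : nr u * D * rho = 2 * (nr u * nr w) + nr u * e * rho by rewrite /D; field; rewrite gt_eqF.
  by rewrite lerDl !mulr_ge0// ltW.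
have discE u : cdisc (2 / D) u -> nr u < 2 / D.
  by rewrite /cdisc /= ltC_nr ?rc_gt0 ?divr_gt0.
have affd u : cderiv (fun u => z + u * w) u w.
  have := cderivD (cderiv_cst z u) (cderivM (cderiv_id u) (cderiv_cst w u)).
  by rewrite mulr0 mul1r add0r addr0.
(* The straight disc in the chart; seen in a chart [d], its derivative at 0 is that of the
   transition map times [w]. *)
exists (fun u => coord_inv c (z + u * w)); split.
- move=> u /discE/small/hW[cu Wu]; split.
    move=> A /(coord_inv_cvg cu)/nbhs_nr[d d0 dA]; apply/nbhs_nr.
    have [d' d'0 d'P] := cderiv_ccont (affd u) d0.
    by exists d' => // x /d'P/dA.
  move=> d du; have h := @transition_cderiv c d (z + u * w) (conj cu du).
  exact: (cderiv_derivable (cderiv_comp (affd u) h)).1.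
- by move=> _ [u /discE/small/hW[_ ?] <-].
- by rewrite mul0r addr0.
- move=> d dz; rewrite hv//.
  have z00 : nr (0 * w) < rho by rewrite mul0r nr0.
  have [cz _] := hW _ z00.
  have dz' : chart_dom d (coord_inv c (z + 0 * w)) by rewrite mul0r addr0.
  have h := @transition_cderiv c d (z + 0 * w) (conj cz dz').
  have := (cderiv_derivable (cderiv_comp (affd 0) h)).2.
  by rewrite mul0r addr0.
Qed.
End ChartLines.

(** * Averaging over parallel segments *)

Section HyperbolicIntegral.
Context {R : realType}.
Local Notation mu := (@lebesgue_measure R).
Implicit Types (x y d u v : R).

(** The power -1/2, with value 0 for [x <= 0]. Since it does not blow up at 0, positivity of
    distances is always recorded next to bounds on sums of [rsq]. *)
Definition rsq x : R := (Num.sqrt x)^-1.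

Lemma rsq_ge0 x : 0 <= rsq x.
Proof. by rewrite invr_ge0 sqrtr_ge0. Qed.

Lemma rsq_le x y : 0 < x -> x <= y -> rsq y <= rsq x.
Proof.
move=> x0 xy; rewrite lef_pV2 ?posrE ?sqrtr_gt0 ?(lt_le_trans x0)//.
by rewrite ler_wsqrtr.
Qed.

Lemma rsqM x y : 0 <= x -> rsq (x * y) = rsq x * rsq y.
Proof. by move=> x0; rewrite /rsq sqrtrM// invfM. Qed.

(** Distance from a puncture at distance [d] from a line to the point of the line at offset [x] from
    its projection. *)
Definition hyp x d : R := Num.sqrt (x ^+ 2 + d ^+ 2).

Lemma hyp_sqr x d : hyp x d ^+ 2 = x ^+ 2 + d ^+ 2.
Proof. by rewrite /hyp sqr_sqrtr// addr_ge0// sqr_ge0. Qed.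

Lemma hyp_gt0 x d : 0 < d -> 0 < hyp x d.
Proof. by move=> d0; rewrite /hyp sqrtr_gt0 ltr_wpDl ?sqr_ge0// exprn_gt0. Qed.

Lemma hyp_gt x d : 0 < d -> `|x| < hyp x d.
Proof.
move=> d0; have h := hyp_gt0 x d0.
rewrite -(@ltr_pXn2r _ 2) ?nnegrE ?(ltW h)// hyp_sqr real_normK ?num_real//.
by rewrite ltrDl exprn_gt0.
Qed.

Lemma hypD_gt0 x d : 0 < d -> 0 < x + hyp x d.
Proof. by move=> d0; have := hyp_gt x d0; rewrite ltr_norml => /andP[]; lra. Qed.

Lemma hypB_gt0 x d : 0 < d -> 0 < hyp x d - x.
Proof. by move=> d0; have := hyp_gt x d0; rewrite ltr_norml => /andP[]; lra. Qed.

(* [t |-> ln (x t + hyp (x t) d)] is a primitive of the integrand: it is asinh up to a constant. *)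
Lemma hyp_primitive (al be d t : R) : 0 < d ->
  is_derive t 1 (fun t => ln (al + be * t + hyp (al + be * t) d)) (be / hyp (al + be * t) d).
Proof.
move=> d0.
have h1 : is_derive t 1 (fun t => al + be * t) be.
  by apply: is_derive_eq; rewrite /GRing.scale /=; ring.
have h2 : is_derive t 1 (fun t => (al + be * t) ^+ 2 + d ^+ 2) (2 * (al + be * t) * be).
  by apply: is_derive_eq; rewrite /GRing.scale /=; ring.
have p0 : 0 < (al + be * t) ^+ 2 + d ^+ 2 by rewrite ltr_wpDl ?sqr_ge0// exprn_gt0.
have h3 : is_derive t 1 (fun t => hyp (al + be * t) d) ((2 * hyp (al + be * t) d)^-1 * (2 * (al + be * t) * be)).
  exact: (@is_derive1_comp _ Num.sqrt (fun t => (al + be * t) ^+ 2 + d ^+ 2) t _ _ (is_derive1_sqrt p0) h2).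
have h4 := is_deriveD h1 h3.
have l0 := hypD_gt0 (al + be * t) d0.
have hn := hyp_gt0 (al + be * t) d0.
have h5 := @is_derive1_comp _ (@ln R) (fun t => al + be * t + hyp (al + be * t) d) t _ _ (is_derive1_ln l0) h4.
apply: (is_derive_eq h5).
by field; rewrite !gt_eqF.
Qed.

(** With [x = s ^+ 2], [2 + s ^+ 4 <= (2 + s) ^+ 4] and [ln (2 + s) <= 1 + s]. Here the logarithm is
    traded for a square root; the constant 8 is generous. *)
Lemma ln_bound x : 0 <= x -> ln (2 + x ^+ 2) <= 8 + 4 * Num.sqrt x.
Proof.
move=> x0; set s := Num.sqrt x; have s0 : 0 <= s by rewrite sqrtr_ge0.
have xs : x = s ^+ 2 by rewrite sqr_sqrtr.
apply: (@le_trans _ _ (ln ((2 + s) ^+ 4))).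
  rewrite ler_ln ?posrE ?exprn_gt0//; first by rewrite xs; nra.
    by rewrite ltr_wpDr// sqr_ge0.
  by rewrite ltr_wpDr.
rewrite lnXn ?ltr_wpDr//.
have : ln (1 + (1 + s)) <= 1 + s by apply: le_ln1Dx; lra.
have -> : 1 + (1 + s) = 2 + s by ring.
by rewrite -mulr_natr; lra.
Qed.

Lemma hyp_ratio x y d : 0 < d ->
  (y + hyp y d) / (x + hyp x d) <= 2 + ((y - x) / d) ^+ 2.
Proof.
move=> d0; have hx := hyp_sqr x d; have hy := hyp_sqr y d.
have p1 := hypD_gt0 x d0; have p2 := hypB_gt0 y d0.
have -> : 2 + ((y - x) / d) ^+ 2 = (2 * d ^+ 2 + (y - x) ^+ 2) / d ^+ 2.
  by field; rewrite gt_eqF.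
rewrite ler_pdivrMr// mulrAC ler_pdivlMr ?exprn_gt0//.
move: hx hy p1 p2; set A := hyp x d; set B := hyp y d => hx hy p1 p2.
have E : d ^+ 2 = (A + x) * (A - x) 
  by have -> : (A + x) * (A - x) = A ^+ 2 - x ^+ 2 by [ring]; rewrite hx; ring.
(* Adding the nonnegative [(B - y) * (A + x)] to the left side gives [2 * A * B - 2 * x * y], which
   is at most [A ^+ 2 + B ^+ 2 - 2 * x * y], that is, the right side. *)
suff H : (y + B) * (A - x) <= 2 * d ^+ 2 + (y - x) ^+ 2.
  by rewrite {1}E; have := ler_wpM2r (ltW p1) H; lra.
have : 0 <= (B - y) * (A + x) by rewrite mulr_ge0 ?ltW// addrC.
have : 0 <= (A - B) ^+ 2 by rewrite sqr_ge0.
by move: hx hy; clear; nra.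
Qed.

Lemma hyp_integral (al be d u v : R) : u < v -> 0 < d ->
  (\int[mu]_(t in `[u, v]) (`|be| / hyp (al + be * t) d)%:E <=
   (8 + 4 * (Num.sqrt (`|be| * (v - u)) * rsq d))%:E)%E.
Proof.
(* Changing the signs of both [al] and [be] leaves [hyp] unchanged, whereas the primitive has
   derivative [be / hyp], without absolute value. *)
move=> uv d0; wlog be0 : al be / 0 <= be.
  move=> H; have [/H//|/ltW be0] := leP 0 be; have := H (- al) (- be).
  rewrite normrN oppr_ge0 => /(_ be0); apply: le_trans.
  rewrite le_eqVlt; apply/orP; left; apply/eqP; apply: eq_integral => t _; congr (_ / _)%:E.
  by rewrite /hyp; congr (Num.sqrt (_ + _)); ring.
rewrite ger0_norm//.
pose F t := ln (al + be * t + hyp (al + be * t) d).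
have dF t := hyp_primitive al be t d0.
have cF : continuous F.
  by move=> t; apply/differentiable_continuous/derivable1_diffP; apply: (@ex_derive _ _ _ _ _ _ _ (dF t)).
have ch : continuous (fun t : R => be / hyp (al + be * t) d).
  move=> t; apply: cvgM; first exact: cvg_cst.
  apply: cvgV; first by rewrite gt_eqF// hyp_gt0.
  apply: (@continuous_comp _ _ _ (fun t => (al + be * t) ^+ 2 + d ^+ 2) Num.sqrt).
    apply: (@differentiable_continuous _ _ _ _ (fun t => (al + be * t) ^+ 2 + d ^+ 2)).
    by apply/derivable1_diffP.
  exact: sqrt_continuous.
rewrite (@continuous_FTC2 _ (fun t => be / hyp (al + be * t) d) F u v)//=; last first.
- by move=> t _; rewrite derive1E; apply: derive_val.
- split.
  + by move=> x _; apply: (@ex_derive _ _ _ _ _ _ _ (dF x)).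
  + exact/cvg_at_right_filter/cF.
  + exact/cvg_at_left_filter/cF.
- exact: continuous_subspaceT.
rewrite -EFinB lee_fin /F.
have px := hypD_gt0 (al + be * u) d0; have py := hypD_gt0 (al + be * v) d0.
rewrite -ln_div ?posrE//.
have l0 : 0 <= be * (v - u) / d by rewrite divr_ge0 ?mulr_ge0 ?subr_ge0// ltW.
apply: (@le_trans _ _ (ln (2 + (be * (v - u) / d) ^+ 2))).
  rewrite ler_ln ?posrE ?divr_gt0//; last by rewrite ltr_wpDr// sqr_ge0.
  apply: (le_trans (hyp_ratio _ _ d0)).
  by have -> : al + be * v - (al + be * u) = be * (v - u) by ring.
apply: (le_trans (ln_bound l0)); rewrite lerD2l ler_pM2l//.
by rewrite /rsq -sqrtrV ?(ltW d0)// -sqrtrM ?mulr_ge0 ?subr_ge0 ?(ltW uv).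
Qed.
End HyperbolicIntegral.

(** * Choice of a parameter by averaging over samples *)

Section Selection.
Context {R : realType}.
Local Notation rsq := (@rsq R).

(** With [A ^+ 2 - B ^+ 2 = 1] this is [0 <= (A - B) ^+ 2]. *)
Lemma rsq_telescope (m : nat) :
  rsq m.+1%:R <= 2 * (Num.sqrt m.+1%:R - Num.sqrt m%:R).
Proof.
rewrite /rsq; set A := Num.sqrt m.+1%:R; set B := Num.sqrt m%:R.
have hA : A ^+ 2 = m%:R + 1 by rewrite sqr_sqrtr ?ler0n// -natr1.
have hB : B ^+ 2 = m%:R by rewrite sqr_sqrtr ?ler0n.
have A0 : 0 < A by rewrite sqrtr_gt0 ltr0n.
rewrite -[leLHS]mul1r ler_pdivrMr//.
have : 0 <= (A - B) ^+ 2 by rewrite sqr_ge0.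
by move: hA hB; clear; nra.
Qed.

Lemma sum_rsq_dist (N k0 : nat) : (k0 < N)%N ->
  \sum_(k < N) rsq `|(k%:R : R) - k0%:R| <= 4 * Num.sqrt N%:R.
Proof.
move=> kN.
(* A discrete primitive on both sides of [k0]: truncated subtraction kills the square root of the
   wrong side. The term [k = k0] is [rsq 0 = 0]. *)
pose P (k : nat) : R := Num.sqrt (k - k0.+1)%:R - Num.sqrt (k0 - k)%:R.
have step (k : nat) : rsq `|(k%:R : R) - k0%:R| <= 2 * (P k.+1 - P k).
  rewrite /P subSS; have [kk|kk|->] := ltngtP k k0.
  - have [m E] : exists m, k0 = (k + m.+1)%N by exists (k0 - k).-1; lia.
    rewrite {}E; have -> : (k - (k + m.+1) = 0)%N by lia.
    have -> : (k + m.+1 - k = m.+1)%N by lia.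
    have -> : (k + m.+1 - k.+1 = m)%N by lia.
    have -> : (k - (k + m.+1).+1 = 0)%N by lia.
    rewrite natrD opprD addrA subrr add0r normrN ger0_norm ?ler0n//.
    by apply: (le_trans (rsq_telescope m)); rewrite sqrtr0; lra.
  - have [m E] : exists m, k = (k0 + m.+1)%N by exists (k - k0).-1; lia.
    rewrite {}E; have -> : (k0 + m.+1 - k0 = m.+1)%N by lia.
    have -> : (k0 - (k0 + m.+1).+1 = 0)%N by lia.
    have -> : (k0 + m.+1 - k0.+1 = m)%N by lia.
    have -> : (k0 - (k0 + m.+1) = 0)%N by lia.
    rewrite natrD addrAC subrr add0r ger0_norm ?ler0n//.
    by apply: (le_trans (rsq_telescope m)); rewrite sqrtr0; lra.
  - have -> : (k0 - k0 = 0)%N by lia.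
    have -> : (k0 - k0.+1 = 0)%N by lia.
    by rewrite subrr normr0 /rsq sqrtr0 invr0; lra.
apply: (le_trans (ler_sum _ (fun (k : 'I_N) _ => step k))).
rewrite -mulr_sumr -(big_mkord xpredT (fun k => P k.+1 - P k)) telescope_sumr//.
rewrite /P sub0n subn0; have -> : (k0 - N = 0)%N by lia.
have h1 : Num.sqrt (N - k0.+1)%:R <= Num.sqrt (N%:R : R).
  by rewrite ler_wsqrtr// ler_nat leq_subr.
have h2 : Num.sqrt k0%:R <= Num.sqrt (N%:R : R) by rewrite ler_wsqrtr// ler_nat ltnW.
by rewrite sqrtr0; lra.
Qed.

(* Pigeonhole: of [2 n + 1] equally spaced samples at most [n] are nearest to the
   zero of some [psi i]; averaging over the others gives a good one. *)
Lemma select_parameter (L c : R) : 0 < L -> 0 < c -> exists2 K : R, 0 < K &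
  forall (I : finType) (psi : I -> R -> R),
    (forall i s, 0 <= psi i s) ->
    (forall i s s', 0 <= s <= L -> 0 <= s' <= L -> c * `|s - s'| <= psi i s + psi i s') ->
    exists2 s, 0 <= s <= L & (forall i, 0 < psi i s) /\
      \sum_i rsq (psi i s) <= K * (#|I|%:R + 1).
Proof.
(* Chosen so that [rsq (c * h / 2) = k0 * Num.sqrt N%:R] for the sampling step [h = L / N]. *)
move=> L0 c0; pose k0 : R := Num.sqrt (2 / (c * L)).
have k00 : 0 < k0 by rewrite sqrtr_gt0 divr_gt0// mulr_gt0.
exists (8 * k0); first by rewrite mulr_gt0.
move=> I psi psi0 hpsi; set n := #|I|; pose N := (n.*2).+1.
have N0 : 0 < (N%:R : R) by rewrite ltr0n.
pose h := L / N%:R; have h0 : 0 < h by rewrite divr_gt0.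
pose smp (k : 'I_N) : R := h * k%:R.
have smpL k : 0 <= smp k <= L.
  apply/andP; split; first by rewrite /smp mulr_ge0 ?ler0n// ltW.
  rewrite /smp /h mulrAC ler_pdivrMr// ler_pM2l// ler_nat.
  by rewrite ltnW.
pose near i := [arg min_(k < ord0) psi i (smp k)]%O.
have nearP i k : psi i (smp (near i)) <= psi i (smp k).
  by rewrite /near; case: arg_minP => // j _; apply.
(* The separation hypothesis bounds [psi] at [k] plus [psi] at the nearest sample from below, and
   the latter is the smaller one. *)
have far i (k : 'I_N) : c * h / 2 * `|(k%:R : R) - (near i)%:R| <= psi i (smp k).
  have := hpsi i (smp k) (smp (near i)) (smpL _) (smpL _).
  rewrite /smp -mulrBr normrM (gtr0_norm h0); have := nearP i k; rewrite /smp.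
  by move: (psi i (h * k%:R)) (psi i (h * (near i)%:R)) => a b; lra.
pose G := finset (fun k : 'I_N => [forall i, k != near i]).
have Gbig : (n < #|G|)%N.
  have : (#|~: G| <= n)%N.
    apply: (@leq_trans #|codom near|); last exact: leq_image_card.
    apply/subset_leq_card/fintype.subsetP => k; rewrite !inE negb_forall => /fintype.existsP[j].
    by rewrite negbK => /eqP ->; exact: codom_f.
  have : (#|G| + #|~: G| = (n + n).+1)%N by rewrite cardsC card_ord /N addnn.
  lia.
have ch0 : 0 < c * h / 2 by rewrite divr_gt0// mulr_gt0.
have chE : rsq (c * h / 2) = k0 * Num.sqrt N%:R.
  rewrite /rsq /k0 -sqrtrM ?divr_ge0 ?mulr_ge0 ?ltW// -sqrtrV ?ltW//; congr Num.sqrt.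
  by rewrite /h; field; rewrite !gt_eqF.
have psipos k i : k \in G -> 0 < psi i (smp k).
  rewrite inE => /fintype.forallP/(_ i) kn; apply: lt_le_trans (far i k).
  rewrite mulr_gt0// normr_gt0 subr_eq0 eqr_nat; exact: kn.
(* For each [i], [far] bounds the sum over [k] by [k0 * Num.sqrt N * (4 * Num.sqrt N) = 4 * k0 * N],
   and [N = 2 n + 1]. As [G] has more than [n] elements, one of them is at most
   [8 * k0 * (n + 1)]. *)
have total : \sum_(k in G) \sum_i rsq (psi i (smp k)) <= n%:R * (8 * k0 * (n%:R + 1)).
  rewrite exchange_big /=.
  have -> : n%:R * (8 * k0 * (n%:R + 1)) = \sum_(i : I) (8 * k0 * (n%:R + 1)).
    by rewrite sumr_const -[RHS]mulr_natl.
  apply: ler_sum => i _.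
  apply: (@le_trans _ _ (\sum_(k in G) rsq (c * h / 2) * rsq `|(k%:R : R) - (near i)%:R|)).
    apply: ler_sum => k kG; rewrite -rsqM ?(ltW ch0)//; apply: rsq_le (far i k).
    move: kG; rewrite inE => /fintype.forallP/(_ i) kn.
    by rewrite mulr_gt0// normr_gt0 subr_eq0 eqr_nat; exact: kn.
  rewrite -mulr_sumr.
  have S4 : \sum_(k in G) rsq `|(k%:R : R) - (near i)%:R| <= 4 * Num.sqrt N%:R.
    apply: le_trans (sum_rsq_dist (ltn_ord (near i))).
    rewrite [leRHS](bigID (mem G)) /= lerDl; apply: sumr_ge0 => k _; exact: rsq_ge0.
  apply: (le_trans (ler_wpM2l (rsq_ge0 _) S4)); rewrite chE.
  have -> : k0 * Num.sqrt N%:R * (4 * Num.sqrt N%:R) = 4 * k0 * Num.sqrt N%:R ^+ 2 by ring.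
  rewrite sqr_sqrtr ?(ltW N0)//.
  have -> : 8 * k0 * (n%:R + 1) = 4 * k0 * (2 * n%:R + 2) by ring.
  have -> : N%:R = 2 * n%:R + 1 :> R by rewrite /N -natr1 -muln2 natrM mulrC.
  by rewrite ler_pM2l ?mulr_gt0// lerD2l ler1n.
have [k kG hk] : exists2 k, k \in G & \sum_i rsq (psi i (smp k)) <= 8 * k0 * (n%:R + 1).
  apply: contrapT => no.
  have : \sum_(k in G) (8 * k0 * (n%:R + 1)) <= \sum_(k in G) \sum_i rsq (psi i (smp k)).
    apply: ler_sum => k kG; rewrite leNgt; apply/negP => /ltW hk; by apply: no; exists k.
  rewrite sumr_const -[X in X <= _]mulr_natl => /le_trans/(_ total).
  by rewrite ler_pM2r ?mulr_gt0 ?ltr_wpDl// ler_nat leqNgt Gbig.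
exists (smp k); first exact: smpL.
by split=> // i; exact: psipos.
Qed.
End Selection.

(** * Paths of controlled length *)

Section Pieces.
Context {R : realType} {X : topologicalType} (M : riemann_surface R X).
Local Notation C := (Cplx R).
Local Notation mu := (@lebesgue_measure R).
Implicit Types (c d : chart M) (z w : C) (W : set X) (S : seq X) (g : R -> X).

(** Subdivisions in inductive form, so that concatenation is an easy induction;
    [smooth_chain_partition] converts them into a partition at the end. *)
Inductive smooth_chain : R -> R -> (R -> X) -> Prop :=
| smooth_chain1 u v g : u < v -> smooth_on_segment M u v g -> smooth_chain u v g
| smooth_chain_cons u m v g : u < m -> smooth_on_segment M u m g ->
    smooth_chain m v g -> smooth_chain u v g.

Lemma smooth_chain_lt u v g : smooth_chain u v g -> u < v.
Proof. by elim=> // {}u m {}v {}g um _ _; exact: lt_trans. Qed.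

Lemma smooth_chain_cat u m v g : smooth_chain u m g -> smooth_chain m v g ->
  smooth_chain u v g.
Proof.
elim=> [{}u {}m {}g um hg|{}u m' {}m {}g um hg h IH] hm; first exact: smooth_chain_cons hm.
by apply: smooth_chain_cons (IH hm).
Qed.

Lemma smooth_chain_congr u v g g' : (forall t, u <= t <= v -> g t = g' t) ->
  smooth_chain u v g -> smooth_chain u v g'.
Proof.
have seg a b g1 g2 : (forall t, a <= t <= b -> g1 t = g2 t) ->
    smooth_on_segment M a b g1 -> smooth_on_segment M a b g2.
  move=> E [e [h [e0 hs hE]]]; exists e, h; split=> // t tab.
  by rewrite -E ?hE//; move: tab; rewrite in_itv.
move=> E h; elim: h g' E => [{}u {}v {}g uv hg|{}u m {}v {}g um hg h IH] g' E.
  by apply: smooth_chain1 => //; exact: seg hg.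
have mv := smooth_chain_lt h.
apply: (@smooth_chain_cons _ m) => //.
  by apply: seg hg => t /andP[ut tm]; apply: E; rewrite ut (le_trans tm)// ltW.
by apply: IH => t /andP[mt tv]; apply: E; rewrite tv (le_trans _ mt)// ltW.
Qed.

Lemma smooth_chain_partition u v g : smooth_chain u v g ->
  exists s : seq R, itv_partition u v s /\
    forall i, (i < size s)%N ->
      smooth_on_segment M (nth v (u :: s) i) (nth v (u :: s) i.+1) g.
Proof.
elim=> [{}u {}v {}g uv hg|{}u m {}v {}g um hg _ [s [[sp sl] hs]]].
  by exists [:: v]; split; [split=> //=; rewrite uv|case].
exists (m :: s); split; first by split=> //=; rewrite um.
by move=> [|k] //= ks; exact: hs.
Qed.

Lemma kobayashi_ge0 W x (v : tangent M) : (0 <= kobayashi_royden W x v)%E.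
Proof. by apply: le_ereal_inf_tmp => _ [r [r0 _] <-]; rewrite lee_fin divr_ge0// ltW. Qed.

(* The Kobayashi metric is not known to be measurable, hence only the dominating
   function is required to be. *)
Lemma ge0_integral_dominated (D : set R) (f1 f2 : R -> \bar R) :
  (forall t, D t -> (0 <= f1 t)%E) -> (forall t, D t -> (f1 t <= f2 t)%E) ->
  (\int[mu]_(t in D) f1 t <= \int[mu]_(t in D) f2 t)%E.
Proof.
move=> f10 f12; have f20 t : D t -> (0 <= f2 t)%E.
  by move=> Dt; apply: le_trans (f12 _ Dt); exact: f10.
rewrite !ge0_integralE//; apply: le_ereal_sup => _ [h hf <-]; exists h => // t.
apply: (le_trans (hf t)); rewrite /patch; case: ifPn => // tD.
by apply: f12; rewrite -in_setE.
Qed.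

(* Open interval: the velocity at [u] and [v] depends on [g] outside of [u, v]. *)
Definition cheap W (u v : R) g (k : R) := exists f : R -> \bar R,
  [/\ measurable_fun `]u, v[ f, forall t, (0 <= f t)%E,
      (\int[mu]_(t in `]u, v[) f t <= k%:E)%E &
      forall t, u < t < v -> (kobayashi_royden W (g t) (velocity (M := M) g t) <= f t)%E].

Lemma velocity_near g g' t : (\near t, g t = g' t) -> velocity (M := M) g t = velocity g' t.
Proof.
move=> E; apply/funext => c; rewrite /velocity !derive1E.
congr (_ +i* _)%C; apply: near_eq_derive; near=> s; rewrite /re_coord /im_coord; congr (_ (coord c _));
  by near: s.
Unshelve. all: by end_near. Qed.

Lemma cheap_congr W u v g g' k : (forall t, u <= t <= v -> g t = g' t) ->
  cheap W u v g k -> cheap W u v g' k.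
Proof.
move=> E [f [mf f0 fk hf]]; exists f; split=> // t /[dup] tuv /andP[ut tv].
rewrite -E ?(ltW ut) ?(ltW tv)// -(@velocity_near g); first exact: hf.
have h1 : \forall s \near t, s \in `]u, v[ by apply: near_in_itvoo; rewrite in_itv /= ut tv.
apply: filterS h1 => s; rewrite in_itv /= => /andP[h2 h3].
by apply: E; rewrite !ltW.
Qed.

Lemma cheap_cat W u m v g k1 k2 : u < m -> m < v -> cheap W u m g k1 -> cheap W m v g k2 ->
  cheap W u v g (k1 + k2).
Proof.
move=> um mv [f1 [mf1 f10 fk1 hf1]] [f2 [mf2 f20 fk2 hf2]].
(* At the break point the velocity is uncontrolled; the value [+oo] dominates anything there and a
   single point does not affect the integral. *)
pose f t : \bar R := if t < m then f1 t else if t == m then +oo%E else f2 t.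
have E1 t : t \in `]u, m[%classic -> f1 t = f t.
  by rewrite inE /= in_itv /= /f => /andP[_ ->].
have E2 t : t \in `]m, v[%classic -> f2 t = f t.
  by rewrite inE /= in_itv /= /f => /andP[mt _]; rewrite ltNge (ltW mt)/= gt_eqF.
have f0 t : (0 <= f t)%E.
  by rewrite /f; case: ifP => // _; case: ifP => // _; rewrite leey.
have mg1 : measurable_fun `]u, m[ f by exact: eq_measurable_fun mf1.
have mg2 : measurable_fun `]m, v[ f by exact: eq_measurable_fun mf2.
have U1 : `]u, m]%classic = `]u, m[ `|` [set m] :> set R by rewrite setUitv1// bnd_simp.
have U2 : `]u, v[%classic = `]u, m] `|` `]m, v[ :> set R.
  by rewrite -itv_bndbnd_setU// bnd_simp ltW.
have mg3 : measurable_fun `]u, m] f.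
  by rewrite U1; apply/measurable_funU => //; split => //; exact: measurable_fun_set1.
exists f; split => //.
- by rewrite U2; apply/measurable_funU.
- rewrite U2 ge0_integral_setU//=; last 2 first.
  + by rewrite -U2 U2; apply/measurable_funU.
  + apply/disj_setPS => t [] /=; rewrite !in_itv /= => /andP[_ h1] /andP[h2 _].
    by have := lt_le_trans h2 h1; rewrite ltxx.
  rewrite EFinD; apply: leeD.
    rewrite (@integral_itv_bndoo _ _ _ f false false)//.
    by rewrite (_ : (\int[mu]_(z in `]u, m[) f z = \int[mu]_(z in `]u, m[) f1 z)%E)//;
      apply: eq_integral => t tt; rewrite E1.
  by rewrite (_ : (\int[mu]_(z in `]m, v[) f z = \int[mu]_(z in `]m, v[) f2 z)%E)//;
    apply: eq_integral => t tt; rewrite E2.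
- move=> t /andP[ut tv]; rewrite /f; have [tm|mt|->] := ltgtP t m.
  + by apply: hf1; rewrite ut.
  + by apply: hf2; rewrite mt.
  + by rewrite leey.
Qed.

Definition avoiding W S : set X := W `\` [set` S].

Definition piece W S (u v : R) g (k : R) :=
  [/\ smooth_chain u v g, forall t, u <= t <= v -> g t \notin S &
      cheap (avoiding W S) u v g k].

Lemma piece_congr W S u v g g' k : (forall t, u <= t <= v -> g t = g' t) ->
  piece W S u v g k -> piece W S u v g' k.
Proof.
move=> E [h1 h2 h3]; split; first exact: smooth_chain_congr h1.
  by move=> t tuv; rewrite -E// h2.
exact: cheap_congr h3.
Qed.

Lemma piece_cat W S u m v g k1 k2 : piece W S u m g k1 -> piece W S m v g k2 ->
  piece W S u v g (k1 + k2).
Proof.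
move=> [h1 h2 h3] [h4 h5 h6].
have um := smooth_chain_lt h1; have mv := smooth_chain_lt h4; split.
- exact: smooth_chain_cat h4.
- move=> t /andP[ut tv]; have [tm|mt] := leP t m; first by rewrite h2// ut.
  by rewrite h5// tv ltW.
- exact: cheap_cat h6.
Qed.

Lemma piece_le W S u v g k k' : k <= k' -> piece W S u v g k -> piece W S u v g k'.
Proof.
move=> kk [h1 h2 [f [mf f0 fk hf]]]; split=> //; exists f; split=> //.
by apply: (le_trans fk); rewrite lee_fin.
Qed.

Lemma piece_length W S g k : piece W S 0 1 g k ->
  piecewise_smooth M g /\ (kobayashi_length M (avoiding W S) g <= k%:E)%E.
Proof.
move=> [/smooth_chain_partition h1 _ [f [mf f0 fk hf]]]; split => //.
(* Again [+oo] where the velocity is uncontrolled, at the two end points. *)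
pose f' t : \bar R := if (0 < t) && (t < 1) then f t else +oo%E.
have E t : t \in `]0, 1[%classic -> f t = f' t.
  by rewrite inE /= in_itv /= /f' => ->.
rewrite /kobayashi_length; apply: (@le_trans _ _ (\int[mu]_(t in `[0%R, 1%R]) f' t)%E).
  apply: ge0_integral_dominated => t _; first exact: kobayashi_ge0.
  by rewrite /f'; case: ifPn => [/hf//|_]; rewrite leey.
rewrite (@integral_itv_bndoo _ _ _ f' true false); last exact: eq_measurable_fun mf.
by rewrite (_ : (\int[mu]_(z in `]0%R, 1%R[) f' z = \int[mu]_(z in `]0%R, 1%R[) f z)%E)//;
  apply: eq_integral => t tt; rewrite E.
Qed.

Record cbox := CBox { box_chart : chart M; box_center : C; box_radius : R }.

Definition in_square (z0 : C) (r : R) z :=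
  `|complex.Re z - complex.Re z0| < r /\ `|complex.Im z - complex.Im z0| < r.

(* The factor 4 leaves room for the discs of [kobayashi_le] and for homotopies
   between paths in [box_set], which stay in a box three times as large. *)
Definition box_in W (d : cbox) := 0 < box_radius d /\
  forall z, in_square (box_center d) (4 * box_radius d) z ->
    chart_img (box_chart d) z /\ W (coord_inv (box_chart d) z).

Definition box_set (d : cbox) : set X := [set x | chart_dom (box_chart d) x /\
  in_square (box_center d) (box_radius d) (coord (box_chart d) x)].

Lemma in_square_near (z0 : C) (r s : R) z u : in_square z0 r z -> nr u < s ->
  in_square z0 (r + s) (z + u).
Proof.
move=> [h1 h2] us; split.
  rewrite ReD addrAC (le_lt_trans (ler_normD _ _))// ltrD//.
  exact: le_lt_trans (Re_le_nr u) us.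
rewrite ImD addrAC (le_lt_trans (ler_normD _ _))// ltrD//.
exact: le_lt_trans (Im_le_nr u) us.
Qed.

(* Covers horizontal and vertical segments at once: [d p] is the distance of the
   puncture [p] to the line.  Punctures outside the chart have junk coordinates,
   but avoiding these too costs nothing more. *)
Lemma piece_segment W S (b : cbox) u v z w (be : R) (al d : X -> R) :
  box_in W b -> u < v -> nr w = `|be| -> `|be| * (v - u) <= 2 * box_radius b ->
  (forall t, u <= t <= v -> in_square (box_center b) (box_radius b) (aline z w t)) ->
  (forall p, p \in S -> 0 < d p /\
     forall t, nr (aline z w t - coord (box_chart b) p) = hyp (al p + be * t) (d p)) ->
  piece W S u v (chart_line (box_chart b) z w)
    (4 + 16 * (size S)%:R + 8 * Num.sqrt (2 * box_radius b) * \sum_(p <- S) rsq (d p)).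
Proof.
case: b => c z0 r [/= r0 hW] uv nw len sq hS.
have sq4 (t : R) x : u <= t <= v -> nr x < r -> in_square z0 (4 * r) (aline z w t + x).
  move=> tuv xr; have [h1 h2] := in_square_near (sq t tuv) xr.
  by split; [apply: (lt_le_trans h1)|apply: (lt_le_trans h2)]; lra.
have img t : u <= t <= v -> chart_img c (aline z w t) /\ W (chart_line c z w t).
  move=> tuv; have := hW (aline z w t + 0) (sq4 t 0 tuv _).
  by rewrite nr0 addr0; apply.
have hyp0 p t : p \in S -> 0 < hyp (al p + be * t) (d p).
  by move=> /hS[d0 _]; exact: hyp_gt0.
split.
- apply: smooth_chain1 => //.
  have near t : u <= t <= v -> exists2 e : R, 0 < e & forall s, `|s - t| < e -> chart_img c (aline z w s).
    move=> tuv; have [e e0 eP] := aline_near z w t r0; exists e => // s /eP h.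
    have := hW (aline z w t + (aline z w s - aline z w t)) (sq4 t _ tuv h).
    by rewrite addrC subrK => -[].
  have [e1 e10 e1P] := near u (introT andP (conj (lexx u) (ltW uv))).
  have [e2 e20 e2P] := near v (introT andP (conj (ltW uv) (lexx v))).
  exists (Order.min e1 e2), (chart_line c z w); split; rewrite ?lt_min ?e10//.
  apply: chart_line_smooth => t; rewrite /= in_itv /= => /andP[h1 h2].
  have m1 : Order.min e1 e2 <= e1 by rewrite ge_min lexx.
  have m2 : Order.min e1 e2 <= e2 by rewrite ge_min lexx orbT.
  have [tu|ut] := ltP t u.
    by apply: e1P; rewrite ltr_norml; apply/andP; split; lra.
  have [vt|tv] := ltP v t.
    by apply: e2P; rewrite ltr_norml; apply/andP; split; lra.
  by apply: (img t _).1; rewrite ut.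
- move=> t tuv; apply/negP => pS; have [ci _] := img t tuv.
  have [d0 /(_ t)] := hS _ pS; rewrite (coord_invP ci).2 subrr nr0 => E.
  by have := hyp0 _ t pS; rewrite -E ltxx.
(* A positive height for every point, so that [h p] is nonnegative and measurable without knowing
   that [p] lies in [S]. *)
pose d' p := if p \in S then d p else 1.
have d'0 p : 0 < d' p by rewrite /d'; case: ifPn => // /hS[].
pose h p t : R := 2 * (`|be| / hyp (al p + be * t) (d' p)).
have h0 p t : 0 <= h p t by rewrite mulr_ge0// divr_ge0// ltW// hyp_gt0.
pose k := 2 * `|be| / r.
have k0 : 0 <= k by rewrite divr_ge0 ?mulr_ge0// ltW.
pose f t : R := k + \sum_(p <- S) h p t.
have mh p : measurable_fun setT (h p).
  apply: continuous_measurable_fun => t; apply: cvgM; first exact: cvg_cst.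
  apply: cvgM; first exact: cvg_cst.
  apply: cvgV; first by rewrite gt_eqF// hyp_gt0.
  apply: (@continuous_comp _ _ _ (fun t => (al p + be * t) ^+ 2 + d' p ^+ 2) Num.sqrt).
    apply: (@differentiable_continuous _ _ _ _ (fun t => (al p + be * t) ^+ 2 + d' p ^+ 2)).
    by apply/derivable1_diffP.
  exact: sqrt_continuous.
have mf : measurable_fun setT f by apply: measurable_funD => //; exact: measurable_sum.
have f0 t : 0 <= f t by rewrite addr_ge0// sumr_ge0.
have mfE : measurable_fun setT (fun t => (f t)%:E) by exact/measurable_EFinP.
exists (fun t => (f t)%:E); split.
- exact: measurable_funTS.
- by move=> t; rewrite lee_fin.
- apply: (@le_trans _ _ (\int[mu]_(t in `[u, v]) (f t)%:E)%E).
    apply: ge0_subset_integral => //; first exact: measurable_funTS.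
      by move=> t _; rewrite lee_fin.
    exact: subset_itv_oo_cc.
  have -> : (\int[mu]_(t in `[u, v]) (f t)%:E =
     \int[mu]_(t in `[u, v]) (k%:E + \sum_(p <- S) (h p t)%:E))%E.
    by apply: eq_integral => t _; rewrite /f EFinD sumEFin.
  have mhE p : measurable_fun `[u, v] (fun t => (h p t)%:E).
    by apply/measurable_EFinP; exact: measurable_funTS.
  rewrite ge0_integralD//; last 2 first.
  + by move=> t _; apply: sume_ge0 => p _; rewrite lee_fin.
  + exact: emeasurable_sum.
  rewrite ge0_integral_sum//; last by move=> p t _; rewrite lee_fin.
  rewrite integral_cst//= lebesgue_measure_itv /= lte_fin uv -EFinB -EFinM.
  (* Twice the bound of [hyp_integral]; the factor 2 is that of the metric. *)
  have hp p : p \in S -> (\int[mu]_(t in `[u, v]) (h p t)%:E <=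
      (16 + 8 * Num.sqrt (2 * r) * rsq (d p))%:E)%E.
    move=> pS; have dp : d' p = d p by rewrite /d' pS.
    have -> : (\int[mu]_(t in `[u, v]) (h p t)%:E =
        2%:E * \int[mu]_(t in `[u, v]) (`|be| / hyp (al p + be * t) (d p))%:E)%E.
      rewrite -ge0_integralZl_EFin//.
      * by apply: eq_integral => t _; rewrite /h dp EFinM.
      * by move=> t _; rewrite lee_fin divr_ge0// ltW// hyp_gt0// -dp.
      * have -> : (fun t => (`|be| / hyp (al p + be * t) (d p))%:E) = (fun t => (2^-1 * h p t)%:E).
          by apply/funext => t; rewrite /h dp mulKf ?pnatr_eq0.
        apply: (eq_measurable_fun (fun t => ((2^-1)%:E * (h p t)%:E)%E)) => [t _|].
          by rewrite EFinM.
        exact: measurable_funeM.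
    have dp0 : 0 < d p by rewrite -dp.
    have := hyp_integral (al p) be uv dp0.
    have s1 : Num.sqrt (`|be| * (v - u)) <= Num.sqrt (2 * r) by rewrite ler_wsqrtr.
    have p2 : (0 <= (2 : R)%:E)%E by rewrite lee_fin.
    move=> /(lee_wpmul2l p2) H; apply: (le_trans H).
    rewrite -EFinM lee_fin.
    have := ler_wpM2r (rsq_ge0 (d p)) s1; lra.
  apply: (@le_trans _ _ ((k * (v - u))%:E + \sum_(p <- S) (16 + 8 * Num.sqrt (2 * r) * rsq (d p))%:E)%E).
    by apply: leeD => //; rewrite big_seq [leRHS]big_seq; apply: lee_sum.
  rewrite sumEFin -EFinD lee_fin big_split /= -mulr_sumr addrA lerD2r.
  rewrite big_const_seq count_predT iter_addr addr0 -[16 *+ _]mulr_natr lerD2r.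
  (* The segment has coordinate length at most [2 * r], so the border of the box contributes at most
     4. *)
  have -> : k * (v - u) = 2 * (`|be| * (v - u)) / r by rewrite /k; ring.
  by rewrite ler_pdivrMr//; lra.
- move=> t /andP[ut tv]; have tuv : u <= t <= v by rewrite !ltW.
  have [ci _] := img t tuv.
  (* The disc gets radius [T^-1], below [r] and below all distances to punctures; unlike the
     minimum, it makes the bound an exact sum, equal to [f t]. *)
  pose T := r^-1 + \sum_(p <- S) (nr (aline z w t - coord c p))^-1.
  have sum0 : 0 <= \sum_(p <- S) (nr (aline z w t - coord c p))^-1.
    by apply: sumr_ge0 => p _; rewrite invr_ge0 nr_ge0.
  have r1 : 0 < r^-1 by rewrite invr_gt0.
  have T0 : 0 < T by rewrite ltr_wpDr.
  have Tr : T^-1 <= r by rewrite -[leRHS]invrK lef_pV2 ?posrE// lerDl.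
  have Tp p : p \in S -> T^-1 <= nr (aline z w t - coord c p).
    move=> pS; have [d0 /(_ t) E] := hS _ pS; have n0 := hyp_gt0 (al p + be * t) d0.
    rewrite -[leRHS]invrK lef_pV2 ?posrE// ?invr_gt0 ?E// -E /T (big_rem p)//=.
    rewrite addrCA lerDl addr_ge0 ?(ltW r1)//; apply: sumr_ge0 => q _.
    by rewrite invr_ge0 nr_ge0.
  have -> : f t = 2 * nr w / T^-1.
    rewrite invrK nw /T mulrDr /f /k; congr (_ + _).
    rewrite mulr_sumr big_seq [RHS]big_seq; apply: eq_bigr => p pS.
    by have [d0 /(_ t) ->] := hS _ pS; rewrite /h /d' pS mulrA.
  apply: (@kobayashi_le _ _ M c (aline z w t) w); first by rewrite invr_gt0.
    move=> x xT; have [cx Wx] := hW _ (sq4 t x tuv (lt_le_trans xT Tr)).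
    split; [exact: cx|split; [exact: Wx|move=> /= xS]].
    have := Tp _ xS; rewrite (coord_invP cx).2 opprD addNKr nrN leNgt.
    by rewrite xT.
  by move=> e ed; exact: chart_line_velocity.
Qed.
End Pieces.

(** * Homotopies along a chain of boxes *)

Section Reach.
Context {R : realType} {X : topologicalType} (M : riemann_surface R X).
Local Notation C := (Cplx R).
Implicit Types (c : chart M) (b : cbox M) (z w : C) (W : set X) (S : seq X) (l r : R -> X).

Definition dist_re c x p : R := `|complex.Re (coord c x) - complex.Re (coord c p)|.
Definition dist_im c x p : R := `|complex.Im (coord c x) - complex.Im (coord c p)|.

(** [dist_im] and [dist_re] are the distances from a puncture to the horizontal and vertical lines
    through [x]: both lines are affordable at a [good] point. *)
Definition good c S (G : R) x :=
  (forall p, p \in S -> 0 < dist_re c x p /\ 0 < dist_im c x p) /\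
  \sum_(p <- S) (rsq (dist_re c x p) + rsq (dist_im c x p)) <= G * ((size S)%:R + 1).

Lemma good_le c S G G' x : G <= G' -> good c S G x -> good c S G' x.
Proof.
move=> GG [h1 h2]; split=> //; apply: (le_trans h2).
by rewrite ler_wpM2r// addr_ge0.
Qed.

Lemma good_sums c S G x : good c S G x ->
  \sum_(p <- S) rsq (dist_re c x p) <= G * ((size S)%:R + 1) /\
  \sum_(p <- S) rsq (dist_im c x p) <= G * ((size S)%:R + 1).
Proof.
move=> [_ h]; split; apply: le_trans h; apply: ler_sum => p _.
  by rewrite lerDl rsq_ge0.
by rewrite lerDr rsq_ge0.
Qed.

Lemma lipschitz_continuous (f : R -> R) (k : R) :
  (forall s t, `|f s - f t| <= k * `|s - t|) -> continuous f.
Proof.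
move=> h t A /nbhs_real[e e0 eA]; apply/nbhs_real.
have k0 : 0 < `|k| + 1 by rewrite ltr_wpDl.
exists (e / (`|k| + 1)); first by rewrite divr_gt0.
move=> s; rewrite ltr_pdivlMr// mulrC => st; apply: eA; apply: le_lt_trans st.
apply: (le_trans (h s t)); rewrite ler_wpM2r//.
by apply: (le_trans (ler_norm k)); rewrite lerDl.
Qed.

Lemma min_lip (m s t : R) : `|Order.min s m - Order.min t m| <= `|s - t|.
Proof.
have [sm|ms] := leP s m; have [tm|mt] := leP t m => //.
- rewrite !ler0_norm; lra.
- rewrite !ger0_norm; lra.
- by rewrite subrr normr0.
Qed.

Lemma max_lip (m s t : R) : `|Order.max s m - Order.max t m| <= `|s - t|.
Proof.
have [sm|ms] := leP s m; have [tm|mt] := leP t m => //.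
- by rewrite subrr normr0.
- rewrite !ler0_norm; lra.
- rewrite !ger0_norm; lra.
Qed.

(** The retraction of the line onto [u, v]; it extends paths and homotopies to globally continuous
    maps. *)
Definition clamp (u v t : R) : R := Order.max (Order.min t v) u.

Lemma clamp_lip u v s t : `|clamp u v s - clamp u v t| <= `|s - t|.
Proof. by apply: (le_trans (max_lip _ _ _)); exact: min_lip. Qed.

Lemma clamp_continuous u v : continuous (clamp u v).
Proof. by apply: (@lipschitz_continuous _ 1) => s t; rewrite mul1r clamp_lip. Qed.

Lemma clamp_itv u v t : u <= v -> u <= clamp u v t <= v.
Proof. by move=> uv; rewrite /clamp le_max lexx orbT /= ge_max uv ge_min lexx orbT. Qed.

Lemma clamp_id u v t : u <= t <= v -> clamp u v t = t.
Proof. by move=> /andP[ut tv]; rewrite /clamp min_l// max_l. Qed.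

Lemma convex_abs (p q x0 r0 s : R) : `|p - x0| < r0 -> `|q - x0| < r0 -> 0 <= s <= 1 ->
  `|(1 - s) * p + s * q - x0| < r0.
Proof.
move=> hp hq /andP[s0 s1]; have s1' : 0 <= 1 - s by rewrite subr_ge0.
have -> : (1 - s) * p + s * q - x0 = (1 - s) * (p - x0) + s * (q - x0) by ring.
apply: (le_lt_trans (ler_normD _ _)); rewrite !normrM (ger0_norm s0) (ger0_norm s1').
pose m := Order.max `|p - x0| `|q - x0|.
have mp : `|p - x0| <= m by rewrite le_max lexx.
have mq : `|q - x0| <= m by rewrite le_max lexx orbT.
apply: (@le_lt_trans _ _ m); last by rewrite gt_max hp.
have -> : m = (1 - s) * m + s * m by ring.
by apply: lerD; apply: ler_wpM2l.
Qed.

Lemma hline_continuous (T : topologicalType) (f g : T -> R) : continuous f -> continuous g ->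
  continuous (fun p => hline (g p) (f p)).
Proof.
move=> fc gc p A /nbhs_nr[e e0 eA].
have e2 : 0 < e / 2 by rewrite divr_gt0.
have hf : nbhs p (f @^-1` [set y | `|y - f p| < e / 2]).
  by apply: fc; apply/nbhs_real; exists (e / 2).
have hg : nbhs p (g @^-1` [set y | `|y - g p| < e / 2]).
  by apply: gc; apply/nbhs_real; exists (e / 2).
apply: filterS (filterI hf hg) => q [/= h1 h2]; apply: eA.
apply: (le_lt_trans (nr_le _)); rewrite ReD ImD ReN ImN !lineE.
by lra.
Qed.

Lemma Re_coord_continuous c (T : topologicalType) (f : T -> X) :
  continuous f -> (forall p, chart_dom c (f p)) ->
  continuous (fun p => complex.Re (coord c (f p))) /\
  continuous (fun p => complex.Im (coord c (f p))).
Proof.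
move=> fc fd.
have H p e : 0 < e -> nbhs p [set q | nr (coord c (f q) - coord c (f p)) < e].
  move=> e0; have h := Defs.coord_continuous (fd p).
  have : nbhs (f p) (coord c @^-1` [set w | nr (w - coord c (f p)) < e]).
    by apply: h; apply/nbhs_nr; exists e.
  by move=> /fc.
split=> p A /nbhs_real[e e0 eA]; apply: filterS (H p e e0) => q /= h; apply: eA;
  apply: le_lt_trans h.
  by rewrite -ReN -ReD Re_le_nr.
by rewrite -ImN -ImD Im_le_nr.
Qed.

(** The horizontal leg lies on the line through [A] and is paid by [dist_im] at [A]; the vertical
    leg lies on the line through [B] and is paid by [dist_re] at [B]. *)
Lemma corner_path W b G : box_in W b -> 0 <= G -> exists K, forall S A B u v, u < v ->
  box_set b A -> box_set b B -> good (box_chart b) S G A -> good (box_chart b) S G B ->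
  exists x y : R -> R,
    [/\ continuous x, continuous y,
      forall t, u <= t <= v -> in_square (box_center b) (box_radius b) (hline (y t) (x t)),
      hline (y u) (x u) = coord (box_chart b) A /\ hline (y v) (x v) = coord (box_chart b) B &
      piece M W S u v (fun t => coord_inv (box_chart b) (hline (y t) (x t))) (K * ((size S)%:R + 1))].
Proof.
move=> hb G0; set c := box_chart b; set r0 := box_radius b.
pose K1 := 16 + 8 * Num.sqrt (2 * r0) * G.
exists (K1 + K1) => S A B u v uv [cA [A1 A2]] [cB [B1 B2]] gA gB.
rewrite -/c in A1 A2 B1 B2; rewrite -/r0 in A1 A2 B1 B2.
set xA := complex.Re (coord c A) in A1; set yA := complex.Im (coord c A) in A2.
set xB := complex.Re (coord c B) in B1; set yB := complex.Im (coord c B) in B2.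
set x0 := complex.Re (box_center b) in A1 B1; set y0 := complex.Im (box_center b) in A2 B2.
pose m := (u + v) / 2.
have um : u < m by rewrite /m; lra.
have mv : m < v by rewrite /m; lra.
have um0 : 0 < m - u by rewrite subr_gt0.
have mv0 : 0 < v - m by rewrite subr_gt0.
(* [la] reaches 1 at [m] and stays there, [lb] stays 0 up to [m]: one formula gives both legs,
   continuous at the corner. *)
pose la t := (Order.min t m - u) / (m - u).
pose lb t := (Order.max t m - m) / (v - m).
pose x t := (1 - la t) * xA + la t * xB.
pose y t := (1 - lb t) * yA + lb t * yB.
have laI t : u <= t -> 0 <= la t <= 1.
  move=> ut; rewrite divr_ge0 ?(ltW um0)//; last by rewrite subr_ge0 le_min ut ltW.
  by rewrite ler_pdivrMr// mul1r lerD2r ge_min lexx orbT.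
have lbI t : t <= v -> 0 <= lb t <= 1.
  move=> tv; rewrite divr_ge0 ?(ltW mv0)//; last by rewrite subr_ge0 le_max lexx orbT.
  by rewrite ler_pdivrMr// mul1r lerD2r ge_max tv ltW.
have lac : continuous la.
  apply: (@lipschitz_continuous _ (m - u)^-1) => s t.
  rewrite /la -mulrBl normrM mulrC gtr0_norm ?invr_gt0// ler_pM2l ?invr_gt0//.
  by rewrite opprB addrA subrK min_lip.
have lbc : continuous lb.
  apply: (@lipschitz_continuous _ (v - m)^-1) => s t.
  rewrite /lb -mulrBl normrM mulrC gtr0_norm ?invr_gt0// ler_pM2l ?invr_gt0//.
  by rewrite opprB addrA subrK max_lip.
have aff (f : R -> R) p q : continuous f -> continuous (fun t => (1 - f t) * p + f t * q).
  move=> fc t; apply: cvgD; apply: cvgM; try exact: cvg_cst; last exact: fc.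
  by apply: cvgB; [exact: cvg_cst|exact: fc].
have sq t : u <= t <= v -> in_square (box_center b) r0 (hline (y t) (x t)).
  move=> /andP[ut tv]; rewrite /in_square !lineE; split; apply: convex_abs => //.
    exact: laI.
  exact: lbI.
have yu t : t <= m -> y t = yA.
  by move=> tm; rewrite /y /lb max_r// subrr mul0r; ring.
have xv t : m <= t -> x t = xB.
  by move=> mt; rewrite /x /la min_r// divff ?gt_eqF//; ring.
exists x, y; split; [exact: aff|exact: aff|exact: sq| |].
  split; first last.
    rewrite xv ?ltW//; have -> : y v = yB.
      by rewrite /y /lb max_l ?ltW// divff ?gt_eqF//; ring.
    by apply: ReImP; rewrite !lineE.
  rewrite yu ?ltW//; have -> : x u = xA.
    by rewrite /x /la min_l ?ltW// subrr mul0r; ring.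
  by apply: ReImP; rewrite !lineE.
rewrite mulrDl.
have n0 : 0 <= (size S)%:R :> R by [].
have s0 : 0 <= 8 * Num.sqrt (2 * r0) by rewrite mulr_ge0// sqrtr_ge0.
have cost (T : R) : T <= G * ((size S)%:R + 1) ->
    4 + 16 * (size S)%:R + 8 * Num.sqrt (2 * r0) * T <= K1 * ((size S)%:R + 1).
  move=> hT; have := ler_wpM2l s0 hT; rewrite /K1; lra.
have [sA1 sA2] := good_sums gA; have [sB1 sB2] := good_sums gB.
apply: (@piece_cat _ _ M W S u m v).
(* [b1] may be 0; the leg is then constant, which [piece_segment] allows. *)
- pose b1 := (xB - xA) / (m - u).
  have E t : u <= t <= m -> aline (hline yA (xA - b1 * u)) (rc b1) t = hline (y t) (x t).
    move=> /andP[ut tm]; rewrite yu// /x /la min_l//.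
    by apply: ReImP; rewrite /aline !(ReImE, lineE) /b1; field; rewrite gt_eqF.
  apply: (@piece_congr _ _ M W S u m (chart_line c (hline yA (xA - b1 * u)) (rc b1))).
    by move=> t tum; rewrite /chart_line E.
  apply: piece_le (cost _ sA2) _.
  apply: (@piece_segment _ _ M W S b u m _ _ b1 (fun p => xA - b1 * u - complex.Re (coord c p)) (dist_im c A)) => //.
  + by rewrite nr_rc.
  + rewrite /b1 normrM normfV (gtr0_norm um0) divfK ?gt_eqF// -/r0.
    have -> : xB - xA = (xB - x0) - (xA - x0) by ring.
    by apply: (le_trans (ler_normB _ _)); lra.
  + by move=> t /andP[ut tm]; rewrite E ?ut//; apply: sq; rewrite ut (le_trans tm)// ltW.
  + move=> p pS; split; first by have [_] := gA.1 _ pS.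
    move=> t; rewrite nr_sqrt /hyp /dist_im real_normK ?num_real//.
    by congr (Num.sqrt (_ ^+ 2 + _ ^+ 2)); rewrite /aline !(ReImE, lineE); ring.
- pose b2 := (yB - yA) / (v - m).
  have E t : m <= t <= v -> aline (hline (yA - b2 * m) xB) (ii * rc b2) t = hline (y t) (x t).
    move=> /andP[mt tv]; rewrite xv// /y /lb max_l//.
    by apply: ReImP; rewrite /aline !(ReImE, lineE) /b2; field; rewrite gt_eqF.
  apply: (@piece_congr _ _ M W S m v (chart_line c (hline (yA - b2 * m) xB) (ii * rc b2))).
    by move=> t tum; rewrite /chart_line E.
  apply: piece_le (cost _ sB1) _.
  apply: (@piece_segment _ _ M W S b m v _ _ b2 (fun p => yA - b2 * m - complex.Im (coord c p)) (dist_re c B)) => //.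
  + by rewrite nrM nr_ii mul1r nr_rc.
  + rewrite /b2 normrM normfV (gtr0_norm mv0) divfK ?gt_eqF// -/r0.
    have -> : yB - yA = (yB - y0) - (yA - y0) by ring.
    by apply: (le_trans (ler_normB _ _)); lra.
  + by move=> t /andP[mt tv]; rewrite E ?mt//; apply: sq; rewrite tv (le_trans _ mt)// ltW.
  + move=> p pS; split; first by have [] := gB.1 _ pS.
    move=> t; rewrite nr_sqrt /hyp /dist_re real_normK ?num_real// addrC.
    by congr (Num.sqrt (_ ^+ 2 + _ ^+ 2)); rewrite /aline !(ReImE, lineE); ring.
Qed.

(* Transfinite (Coons) interpolation of the boundary values on [0, 1] x [u, v]. *)
Definition coons (u v : R) (fa fx fl fr : R -> R) (s t : R) : R :=
  let h := (t - u) / (v - u) in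
  (1 - s) * fa t + s * fx t + ((1 - h) * (fl s - ((1 - s) * fa u + s * fx u))
    + h * (fr s - ((1 - s) * fa v + s * fx v))).

Section Coons.
Variables (u v : R) (fa fx fl fr : R -> R).
Hypothesis uv : u < v.
Local Notation F := (coons u v fa fx fl fr).

(** A convex combination within [r0] of [x0], plus a convex combination of two corrections, each a
    difference of values within [r0] of [x0]. This is the threefold enlargement that a box must
    accommodate. *)
Lemma coons_bound (x0 r0 s t : R) : 0 <= s <= 1 -> u <= t <= v ->
  (forall t, u <= t <= v -> `|fa t - x0| < r0) -> (forall t, u <= t <= v -> `|fx t - x0| < r0) ->
  (forall s, 0 <= s <= 1 -> `|fl s - x0| < r0) -> (forall s, 0 <= s <= 1 -> `|fr s - x0| < r0) ->
  `|F s t - x0| < 3 * r0.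
Proof.
move=> sI tI ha hx hl hr; have uI : u <= u <= v by rewrite lexx ltW.
have vI : u <= v <= v by rewrite lexx ltW.
have h1 := convex_abs (ha _ tI) (hx _ tI) sI.
have h2 := convex_abs (ha _ uI) (hx _ uI) sI.
have h3 := convex_abs (ha _ vI) (hx _ vI) sI.
have h4 := hl _ sI; have h5 := hr _ sI.
have vu : 0 < v - u by rewrite subr_gt0.
have hI : 0 <= (t - u) / (v - u) <= 1.
  move: tI => /andP[ut tv].
  by rewrite divr_ge0 ?subr_ge0// ?(ltW uv)//= ler_pdivrMr// mul1r lerD2r.
rewrite /coons; set h := (t - u) / (v - u) in hI *.
set p1 := (1 - s) * fa t + s * fx t in h1 *; set p2 := (1 - s) * fa u + s * fx u in h2 *.
set p3 := (1 - s) * fa v + s * fx v in h3 *.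
have q1 : `|(fl s - p2) - 0| < 2 * r0.
  have -> : fl s - p2 - 0 = (fl s - x0) - (p2 - x0) by ring.
  by apply: (le_lt_trans (ler_normB _ _)); lra.
have q2 : `|(fr s - p3) - 0| < 2 * r0.
  have -> : fr s - p3 - 0 = (fr s - x0) - (p3 - x0) by ring.
  by apply: (le_lt_trans (ler_normB _ _)); lra.
have := convex_abs q1 q2 hI; rewrite subr0 => h6.
rewrite addrAC (le_lt_trans (ler_normD _ _))//; lra.
Qed.

Lemma coons0 t : fl 0 = fa u -> fr 0 = fa v -> F 0 t = fa t.
Proof. by move=> h1 h2; rewrite /coons /= h1 h2; ring. Qed.

Lemma coons1 t : fl 1 = fx u -> fr 1 = fx v -> F 1 t = fx t.
Proof. by move=> h1 h2; rewrite /coons /= h1 h2; ring. Qed.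

Lemma coonsu s : F s u = fl s.
Proof. by rewrite /coons /= subrr mul0r; ring. Qed.

Lemma coonsv s : F s v = fr s.
Proof. by rewrite /coons /= divff ?subr_eq0 ?gt_eqF//; ring. Qed.

Lemma coons_continuous :
  continuous (fa \o clamp u v) -> continuous (fx \o clamp u v) ->
  continuous (fl \o clamp 0 1) -> continuous (fr \o clamp 0 1) ->
  continuous (fun p : R * R => F (clamp 0 1 p.1) (clamp u v p.2)).
Proof.
move=> ha hx hl hr.
have P1 (f : R -> R) : continuous f -> continuous (fun p : R * R => f p.1).
  by move=> fc p; apply: (@continuous_comp _ _ _ fst f); [exact: cvg_fst|exact: fc].
have P2 (f : R -> R) : continuous f -> continuous (fun p : R * R => f p.2).
  by move=> fc p; apply: (@continuous_comp _ _ _ snd f); [exact: cvg_snd|exact: fc].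
have s0 := P1 _ (@clamp_continuous 0 1); have t0 := P2 _ (@clamp_continuous u v).
have a0 := P2 _ ha; have x0 := P2 _ hx; have l0 := P1 _ hl; have r0 := P1 _ hr.
have K (k : R) (p : R * R) : (fun=> k) @ p --> k by exact: cvg_cst.
have s1 (p : R * R) : (fun p : R * R => 1 - clamp 0 1 p.1) @ p --> 1 - clamp 0 1 p.1.
  by apply: cvgB; [exact: K|exact: s0].
have h0 (p : R * R) : (fun p : R * R => (clamp u v p.2 - u) / (v - u)) @ p --> (clamp u v p.2 - u) / (v - u).
  by apply: cvgM; [apply: cvgB; [exact: t0|exact: K]|exact: K].
have lin (g : R * R -> R) (k k' : R) (p : R * R) : {for p, continuous g} ->
    {for p, continuous (fun p : R * R => g p - ((1 - clamp 0 1 p.1) * k + clamp 0 1 p.1 * k'))}.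
  move=> gc; apply: cvgB; first exact: gc.
  by apply: cvgD; apply: cvgM; [exact: s1|exact: K|exact: s0|exact: K].
move=> p; apply: cvgD.
  by apply: cvgD; apply: cvgM; [exact: s1|exact: a0|exact: s0|exact: x0].
apply: cvgD.
  by apply: cvgM; [apply: cvgB; [exact: K|exact: h0]|apply: lin; exact: l0].
by apply: cvgM; [exact: h0|apply: lin; exact: r0].
Qed.
End Coons.

Definition homotopy_data W (a : R -> X) (u v : R) l r (H : R * R -> X) :=
  [/\ continuous H, forall p, W (H p), forall t, u <= t <= v -> H (0, t) = a t,
      forall s, 0 <= s <= 1 -> H (s, u) = l s & forall s, 0 <= s <= 1 -> H (s, v) = r s].

(** The trace of an end point during a homotopy, from the point [x] of the old path to the junction
    [A]. *)
Definition edge b x A l :=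
  [/\ continuous l, forall s, 0 <= s <= 1 -> box_set b (l s), l 0 = x & l 1 = A].

(* [K] depends on [G] but not on the punctures [S], which only the final curve of
   the homotopy has to avoid.  The endpoints of that curve are given as [l 1], [r 1]. *)
Definition reach W (a : R -> X) b0 b1 (u v : R) := forall G, 0 <= G -> exists K, forall S A B l r,
  good (box_chart b0) S G A -> good (box_chart b1) S G B ->
  edge b0 (a u) A l -> edge b1 (a v) B r ->
  exists2 H, homotopy_data W a u v l r H &
    piece M W S u v (fun t => H (1, t)) (K * ((size S)%:R + 1)).

Lemma zero_in01 : 0 <= (0 : R) <= 1. Proof. by rewrite lexx ler01. Qed.
Lemma one_in01 : 0 <= (1 : R) <= 1. Proof. by rewrite lexx ler01. Qed.

(** Inside one box, the four boundary paths ([a], the L-shaped path, [l] and [r]) are filled by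
    Coons interpolation of the coordinates. *)
Lemma reach_base W (a : R -> X) b u v : box_in W b -> continuous a -> u < v ->
  (forall t, u <= t <= v -> box_set b (a t)) -> reach W a b b u v.
Proof.
move=> hb ac uv ab G G0; have [K KP] := corner_path hb G0; exists K.
move=> S A B l r gA gB [lc lb l0 l1] [rc' rb r0 r1].
have bA : box_set b A by rewrite -l1; apply: lb; exact: one_in01.
have bB : box_set b B by rewrite -r1; apply: rb; exact: one_in01.
have [x [y [xc yc xy [xyu xyv] pc]]] := KP S A B u v uv bA bB gA gB.
set c := box_chart b in pc xyu xyv *.
pose re (f : R -> X) t := complex.Re (coord c (f t)); pose im (f : R -> X) t := complex.Im (coord c (f t)).
pose F1 := coons u v (re a) x (re l) (re r); pose F2 := coons u v (im a) y (im l) (im r).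
pose H (p : R * R) := coord_inv c (hline (F2 (clamp 0 1 p.1) (clamp u v p.2)) (F1 (clamp 0 1 p.1) (clamp u v p.2))).
have uvI t := clamp_itv t (ltW uv); have sI s := clamp_itv s (@ler01 R).
have sqH p : in_square (box_center b) (4 * box_radius b)
    (hline (F2 (clamp 0 1 p.1) (clamp u v p.2)) (F1 (clamp 0 1 p.1) (clamp u v p.2))).
  have r00 := hb.1.
  have l3 : 3 * box_radius b < 4 * box_radius b by rewrite ltr_pM2r// ltr_nat.
  rewrite /in_square !lineE; split; apply: (lt_trans _ l3); apply: coons_bound => //.
  - by move=> t /ab[_ []].
  - by move=> t /xy[]; rewrite Re_hline.
  - by move=> s /lb[_ []].
  - by move=> s /rb[_ []].
  - by move=> t /ab[_ []].
  - by move=> t /xy[]; rewrite Im_hline.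
  - by move=> s /lb[_ []].
  - by move=> s /rb[_ []].
have compc (f : R -> X) p q : continuous f -> (forall t, p <= t <= q -> box_set b (f t)) -> p <= q ->
    continuous (re f \o clamp p q) /\ continuous (im f \o clamp p q).
  move=> fc fb pq; apply: (@Re_coord_continuous c R (f \o clamp p q)).
    by move=> t; apply: continuous_comp; [exact: clamp_continuous|exact: fc].
  by move=> t; have [] := fb _ (clamp_itv t pq).
have [a1 a2] := compc _ _ _ ac ab (ltW uv).
have [l3 l4] := compc _ _ _ lc lb (@ler01 R).
have [r3 r4] := compc _ _ _ rc' rb (@ler01 R).
have cc (f : R -> R) : continuous f -> continuous (f \o clamp u v).
  by move=> fc t; apply: continuous_comp; [exact: clamp_continuous|exact: fc].
have Hc : continuous H.
  move=> p; apply: (@continuous_comp _ _ _ (fun p : R * R => hline (F2 (clamp 0 1 p.1) (clamp u v p.2))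
      (F1 (clamp 0 1 p.1) (clamp u v p.2))) (coord_inv c)).
    by apply: hline_continuous; apply: coons_continuous => //; exact: cc.
  by apply: (@coord_inv_cvg _ _ M); have [] := hb.2 _ (sqH p).
have coordRI (z : X) : hline (complex.Im (coord c z)) (complex.Re (coord c z)) = coord c z.
  by apply: ReImP; rewrite !lineE.
have backA (z : X) : box_set b z -> coord_inv c (hline (complex.Im (coord c z)) (complex.Re (coord c z))) = z.
  by move=> [cz _]; rewrite coordRI coordK.
have xu : x u = re l 1 by rewrite /re l1 -xyu Re_hline.
have yu : y u = im l 1 by rewrite /im l1 -xyu Im_hline.
have xv : x v = re r 1 by rewrite /re r1 -xyv Re_hline.
have yv : y v = im r 1 by rewrite /im r1 -xyv Im_hline.
have H1 t : u <= t <= v -> H (1, t) = coord_inv c (hline (y t) (x t)).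
  by move=> tuv; rewrite /H /= (clamp_id one_in01) clamp_id// /F1 /F2 !coons1.
exists H; last first.
  by apply: piece_congr pc => t /H1.
split=> //.
- by move=> p; have [] := hb.2 _ (sqH p).
- move=> t tuv; rewrite /H /= (clamp_id zero_in01) clamp_id// /F1 /F2 !coons0 ?/re ?/im ?l0 ?r0//.
  by apply: backA; exact: ab.
- move=> s ss; rewrite /H /= (clamp_id ss) clamp_id ?lexx ?(ltW uv)// /F1 /F2 !coonsu.
  by apply: backA; exact: lb.
- move=> s ss; rewrite /H /= (clamp_id ss) clamp_id ?lexx ?(ltW uv)// /F1 /F2 !coonsv//.
  by apply: backA; exact: rb.
Qed.

Lemma glue_continuous (H1 H2 : R * R -> X) (m : R) : continuous H1 -> continuous H2 ->
  (forall s, H1 (s, m) = H2 (s, m)) ->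
  continuous (fun p : R * R => if p.2 <= m then H1 p else H2 p).
Proof.
move=> c1 c2 E p A Ap.
have sndc : {for p, continuous (snd : R * R -> R)} by exact: cvg_snd.
have h1 : p.2 <= m -> nbhs p (H1 @^-1` A) by move=> pm; apply: c1; move: Ap; rewrite /= pm.
have h2 : m <= p.2 -> nbhs p (H2 @^-1` A).
  move=> mp; apply: c2; move: Ap; rewrite /=; case: ifPn => // pm.
  have -> : p = (p.1, m) by case: p mp pm {sndc h1} => p1 p2 /= mp pm; congr pair; apply/eqP; rewrite eq_le pm.
  by rewrite E.
have [pm|mp|pm] := ltgtP p.2 m.
- have near : nbhs p (snd @^-1` [set y : R | y < m]) by apply: sndc; exact: lt_nbhsl.
  by apply: filterS (filterI near (h1 (ltW pm))) => q /= [qm Hq]; rewrite (ltW qm).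
- have near : nbhs p (snd @^-1` [set y : R | m < y]) by apply: sndc; exact: lt_nbhsr.
  by apply: filterS (filterI near (h2 (ltW mp))) => q /= [qm Hq]; rewrite leNgt qm.
- apply: filterS (filterI (h1 _) (h2 _)); rewrite ?pm// => q /= [q1 q2].
  by case: ifP.
Qed.
End Reach.

(** * Junction points and assembly *)

Section JunctionPoints.
Context {R : realType} {X : topologicalType} (M : riemann_surface R X).
Local Notation C := (Cplx R).
Implicit Types (c : chart M) (b : cbox M) (z w : C) (W : set X) (S : seq X) (l r : R -> X).

Lemma box_set_open b : open (box_set b).
Proof.
case: b => c z0 r0; rewrite openE => x [/= cx [h1 h2]].
have h := Defs.coord_continuous cx.
pose m := Order.min (r0 - `|complex.Re (coord c x) - complex.Re z0|)
  (r0 - `|complex.Im (coord c x) - complex.Im z0|).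
have m0 : 0 < m by rewrite lt_min !subr_gt0 h1.
have n1 : nbhs x (coord c @^-1` [set w | nr (w - coord c x) < m]).
  by apply: h; apply/nbhs_nr; exists m.
have n2 : nbhs x (chart_dom c) by apply: open_nbhs_nbhs; split=> //; exact: chart_dom_open.
apply: filterS (filterI n1 n2) => y [/= ym cy]; split=> //=.
move: ym; rewrite lt_min => /andP[y1 y2].
have r1 := Re_le_nr (coord c y - coord c x); have r2 := Im_le_nr (coord c y - coord c x).
rewrite ReD ReN in r1; rewrite ImD ImN in r2.
split.
  have -> : complex.Re (coord c y) - complex.Re z0 = (complex.Re (coord c y) - complex.Re (coord c x))
    + (complex.Re (coord c x) - complex.Re z0) by ring.
  by apply: (le_lt_trans (ler_normD _ _)); lra.
have -> : complex.Im (coord c y) - complex.Im z0 = (complex.Im (coord c y) - complex.Im (coord c x))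
  + (complex.Im (coord c x) - complex.Im z0) by ring.
by apply: (le_lt_trans (ler_normD _ _)); lra.
Qed.

Lemma exists_box W x : open W -> W x -> exists b, box_in W b /\ box_set b x.
Proof.
move=> Wo Wx; have : [set: X] x by [].
rewrite -(chart_cover M) => -[c _ cx].
have cz : chart_img c (coord c x) by exists x.
have Wx' : W (coord_inv c (coord c x)) by rewrite coordK.
have [e e0 eP] := coord_inv_near Wo cz Wx'.
(* In the square four times as large both coordinates vary by less than [e / 4], hence the point by
   less than [e]. *)
exists (CBox c (coord c x) (e / 16)); split; last first.
  by split=> //=; split; rewrite subrr normr0 divr_gt0.
split=> [|z [/= h1 h2]]; first by rewrite /= divr_gt0.
apply: eP; apply: (le_lt_trans (nr_le _)); rewrite ReD ImD ReN ImN.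
by lra.
Qed.

(** The mean value theorem: some [df x] is the slope between the two points, and its absolute value
    is at least [k]. *)
Lemma lower_lipschitz (f df : R -> R) (L k : R) :
  (forall x, 0 <= x <= L -> rderiv f x (df x) /\ k <= `|df x|) ->
  forall s s', 0 <= s <= L -> 0 <= s' <= L -> k * `|s - s'| <= `|f s - f s'|.
Proof.
move=> h; have main s s' : 0 <= s -> s' <= L -> s <= s' -> k * `|s' - s| <= `|f s' - f s|.
  move=> s0 s'L ss'.
  have inI x : s <= x <= s' -> 0 <= x <= L.
    by move=> /andP[sx xs]; rewrite (le_trans s0 sx) (le_trans xs s'L).
  have [x xI ->] : exists2 x, x \in `[s, s'] & f s' - f s = df x * (s' - s).
    apply: MVT_segment => //.
      move=> x; rewrite in_itv /= => /andP[sx xs].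
      have [|/rderiv_derivable[d1 d2] _] := h x; first by apply: inI; rewrite !ltW.
      by apply: DeriveDef; rewrite // -derive1E.
    apply: continuous_in_subspaceT => x; rewrite inE /= in_itv /= => /inI/h[/rderiv_derivable[d1 _] _].
    exact/differentiable_continuous/derivable1_diffP.
  rewrite normrM; apply: ler_wpM2r => //.
  by move: xI; rewrite in_itv /= => /inI/h[].
move=> s s' /andP[s0 sL] /andP[s0' sL']; have [ss|ss] := leP s s'.
  by rewrite distrC [leRHS]distrC; exact: main.
by apply: main => //; exact: ltW.
Qed.

(** By the chain rule, since the reverse transition composed with this one is the identity near
    [z]. *)
Lemma transition_deriv_neq0 c d z : overlap c d z -> derive1 (coord d \o coord_inv c) z != 0.
Proof.
move=> ov; have [cz dz] := ov; have h := transition_cderiv ov.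
have [cx xz] := coord_invP cz.
set z' := (coord d \o coord_inv c) z.
have ov' : overlap d c z'.
  by split; [exists (coord_inv c z)|rewrite /z' /= coordK].
have h' := transition_cderiv ov'.
have hid : cderiv ((coord c \o coord_inv d) \o (coord d \o coord_inv c)) z 1.
  apply: (@cderiv_ext _ id); last exact: cderiv_id.
  have [e e0 eP] := overlap_open ov; exists e => // w /eP[cw dw] /=.
  by rewrite coordK// (coord_invP cw).2.
have := cderiv_unique (cderiv_comp h h') hid.
by apply: contra_eq_neq => ->; rewrite mulr0 eq_sym oner_eq0.
Qed.

(** One of [k = 1], [k = 2] works: if the product of the two parts vanished for both, then
    [p * p = q * q] and [p * q = 0], so [v = 0]. The bound [1 <= k] gives the direction itself an
    imaginary part of at least 1. *)
Lemma generic_direction (v : C) : v != 0 -> exists2 k : R, 1 <= k &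
  complex.Re (v * (1 + ii * rc k)) != 0 /\ complex.Im (v * (1 + ii * rc k)) != 0.
Proof.
move=> v0; set p := complex.Re v; set q := complex.Im v.
have E k : complex.Re (v * (1 + ii * rc k)) = p - q * k /\ complex.Im (v * (1 + ii * rc k)) = p * k + q.
  rewrite !(ReM, ImM, ReD, ImD) Re_ii Im_ii Re_rc Im_rc (_ : complex.Re 1 = 1)// (_ : complex.Im 1 = 0)// -/p -/q.
  by split; ring.
have pq : p != 0 \/ q != 0.
  have [p0|] := eqVneq p 0; last by left.
  have [q0|] := eqVneq q 0; last by right.
  by move: v0; rewrite (cE v) -/p -/q p0 q0 !rc0 mulr0 addr0 eqxx.
have G k : 1 <= k -> (p - q * k) * (p * k + q) != 0 -> exists2 k : R, 1 <= k &
    complex.Re (v * (1 + ii * rc k)) != 0 /\ complex.Im (v * (1 + ii * rc k)) != 0.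
  move=> k1; rewrite mulf_eq0 negb_or => /andP[h1 h2]; exists k => //.
  by have [-> ->] := E k.
have [h1|] := eqVneq ((p - q * 1) * (p * 1 + q)) 0; last exact: G.
apply: (G 2); first by rewrite ler1n.
apply/eqP => h2; have pq0 : p * q = 0 by lra.
have pp : p * p = q * q by lra.
move/eqP: pq0; rewrite mulf_eq0 => /orP[/eqP p0|/eqP q0].
  by move: pp; rewrite p0 mul0r => /esym/eqP; rewrite mulf_eq0 orbb => /eqP q0; case: pq; rewrite ?p0 ?q0 eqxx.
by move: pp; rewrite q0 mul0r => /eqP; rewrite mulf_eq0 orbb => /eqP p0; case: pq; rewrite ?p0 ?q0 eqxx.
Qed.

Lemma aline_continuous z w : continuous (aline z w).
Proof.
move=> t A /nbhs_nr[e e0 eA]; apply/nbhs_real.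
by have [d d0 dP] := aline_near z w t e0; exists d => // s /dP/eA.
Qed.

(* The junction is chosen on a segment along which the real and imaginary parts of
   both coordinates vary at positive speed. *)
Lemma select_junction b1 b2 x : box_set b1 x -> box_set b2 x -> exists2 G : R, 0 <= G &
  forall S, exists A l, [/\ good (box_chart b1) S G A, good (box_chart b2) S G A,
    edge b1 x A l & edge b2 x A l].
Proof.
move=> B1 B2; set c1 := box_chart b1; set c2 := box_chart b2.
have cx1 : chart_dom c1 x by case: B1.
have cx2 : chart_dom c2 x by case: B2.
pose z := coord c1 x; have cz : chart_img c1 z by exists x.
have xz : coord_inv c1 z = x by rewrite coordK.
have ov : overlap c1 c2 z by split; rewrite ?xz.
pose F := coord c2 \o coord_inv c1.
have l0 := transition_deriv_neq0 ov; rewrite -/F in l0; set la := derive1 F z in l0.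
have [k k1 [hre him]] := generic_direction l0.
set e := 1 + ii * rc k in hre him.
have Ree : complex.Re e = 1 by rewrite /e !(ReD, ReM) Re_ii Im_rc (_ : complex.Re 1 = 1)//; ring.
have Ime : complex.Im e = k by rewrite /e !(ImD, ImM) Re_ii Im_ii Re_rc Im_rc (_ : complex.Im 1 = 0)//; ring.
have N0 : 0 < nr e by have := Re_le_nr e; rewrite Ree normr1; apply: lt_le_trans.
have Oo : open (box_set b1 `&` box_set b2) by apply: openI; exact: box_set_open.
have Ox : (box_set b1 `&` box_set b2) (coord_inv c1 z) by rewrite xz.
have [e1 e10 e1P] := coord_inv_near Oo cz Ox.
have [e2 e20 e2P] := overlap_open ov.
(* Differentiability of the derivative is used for its continuity: near [z] the direction seen in
   the second chart stays close to [la * e]. *)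
have [l hl] := holomorphic_derive1 e20 (fun w hw => ex_intro _ _ (transition_cderiv (e2P w hw))).
(* Half of the speed at [z]: a perturbation of at most [ka] leaves a speed of at least [ka] in both
   coordinates. *)
pose ka := Order.min `|complex.Re (la * e)| `|complex.Im (la * e)| / 2.
have ka0 : 0 < ka by rewrite divr_gt0// lt_min !normr_gt0 hre.
have [e3 e30 e3P] := cderiv_ccont hl (divr_gt0 ka0 N0).
pose m := Order.min (Order.min e1 e2) e3.
have m0 : 0 < m by rewrite !lt_min e10 e20.
pose L := m / (2 * nr e).
have L0 : 0 < L by rewrite divr_gt0// mulr_gt0.
have near s : 0 <= s <= L -> nr (aline z e s - z) < m.
  move=> /andP[s0 sL]; have -> : aline z e s - z = rc s * e by rewrite /aline; ring.
  rewrite nrM nr_rc ger0_norm//; apply: (@le_lt_trans _ _ (L * nr e)); first by rewrite ler_pM2r.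
  have -> : L * nr e = m / 2 by rewrite /L; field; rewrite gt_eqF.
  by rewrite ltr_pdivrMr// ltr_pMr// ltr1n.
have n1 s : 0 <= s <= L -> chart_img c1 (aline z e s) /\ (box_set b1 `&` box_set b2) (coord_inv c1 (aline z e s)).
  by move=> /near; rewrite !lt_min => /andP[/andP[/e1P]].
have n2 s : 0 <= s <= L -> overlap c1 c2 (aline z e s).
  by move=> /near; rewrite !lt_min => /andP[/andP[_ /e2P]].
have n3 s : 0 <= s <= L -> nr ((derive1 F (aline z e s) - la) * e) <= ka.
  move=> /near; rewrite !lt_min => /andP[_ /e3P]; rewrite -/F -/la nrM => /ltW h.
  by rewrite -ler_pdivlMr.
have kre : 2 * ka <= `|complex.Re (la * e)| by rewrite /ka mulrC divfK// ge_min lexx.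
have kim : 2 * ka <= `|complex.Im (la * e)| by rewrite /ka mulrC divfK// ge_min lexx orbT.
pose c := Order.min 1 ka.
have c0 : 0 < c by rewrite lt_min ltr01.
have c_1 : c <= 1 by rewrite ge_min lexx.
have c_k : c <= ka by rewrite ge_min lexx orbT.
pose f1 s := complex.Re (aline z e s); pose f2 s := complex.Im (aline z e s).
pose f3 s := complex.Re (F (aline z e s)); pose f4 s := complex.Im (F (aline z e s)).
have d12 s : rderiv f1 s (complex.Re e) /\ rderiv f2 s (complex.Im e).
  by have := cderiv_aline (cderiv_id (aline z e s)); rewrite mul1r.
have d34 s : 0 <= s <= L -> rderiv f3 s (complex.Re (derive1 F (aline z e s) * e)) /\
    rderiv f4 s (complex.Im (derive1 F (aline z e s) * e)).
  by move=> /n2/transition_cderiv/cderiv_aline.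
have split_la s : derive1 F (aline z e s) * e = la * e + (derive1 F (aline z e s) - la) * e by ring.
have L1 s s' : 0 <= s <= L -> 0 <= s' <= L -> c * `|s - s'| <= `|f1 s - f1 s'|.
  move: s s'; apply: (@lower_lipschitz f1 (fun=> complex.Re e)) => s _.
  by split; [exact: (d12 s).1|rewrite Ree normr1].
have L2 s s' : 0 <= s <= L -> 0 <= s' <= L -> c * `|s - s'| <= `|f2 s - f2 s'|.
  move: s s'; apply: (@lower_lipschitz f2 (fun=> complex.Im e)) => s _.
  split; first exact: (d12 s).2.
  by rewrite Ime (le_trans c_1)// (le_trans k1)// ler_norm.
have L3 s s' : 0 <= s <= L -> 0 <= s' <= L -> c * `|s - s'| <= `|f3 s - f3 s'|.
  move: s s'; apply: (@lower_lipschitz f3 (fun s => complex.Re (derive1 F (aline z e s) * e))) => s sL.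
  split; first exact: (d34 s sL).1.
  have h := le_trans (Re_le_nr _) (n3 s sL); rewrite split_la ReD.
  by have := ler_normB (complex.Re (la * e) + complex.Re ((derive1 F (aline z e s) - la) * e))
    (complex.Re ((derive1 F (aline z e s) - la) * e)); rewrite addrK; move: h kre c_k; clear; lra.
have L4 s s' : 0 <= s <= L -> 0 <= s' <= L -> c * `|s - s'| <= `|f4 s - f4 s'|.
  move: s s'; apply: (@lower_lipschitz f4 (fun s => complex.Im (derive1 F (aline z e s) * e))) => s sL.
  split; first exact: (d34 s sL).2.
  have h := le_trans (Im_le_nr _) (n3 s sL); rewrite split_la ImD.
  by have := ler_normB (complex.Im (la * e) + complex.Im ((derive1 F (aline z e s) - la) * e))
    (complex.Im ((derive1 F (aline z e s) - la) * e)); rewrite addrK; move: h kim c_k; clear; lra.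
have [K K0 KP] := select_parameter L0 c0.
exists (4 * K); first by rewrite mulr_ge0// ltW.
move=> S; set n := size S; pose pt (j : 'I_n) := nth x S j.
(* Four functions per puncture, for two coordinates in two charts, so that one selection makes the
   point [good] in both charts. *)
pose psi (j : ('I_n + 'I_n) + ('I_n + 'I_n)) s := match j with
  | inl (inl j) => `|f1 s - complex.Re (coord c1 (pt j))|
  | inl (inr j) => `|f2 s - complex.Im (coord c1 (pt j))|
  | inr (inl j) => `|f3 s - complex.Re (coord c2 (pt j))|
  | inr (inr j) => `|f4 s - complex.Im (coord c2 (pt j))| end.
have tri (f : R -> R) y : (forall s s', 0 <= s <= L -> 0 <= s' <= L -> c * `|s - s'| <= `|f s - f s'|) ->
    forall s s', 0 <= s <= L -> 0 <= s' <= L -> c * `|s - s'| <= `|f s - y| + `|f s' - y|.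
  move=> h s s' hs hs'; apply: (le_trans (h _ _ hs hs')).
  have -> : f s - f s' = (f s - y) - (f s' - y) by ring.
  exact: ler_normB.
have [||s sL [pos tot]] := KP _ psi.
- by move=> [[j|j]|[j|j]] s /=; exact: normr_ge0.
- by move=> [[j|j]|[j|j]] /=; apply: tri.
have [ci _] := n1 s sL.
pose A := coord_inv c1 (aline z e s).
have A1 : coord c1 A = aline z e s by rewrite (coord_invP ci).2.
have sum_nth (f : X -> R) : \sum_(p <- S) f p = \sum_(j < n) f (pt j).
  by rewrite (big_nth x) big_mkord.
have card4 : (#|{: ('I_n + 'I_n) + ('I_n + 'I_n)}|%:R + 1 : R) = 4 * n%:R + 1.
  by rewrite !card_sum !card_ord !natrD; ring.
have tot4 : \sum_j rsq (psi j s) <= 4 * K * (n%:R + 1).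
  apply: (le_trans tot); rewrite card4; have : 0 <= n%:R :> R by [].
  by move: K0; clear; nra.
have rs0 (J : finType) (f : J -> R) : 0 <= \sum_j rsq (f j) by apply: sumr_ge0 => j _; exact: rsq_ge0.
rewrite !big_sumType /= in tot4.
have mem p : p \in S -> exists j, p = pt j.
  by move=> pS; have h : (index p S < n)%N by [rewrite index_mem]; exists (Ordinal h); rewrite /pt /= nth_index.
have sI t : 0 <= clamp 0 1 t * s <= L.
  have /andP[t0 t1] := clamp_itv t (@ler01 R); move: (sL) => /andP[s0 sL'].
  by rewrite mulr_ge0//= (le_trans _ sL')// ler_piMl.
(* The part of the segment from [x] to [A] lies in both boxes, so the same path is an [edge] in
   each. *)
exists A, (fun t => coord_inv c1 (aline z e (clamp 0 1 t * s))).
have lc : continuous (fun t => coord_inv c1 (aline z e (clamp 0 1 t * s))).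
  move=> t; apply: (@continuous_comp _ _ _ (fun t => aline z e (clamp 0 1 t * s)) (coord_inv c1)).
    apply: (@continuous_comp _ _ _ (fun t => clamp 0 1 t * s) (aline z e)); last exact: aline_continuous.
    by apply: cvgM; [exact: clamp_continuous|exact: cvg_cst].
  by apply: (@coord_inv_cvg _ _ M); have [] := n1 _ (sI t).
have l00 : coord_inv c1 (aline z e (clamp 0 1 0 * s)) = x.
  by rewrite (clamp_id (zero_in01 (R := R))) mul0r /aline rc0 mul0r addr0.
have l11 : coord_inv c1 (aline z e (clamp 0 1 1 * s)) = A.
  by rewrite (clamp_id (one_in01 (R := R))) mul1r.
split.
- split.
    move=> p /mem[j ->]; rewrite /dist_re /dist_im A1; split.
      exact: (pos (inl (inl j))).
    exact: (pos (inl (inr j))).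
  rewrite sum_nth big_split /= /dist_re /dist_im A1; apply: le_trans tot4.
  by rewrite lerDl addr_ge0.
- split.
    move=> p /mem[j ->]; split; first exact: (pos (inr (inl j))).
    exact: (pos (inr (inr j))).
  rewrite sum_nth big_split /=; apply: le_trans tot4.
  by rewrite lerDr addr_ge0.
- by split=> // t _; have [_ []] := n1 _ (sI t).
- by split=> // t _; have [_ []] := n1 _ (sI t).
Qed.
End JunctionPoints.

(** Compactness of [0, 1] as a supremum argument: with [s] the supremum of the [v] such that
    [P 0 v], the local property at [s] extends some such [v] past [s] unless 1 is attained. *)
Lemma cousin (R : realType) (P : R -> R -> Prop) :
  (forall u m v, P u m -> P m v -> P u v) ->
  (forall t, 0 <= t <= 1 -> exists2 d : R, 0 < d &
    forall u v, t - d < u -> u < v -> v < t + d -> 0 <= u -> v <= 1 -> P u v) ->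
  P 0 1.
Proof.
move=> cat loc; pose E := [set v : R | 0 < v <= 1 /\ P 0 v].
have [d0 d00 d0P] := loc 0 (zero_in01 (R := R)).
have EN : E !=set0.
  exists (Order.min (d0 / 2) 1).
  have m0 : 0 < Order.min (d0 / 2) 1 by rewrite lt_min divr_gt0 ?ltr01.
  have m1 : Order.min (d0 / 2) 1 <= 1 by rewrite ge_min lexx orbT.
  split; first by rewrite m0.
  apply: d0P => //; first by rewrite sub0r oppr_lt0.
  by rewrite add0r gt_min ltr_pdivrMr// ltr_pMr// ltr1n.
have Eub : has_ubound E by exists 1 => v [/andP[]].
have Esup : has_sup E by [].
pose s := sup E.
have s1 : s <= 1 by apply: ge_sup => // v [/andP[]].
have s0 : 0 < s.
  by have [v [v01 Pv]] := EN; case/andP: (v01) => v0 _; apply: (lt_le_trans v0); apply: ub_le_sup.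
have [|d dd0 dP] := loc s; first by rewrite (ltW s0).
have [v [/andP[v0 v1] Pv] sv] := sup_adherent dd0 Esup.
have vs : v <= s by apply: ub_le_sup => //; split; [rewrite v0|].
(* [P 0 w] forces [w <= s], which excludes [w = s + d / 2]. *)
pose w := Order.min 1 (s + d / 2).
have w1 : w <= 1 by rewrite ge_min lexx.
have sw : s <= w by rewrite le_min s1 lerDl divr_ge0// ltW.
have wd : w < s + d.
  by rewrite gt_min orbC ltrD2l ltr_pdivrMr// ltr_pMr// ltr1n.
have Pw : P 0 w.
  have [vw|wv] := ltP v w; last by have -> : w = v by apply/eqP; rewrite eq_le wv (le_trans vs).
  by apply: (cat _ v) => //; apply: dP => //; exact: ltW.
have ws : w <= s.
  by apply: ub_le_sup => //; split; [rewrite w1 andbT (lt_le_trans s0)|].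
have E1 : w = 1.
  move: ws; rewrite /w; have [//|h] := leP 1 (s + d / 2).
  by rewrite leNgt ltrDl divr_gt0.
by rewrite -E1.
Qed.

Section Assembly.
Context {R : realType} {X : topologicalType} (M : riemann_surface R X).
Implicit Types (b : cbox M) (W : set X) (S : seq X) (l r : R -> X).

(** The junction near [a m] is [good] in the charts of [b1] and [b2] at once, and both halves move
    their common end along the same edge, so the homotopies agree there. *)
Lemma reach_cat W (a : R -> X) b0 b1 b2 b3 u m v : u < m -> m < v ->
  box_set b1 (a m) -> box_set b2 (a m) ->
  reach W a b0 b1 u m -> reach W a b2 b3 m v -> reach W a b0 b3 u v.
Proof.
move=> um mv a1 a2 h1 h2 G G0.
have [G' G'0 sel] := select_junction a1 a2.
(* [G'] depends on the two boxes at [a m] only, so [K1] and [K2] are still fixed before [S]. *)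
pose G2 := Order.max G G'.
have G20 : 0 <= G2 by rewrite le_max G0.
have GG2 : G <= G2 by rewrite le_max lexx.
have G'G2 : G' <= G2 by rewrite le_max lexx orbT.
have [K1 K1P] := h1 G2 G20; have [K2 K2P] := h2 G2 G20.
exists (K1 + K2) => S A B l r gA gB el er.
have [P [lm [g1 g2 e1 e2]]] := sel S.
have [H1 [H1c H1W H1a H1l H1r] p1] := K1P S A P l lm (good_le GG2 gA) (good_le G'G2 g1) el e1.
have [H2 [H2c H2W H2a H2l H2r] p2] := K2P S P B lm r (good_le G'G2 g2) (good_le GG2 gB) e2 er.
(* The two homotopies are known to agree at time [m] only for parameters in [0, 1]; clamping makes
   them agree for all. *)
pose H1' (p : R * R) := H1 (clamp 0 1 p.1, p.2); pose H2' (p : R * R) := H2 (clamp 0 1 p.1, p.2).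
have cl (H : R * R -> X) : continuous H -> continuous (fun p : R * R => H (clamp 0 1 p.1, p.2)).
  move=> Hc p; apply: (@continuous_comp _ _ _ (fun p : R * R => (clamp 0 1 p.1, p.2)) H); last exact: Hc.
  have c1 : (fun q : R * R => clamp 0 1 q.1) @ p --> clamp 0 1 p.1.
    by apply: (@continuous_comp _ _ _ fst (clamp 0 1)); [exact: cvg_fst|exact: clamp_continuous].
  have c2 : (fun q : R * R => q.2) @ p --> p.2 by exact: cvg_snd.
  exact: (cvg_pair c1 c2).
exists (fun p : R * R => if p.2 <= m then H1' p else H2' p); last first.
  rewrite mulrDl; apply: (@piece_cat _ _ M W S u m v).
    apply: piece_congr p1 => t /andP[_ tm]; rewrite /= tm /H1' /= clamp_id//; exact: one_in01.
  apply: piece_congr p2 => t /andP[mt _] /=; rewrite /H1' /H2' /= clamp_id ?one_in01//.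
  case: ifPn => // tm; have -> : t = m by apply/eqP; rewrite eq_le tm.
  by rewrite H1r ?H2l ?one_in01.
split.
- apply: glue_continuous; [exact: cl|exact: cl|].
  by move=> s; rewrite /H1' /H2' /= H1r ?H2l ?clamp_itv ?ler01.
- by move=> p; case: ifP => _; [exact: H1W|exact: H2W].
- move=> t /andP[ut tv] /=; rewrite /H1' /H2' /= clamp_id ?zero_in01//.
  case: ifPn => [tm|]; first by rewrite H1a// ut.
  by rewrite -ltNge => mt; rewrite H2a// tv ltW.
- by move=> s ss /=; rewrite (ltW um) /H1' /= clamp_id// H1l.
- by move=> s ss /=; rewrite leNgt mv /H2' /= clamp_id// H2r.
Qed.

(** The property fed to [cousin] allows arbitrary boxes at both ends, so that no choice of boxes
    must be remembered when intervals are joined. *)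
Lemma reach_all W (a : R -> X) b b' : open W -> continuous a -> (forall t, W (a t)) ->
  box_in W b -> box_in W b' -> box_set b (a 0) -> box_set b' (a 1) -> reach W a b b' 0 1.
Proof.
move=> Wo ac aW hb hb' ab ab'.
pose P u v := u < v /\ forall b b', box_in W b -> box_in W b' -> box_set b (a u) ->
  box_set b' (a v) -> reach W a b b' u v.
suff : P 0 1 by move=> [_]; exact.
have near (d : cbox M) t : box_set d (a t) -> exists2 e : R, 0 < e & forall s, `|s - t| < e -> box_set d (a s).
  by move=> dt; apply/nbhs_real; apply: ac; apply: open_nbhs_nbhs; split=> //; exact: box_set_open.
apply: cousin => [u m v [um Pum] [mv Pmv]|t _].
  split; first exact: lt_trans mv.
  move=> d d' hd hd' du dv; have [e [he em]] := exists_box M Wo (aW m).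
  by apply: (@reach_cat W a d e e d' u m v) => //; [exact: Pum|exact: Pmv].
have [e [he et]] := exists_box M Wo (aW t).
have [dl dl0 dlP] := near _ _ et; exists dl => // u v tu uv vt _ _; split=> // d d' hd hd' du dv.
have inE s : u <= s <= v -> box_set e (a s).
  move=> /andP[us sv]; apply: dlP; rewrite ltr_norml; apply/andP; split; lra.
have [d1 d10 d1P] := near _ _ du; have [d2 d20 d2P] := near _ _ dv.
(* Three pieces: a start short enough for [d], a middle in [e], an end short enough for [d']; the
   third of [v - u] keeps the middle nonempty. *)
pose k := Order.min (Order.min d1 d2 / 2) ((v - u) / 3).
have k0 : 0 < k by rewrite lt_min !divr_gt0// ?lt_min ?d10// subr_gt0.
have k3 : k <= (v - u) / 3 by rewrite ge_min lexx orbT.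
have kd : k < Order.min d1 d2.
  by rewrite gt_min ltr_pdivrMr ?ltr_pMr ?ltr1n// lt_min d10.
have kd1 : k < d1 by apply: (lt_le_trans kd); rewrite ge_min lexx.
have kd2 : k < d2 by apply: (lt_le_trans kd); rewrite ge_min lexx orbT.
have um : u < u + k by lra.
have mm : u + k < v - k by lra.
have mv : v - k < v by lra.
have D1 s : u <= s <= u + k -> box_set d (a s).
  move=> /andP[us sv]; apply: d1P; rewrite ltr_norml; apply/andP; split; lra.
have D2 s : v - k <= s <= v -> box_set d' (a s).
  move=> /andP[us sv]; apply: d2P; rewrite ltr_norml; apply/andP; split; lra.
apply: (@reach_cat W a d d e d' u (u + k) v) => //; first exact: lt_trans mv.
- by apply: D1; rewrite lexx ltW.
- by apply: inE; rewrite (ltW um) ltW//; exact: lt_trans mv.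
- exact: reach_base.
apply: (@reach_cat W a e e d' d' (u + k) (v - k) v) => //.
- by apply: inE; rewrite (ltW mv) andbT ltW//; exact: lt_trans mm.
- by apply: D2; rewrite lexx ltW.
- apply: reach_base => // s /andP[s1 s2]; apply: inE.
  by rewrite (le_trans (ltW um) s1) (le_trans s2 (ltW mv)).
- exact: reach_base.
Qed.

(** The same junction and the same edge serve at both ends, which keeps every stage of the homotopy
    closed. *)
Lemma loop_bound W (a : R -> X) : open W -> continuous a -> (forall t, W (a t)) -> a 0 = a 1 ->
  exists2 L : R, 0 < L & forall S, exists H : R * R -> X,
    [/\ continuous H, forall p, W (H p), forall t, 0 <= t <= 1 -> H (0, t) = a t,
        forall s, 0 <= s <= 1 -> H (s, 0) = H (s, 1) &
        piece M W S 0 1 (fun t => H (1, t)) (L * ((size S)%:R + 1))].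
Proof.
move=> Wo ac aW a01; have [b [hb b0]] := exists_box M Wo (aW 0).
have b1 : box_set b (a 1) by rewrite -a01.
have [G G0 sel] := select_junction b0 b0.
have [K KP] := reach_all Wo ac aW hb hb b0 b1 G0.
exists (`|K| + 1); first by rewrite ltr_wpDl.
move=> S; have [A [l [gA _ el _]]] := sel S.
have el1 : edge b (a 1) A l by rewrite -a01.
have [H [Hc HW Ha Hl Hr] pc] := KP S A A l l gA gA el el1.
exists H; split=> //; first by move=> s s01; rewrite Hl// Hr.
apply: piece_le pc; rewrite ler_wpM2r ?addr_ge0//.
by apply: (le_trans (ler_norm K)); rewrite lerDl.
Qed.
End Assembly.

(** * Continuity of clamped loops and closedness of the discs *)

Section LoopsAndDiscs.
Context {R : realType} {X : topologicalType}.
Implicit Types (a : R -> X) (W : set X).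

Lemma loop_clamp_continuous W a : loop_in W a -> continuous (a \o clamp 0 1).
Proof.
move=> [ac _ _] t A At.
have I01 : (`[0, 1]%classic : set R) (clamp 0 1 t) by rewrite /= in_itv /= clamp_itv.
have h : @nbhs_subspace R (`[0, 1]%classic : set R) (clamp 0 1 t) (a @^-1` A).
  exact: ac (clamp 0 1 t) A At.
rewrite -nbhs_subspace_in// in h.
have h' : nbhs t (clamp 0 1 @^-1` [set s | `[0, 1]%classic s -> A (a s)]).
  exact: (@clamp_continuous R 0 1 t _ h).
suff : nbhs t ((a \o clamp 0 1) @^-1` A) by [].
apply: filterS h' => s /= Bs; apply: Bs.
by rewrite /= in_itv /= clamp_itv.
Qed.

Lemma unit_disc_compact : compact [set z : Cplx R | `|z| <= 1].
Proof.
have E (z : Cplx R) : (`|z| <= 1) = (nr z <= 1).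
  rewrite nrE -rc1; have -> : (nr z <= 1) = (0 <= 1 - nr z) by rewrite subr_ge0.
  rewrite -subr_ge0 -rcB; set x := 1 - nr z.
  by rewrite !le_eqVlt rc_gt0 -rc0 (inj_eq (@complexI R)).
pose Q := (fun p : R * R => hline p.2 p.1) @` (`[-1, 1] `*` `[-1, 1]).
have Qc : compact Q.
  apply: continuous_compact; last by apply: compact_setX; exact: segment_compact.
  apply: continuous_subspaceT; apply: hline_continuous => p; [exact: cvg_fst|exact: cvg_snd].
have -> : [set z : Cplx R | `|z| <= 1] = Q `&` [set z | nr z <= 1].
  apply/seteqP; split=> z /=; rewrite E; last by case.
  move=> z1; split=> //; exists (complex.Re z, complex.Im z) => /=; last first.
    by apply: ReImP; rewrite !lineE.
  have := Re_le_nr z; have := Im_le_nr z; rewrite !in_itv /= -!ler_norml => h1 h2.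
  by split; [apply: (le_trans h2)|apply: (le_trans h1)].
apply: compact_closedI => //.
have -> : [set z : Cplx R | nr z <= 1] = ~` [set z | 1 < nr z].
  by apply/seteqP; split=> z /=; rewrite leNgt => /negP.
apply: open_closedC; rewrite openE => z /= z1; apply/nbhs_nr.
exists (nr z - 1); first by rewrite subr_gt0.
by move=> w wz /=; have := ler_nrB z w; rewrite nrB; lra.
Qed.

(** Each disc is a continuous image of a compact set, hence closed in a Hausdorff space. *)
Lemma complement_discs_open (n : nat) (D : 'I_n -> set X) : hausdorff_space X ->
  (forall j, closed_disc R (D j)) -> open (~` (\bigcup_j D j)).
Proof.
move=> hX hD; apply: closed_openC; apply: closed_bigcup; first exact: finite_finset.
move=> j _; have [f [_ [<- fc _ _]]] := hD j.
by apply: compact_closed => //; apply: continuous_compact => //; exact: unit_disc_compact.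
Qed.
End LoopsAndDiscs.


Theorem theoremB (R : realType) (B : topologicalType) (M : riemann_surface R B)
    (compactB : compact [set: B]) (connectedB : connected [set: B])
    (m : nat) (D : 'I_m -> set B)
    (discD : forall i, closed_disc R (D i))
    (disjD : forall i j, i != j -> D i `&` D j = set0)
    (B0 := ~` (\bigcup_i D i))
    (b : B) (B0b : B0 b)
    (alpha : set (R -> B)) (alpha_pi1 : pi1 B0 b alpha)
    (alpha_neq0 : alpha <> pi1_unit B0 b) :
  exists2 L : R, 0 < L &
    forall S : {fset B}, [set` S] `<=` B0 ->
      exists gamma : R -> B,
        [/\ piecewise_smooth M gamma,
            loop_in (B0 `\` [set` S]) gamma,
            represents_free_class B0 alpha gamma &
            (kobayashi_length M (B0 `\` [set` S]) gamma
               <= (L * (#|` S| + 1)%:R)%:E)%E].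
Proof.
have B0open : open B0 by apply: complement_discs_open => //; exact: surface_hausdorff M.
move: alpha_pi1 => [a [la a0] def_alpha].
have [_ aB0 a01] := la.
pose ac := a \o clamp 0 1.
have acc : continuous ac := loop_clamp_continuous la.
have acB0 t : B0 (ac t).
  by apply: aB0; exists (clamp 0 1 t) => //=; rewrite in_itv /= clamp_itv.
have acE t : (`[0, 1]%classic : set R) t -> ac t = a t.
  by rewrite /= in_itv /= => t01; rewrite /ac /= clamp_id.
have ac01 : ac 0 = ac 1 by rewrite !acE//= in_itv /= ?lexx ?ler01.
have [L L0 LP] := loop_bound M B0open acc acB0 ac01.
exists L => // S SB0; have [H [Hc HB0 Ha Hs pc]] := LP (enum_fset S).
have I0 : (`[0, 1]%classic : set R) 0 by rewrite /= in_itv /= lexx ler01.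
have I1 : (`[0, 1]%classic : set R) 1 by rewrite /= in_itv /= lexx ler01.
exists (fun t => H (1, t)); have [smooth len] := piece_length pc; split=> //.
- split.
  + apply: continuous_subspaceT => t.
    apply: (@continuous_comp _ _ _ (fun t : R => ((1 : R), t)) H); last exact: Hc.
    have c1 : (fun _ : R => (1 : R)) @ t --> (1 : R) by exact: cvg_cst.
    have c2 : (fun s : R => s) @ t --> t by exact: cvg_id.
    exact: (cvg_pair c1 c2).
  + move=> _ [t /= t01 <-]; split; first exact: HB0.
    by case: pc => _ /(_ t) + _ => /=; move: t01; rewrite in_itv /= => -> /(_ isT)/negP.
  + by rewrite Hs// lexx ler01.
- exists ac.
    (* [ac] coincides with [a] on [0, 1], so the constant homotopy shows that it belongs to
       [alpha]. *)
    rewrite -def_alpha; exists (fun p : R * R => ac p.2); split; [split|].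
    + apply: continuous_subspaceT => p.
      by apply: (@continuous_comp _ _ _ snd ac); [exact: cvg_snd|exact: acc].
    + by move=> _ [p _ <-].
    + by move=> t t01 /=; rewrite acE.
    + by [].
    + by move=> s _ /=; rewrite !acE.
  exists H; split; [split|].
  + exact: continuous_subspaceT.
  + by move=> _ [p _ <-].
  + by move=> t; rewrite /= in_itv /=; exact: Ha.
  + by [].
  + by move=> s; rewrite /= in_itv /=; exact: Hs.
- by rewrite natrD.
Qed.
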